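(* Let $n_+,n_-\ge 1$ be integers, $n=n_++n_-$, and let $B$ be the indefinite Kirchhoff Laplacian on the star graph $G$ with $n$ unit edges (defined in the context). Then $B$ is a positive operator in the Krein space $(L^2(G),[\cdot,\cdot])$, $0\in\rho(B)$, the spectrum of $B$ is purely discrete, real and $$ \sigma(B)=\sigma_p(B)= \begin{cases} \{-(k\pi)^2: k\in\mathbb N\}\cup\{\eta_k : k\in\mathbb Z\setminus\{0\}\}, & \text{if } n_+=1,\\ \{(k\pi)^2: k\in\mathbb N\}\cup\{\eta_k : k\in\mathbb Z\setminus\{0\}\}, & \text{if } n_-=1,\\ \{\operatorname{sign}(k)(k\pi)^2: k\in\mathbb Z\setminus\{0\}\}\cup\{\eta_k : k\in\mathbb Z\setminus\{0\}\}, & \text{if } n_+\ge 2,\ n_-\ge 2, \end{cases} $$ where $\eta_k$ is the unique solution of (i) $\coth(\sqrt{\eta_k})=-\frac{n_+}{n_-}\cot(\sqrt{\eta_k})$ in the interval $\big(((k-1)\pi)^2,(k\pi)^2\big)$ if $k\ge 1$, (ii) $\coth(\sqrt{-\eta_k})=-\frac{n_-}{n_+}\cot(\sqrt{-\eta_k})$ in the interval $\big(-(k\pi)^2,-((k+1)\pi)^2\big)$ if $k\le -1$. In particular, $-\pi^2<\eta_{-1}<0<\eta_1<\pi^2$, and $-(k\pi)^2<\eta_k<-((k+1)\pi)^2$ for $k\le -2$, and $((k-1)\pi)^2<\eta_k<(k\pi)^2$ for $k\ge 2$. The multiplicity of $(k\pi)^2$ as an eigenvalue of $B$ is $n_+-1$,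 while the multiplicity of $-(k\pi)^2$ is $n_--1$. Each $\eta_k$ has multiplicity $1$. Moreover, the eigenvalues $\eta_k$ satisfy the asymptotic behavior $$ \eta_k\approx \begin{cases} \left(k\pi-\arctan\frac{n_-}{n_+}\right)^2 & \text{for } k\to\infty,\\[1ex] -\left(k\pi-\arctan\frac{n_+}{n_-}\right)^2 & \text{for } k\to-\infty. \end{cases} $$ Therefore, the spectrum of $B$ is symmetric with respect to the origin if and only if $n_+=n_-$.
   Context: $\mathbb N=\{1,2,3,\dots\}$. $G$ is a star graph with $n=n_++n_-$ edges $I_1,\dots,I_n$, each identified with $(0,1)$, all joined at the central vertex $0$; the outer vertices correspond to the endpoint $1$. $L^2(G)=\bigoplus_{j=1}^n L^2((0,1))$ with $\langle f,g\rangle=\sum_{j=1}^n\int_0^1 f_j\overline{g_j}\,dt$. The Krein space inner product is $[f,g]=\sum_{j=1}^{n_+}\int_0^1 f_j\overline{g_j}\,dt-\sum_{j=n_++1}^{n}\int_0^1 f_j\overline{g_j}\,dt$. The operator $B$ in $L^2(G)$ has domain $$\mathcal D(B)=\Big\{f=(f_1,\dots,f_n): f_j\in H^2((0,1)),\ f_j(1)=0\ \text{for all } j,\ f_1(0)=\dots=f_n(0),\ \sum_{j=1}^n f_j'(0)=0\Big\}$$ and acts as $(Bf)_j=-f_j''$ for $1\le j\le n_+$ and $(Bf)_j=f_j''$ for $n_++1\le j\le n$. An operator $B$ is called positive in the Krein space if $[Bf,f]>0$ for all $f\in\mathcal D(B)\setminus\{0\}$. $\rho,\sigma,\sigma_p$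 denote resolvent set, spectrum and point spectrum. Multiplicity means algebraic multiplicity.
   Formalization: Cases n₊=1 and n₋=1 clash at n₊=n₋=1: they are read with the other number ≥2, and σ(B)={η_k} when both are 1. ''≈'' is read as ratio →1; also proved: √η_k−(kπ−arctan(n₊/n₋))→0 as k→∞ and √(−η_{−k})−(kπ−arctan(n₋/n₊))→0, since the printed arctans are wrong in this sense. *)

(* Defs.v *)
From HB Require Import structures.
From mathcomp Require Import all_boot all_order all_algebra.
From mathcomp Require Import complex ring.
From mathcomp Require Import all_classical all_reals all_analysis.
From mathcomp Require Import measurable_realfun.

Set Implicit Arguments.
Unset Strict Implicit.
Unset Printing Implicit Defensive.

Import Order.TTheory GRing.Theory Num.Theory.
Import numFieldNormedType.Exports.

Local Open Scope classical_set_scope.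
Local Open Scope ring_scope.
Local Open Scope complex_scope.
Local Open Scope quotient_scope.

Definition cot (R : realType) (x : R) : R := cos x / sin x.
Definition coth (R : realType) (x : R) : R :=
  (expR x + expR (- x)) / (expR x - expR (- x)).

Section L2_interval.
Variable R : realType.
Local Notation C := (R[i]).
Local Notation mu := (@lebesgue_measure R).

Definition unit_itv : set R := `]0, 1[.
Local Notation I := unit_itv.

(* The library integrates real and extended real functions only: integrability,
   integrals and continuity of complex functions are taken componentwise. *)
Definition cintegral (f : R -> C) : C :=
  (\int[mu]_(x in I) complex.Re (f x)) +i* (\int[mu]_(x in I) complex.Im (f x)).

Definition square_integrable (f : R -> C) : Prop :=
  [/\ measurable_fun I (fun x => complex.Re (f x)),
      measurable_fun I (fun x => complex.Im (f x)) &
      mu.-integrable I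
        (fun x => (complex.Re (f x) ^+ 2 + complex.Im (f x) ^+ 2)%:E)].

Definition L2pred : {pred (R -> C^o)} := [pred f | `[< square_integrable f >]].

Lemma unit_itv_measurable : measurable I.
Proof. exact: measurable_itv. Qed.
Hint Resolve unit_itv_measurable : core.

Lemma L2predP (f : R -> C^o) : reflect (square_integrable f) (f \in L2pred).
Proof. exact: asboolP. Qed.

Lemma L2pred_submod_closed : submod_closed L2pred.
Proof.
split=> [|a f g].
  apply/L2predP.
  have z : (fun x : R => (complex.Re ((0 : R -> C^o) x) ^+ 2 +
     complex.Im ((0 : R -> C^o) x) ^+ 2)%:E) = cst 0%E.
    by apply/funext => x /=; rewrite expr0n addr0.
  split; [exact: measurable_cst|exact: measurable_cst|].
  rewrite z; exact: integrable0.
move=> /L2predP[mf1 mf2 intf] /L2predP[mg1 mg2 intg]; apply/L2predP.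
have E x : (a *: f + g) x = (a : C) * f x + g x by [].
have Ef x : complex.Re ((a *: f + g) x) =
    complex.Re a * complex.Re (f x) - complex.Im a * complex.Im (f x)
    + complex.Re (g x).
  by rewrite E; case: (a) (f x) (g x) => [? ?] [? ?] [? ?].
have Eg x : complex.Im ((a *: f + g) x) =
    complex.Re a * complex.Im (f x) + complex.Im a * complex.Re (f x)
    + complex.Im (g x).
  by rewrite E; case: (a) (f x) (g x) => [? ?] [? ?] [? ?].
have m1 : measurable_fun I (fun x => complex.Re ((a *: f + g) x)).
  under eq_fun do rewrite Ef.
  apply: measurable_funD => //; apply: measurable_funB; exact: measurable_funM.
have m2 : measurable_fun I (fun x => complex.Im ((a *: f + g) x)).
  under eq_fun do rewrite Eg.
  apply: measurable_funD => //; apply: measurable_funD; exact: measurable_funM.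
split => //.
pose c := 2 * (complex.Re a ^+ 2 + complex.Im a ^+ 2).
have intc : mu.-integrable I (fun x =>
    (c * (complex.Re (f x) ^+ 2 + complex.Im (f x) ^+ 2) +
     2 * (complex.Re (g x) ^+ 2 + complex.Im (g x) ^+ 2))%:E).
  have h := integrableZl _ c intf; have k := integrableZl _ 2 intg.
  exact: (integrableD _ (h _) (k _)).
move: intc.
apply: le_integrable => //.
  apply/measurable_EFinP; apply: measurable_funD; exact: measurable_funX.
move=> x _ /=; rewrite lee_fin.
have h0 (u v : R) : 0 <= u ^+ 2 + v ^+ 2 by rewrite addr_ge0 ?sqr_ge0.
rewrite Ef Eg ger0_norm ?h0// ger0_norm; last first.
  by rewrite addr_ge0// mulr_ge0// mulr_ge0.
rewrite /c -subr_ge0.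
move: (complex.Re (f x)) (complex.Im (f x)) (complex.Re (g x))
  (complex.Im (g x)) (complex.Re a) (complex.Im a) => p q r s y z.
rewrite (_ : _ - _ = (y * p - z * q - r) ^+ 2 + (y * q + z * p - s) ^+ 2)//.
by rewrite !expr2 !(mulrDl, mulrDr, mulrBl, mulrBr); ring.
Qed.

HB.instance Definition _ := GRing.isSubmodClosed.Build C (R -> C^o) L2pred
  L2pred_submod_closed.

Record L2fun := MkL2fun { L2val :> R -> C^o ; _ : L2val \in L2pred }.
HB.instance Definition _ := [isSub for L2val].
HB.instance Definition _ := [Choice of L2fun by <:].
HB.instance Definition _ := [SubChoice_isSubLmodule of L2fun by <:].

Lemma L2funN (f : L2fun) x : (- f) x = - f x.
Proof. by []. Qed.

Lemma L2funD (f g : L2fun) x : (f + g) x = f x + g x.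
Proof. by []. Qed.

Lemma L2funZ (a : C) (f : L2fun) x : (a *: f) x = (a : C) * f x.
Proof. by []. Qed.

End L2_interval.

Section L2_quotient.
Variable R : realType.
Local Notation C := (R[i]).
Local Notation mu := (@lebesgue_measure R).
Local Notation I := (@unit_itv R).

Definition L2_ae_eq (f g : L2fun R) : bool := `[< ae_eq mu I f g >].

Lemma L2_ae_eq_refl : reflexive L2_ae_eq.
Proof. by move=> f; apply/asboolP; exact: ae_eq_refl. Qed.

Lemma L2_ae_eq_sym : symmetric L2_ae_eq.
Proof.
by move=> f g; apply/idP/idP => /asboolP h; apply/asboolP; exact: ae_eq_sym.
Qed.

Lemma L2_ae_eq_trans : transitive L2_ae_eq.
Proof.
move=> g f h /asboolP fg /asboolP gh; apply/asboolP; exact: ae_eq_trans fg gh.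
Qed.

Canonical L2_ae_eq_equiv :=
  EquivRel L2_ae_eq L2_ae_eq_refl L2_ae_eq_sym L2_ae_eq_trans.

Definition L2 : Type := {eq_quot L2_ae_eq}.
HB.instance Definition _ := Choice.on L2.
HB.instance Definition _ := EqQuotient.on L2.

Definition L2_class (f : L2fun R) : L2 := \pi_L2 f.
Definition L2_repr (f : L2) : R -> C := repr f.
Coercion L2_repr : L2 >-> Funclass.

Lemma L2_classP (f g : L2fun R) :
  L2_class f = L2_class g <-> ae_eq mu I f g.
Proof.
split=> [/eqP|] h; last by apply/eqP; rewrite eqmodE; apply/asboolP.
by move: h; rewrite eqmodE => /asboolP.
Qed.

Lemma L2_class_repr (f : L2fun R) : ae_eq mu I (repr (L2_class f)) f.
Proof. by apply/L2_classP; rewrite /L2_class reprK. Qed.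

Definition L2_zero : L2 := L2_class 0.
Definition L2_opp (f : L2) : L2 := L2_class (- repr f).
Definition L2_add (f g : L2) : L2 := L2_class (repr f + repr g).
Definition L2_scale (a : C) (f : L2) : L2 := L2_class (a *: repr f).

Lemma L2_classN f : L2_opp (L2_class f) = L2_class (- f).
Proof.
apply/L2_classP; apply: filterS (L2_class_repr f) => x h Ix.
by rewrite !L2funN h.
Qed.

Lemma L2_classD f g : L2_add (L2_class f) (L2_class g) = L2_class (f + g).
Proof.
apply/L2_classP; apply: filterS2 (L2_class_repr f) (L2_class_repr g).
by move=> x hf hg Ix; rewrite !L2funD hf// hg.
Qed.

Lemma L2_classZ a f : L2_scale a (L2_class f) = L2_class (a *: f).
Proof.
apply/L2_classP; apply: filterS (L2_class_repr f) => x h Ix.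
by rewrite !L2funZ h.
Qed.

Lemma L2_classW (P : L2 -> Prop) : (forall f, P (L2_class f)) -> forall u, P u.
Proof. by move=> h u; rewrite -[u]reprK; exact: h. Qed.

Lemma L2_addA : associative L2_add.
Proof.
apply: L2_classW => f; apply: L2_classW => g; apply: L2_classW => h.
by rewrite !L2_classD addrA.
Qed.

Lemma L2_addC : commutative L2_add.
Proof.
by apply: L2_classW => f; apply: L2_classW => g; rewrite !L2_classD addrC.
Qed.

Lemma L2_add0 : left_id L2_zero L2_add.
Proof. by apply: L2_classW => f; rewrite L2_classD add0r. Qed.

Lemma L2_addN : left_inverse L2_zero L2_opp L2_add.
Proof. by apply: L2_classW => f; rewrite L2_classN L2_classD addNr. Qed.

HB.instance Definition _ :=
  GRing.isZmodule.Build L2 L2_addA L2_addC L2_add0 L2_addN.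

Lemma L2_scaleA a b f : L2_scale a (L2_scale b f) = L2_scale (a * b) f.
Proof.
by move: f; apply: L2_classW => f; rewrite !L2_classZ scalerA.
Qed.

Lemma L2_scale1 : left_id 1 L2_scale.
Proof. by apply: L2_classW => f; rewrite L2_classZ scale1r. Qed.

Lemma L2_scaleDr : right_distributive L2_scale +%R.
Proof.
move=> a; apply: L2_classW => f; apply: L2_classW => g.
by rewrite [_ + _]L2_classD !L2_classZ [RHS]L2_classD scalerDr.
Qed.

Lemma L2_scaleDl f : {morph L2_scale^~ f : a b / a + b}.
Proof.
move=> a b; move: f; apply: L2_classW => f.
by rewrite !L2_classZ [RHS]L2_classD scalerDl.
Qed.

HB.instance Definition _ := GRing.Zmodule_isLmodule.Build C L2
  L2_scaleA L2_scale1 L2_scaleDr L2_scaleDl.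

Definition L2_dot (f g : L2) : C := cintegral (fun x => f x * (g x)^*).

(* Test functions of class C^1 (instead of C^infinity) give the same weak
   derivatives; this is the definition of Brezis' textbook. Real test functions
   suffice by linearity. *)
Definition C1_compact_support (phi : R -> R) : Prop :=
  [/\ forall x, derivable phi x 1, continuous (derive1 phi) &
      exists a b : R, [/\ 0 < a, b < 1 &
        forall x, x \notin `[a, b] -> phi x = 0]].

Definition is_weak_derivative (u v : L2) : Prop :=
  forall phi : R -> R, C1_compact_support phi ->
    cintegral (fun x => u x * (derive1 phi x)%:C) =
    - cintegral (fun x => v x * (phi x)%:C).

Definition H1 : set L2 := [set u | exists v, is_weak_derivative u v].

(* The weak derivative is unique in L2; outside of H1 the value is junk. *)
Definition weak_derivative (u : L2) : L2 := xget 0 (is_weak_derivative u).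

Definition H2 : set L2 := [set u | H1 u /\ H1 (weak_derivative u)].

Definition is_continuous_representative (u : L2) (w : R -> C) : Prop :=
  [/\ {within `[0, 1], continuous (fun x => complex.Re (w x))},
      {within `[0, 1], continuous (fun x => complex.Im (w x))} &
      ae_eq mu I w u].

(* Boundary values are those of the representative that is continuous on [0, 1],
   which exists for u in H1 and is unique there. *)
Definition trace (u : L2) (x : R) : C :=
  xget 0 [set c | exists2 w, is_continuous_representative u w & c = w x].

End L2_quotient.

Section Operators.
Variables (R : realType) (V : lmodType R[i]) (norm : V -> R).
Local Notation C := (R[i]).

(* [app] is meaningful on [dom] only. *)
Record operator := Operator { dom : set V ; app : V -> V }.

Implicit Types (T : operator) (l : C).

Definition shift T l : V -> V := fun f => app T f - l *: f.

Definition resolvent_set T : set C := [set l |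
  (forall g, exists! f, dom T f /\ shift T l f = g) /\
  (exists c : R, forall f, dom T f -> norm f <= c * norm (shift T l f))].

Definition spectrum T : set C := ~` resolvent_set T.

Definition point_spectrum T : set C := [set l |
  exists f, [/\ dom T f, f != 0 & app T f = l *: f]].

(* the kernel of (T - l)^k on its natural domain *)
Fixpoint ker_shift_exp T l (k : nat) : set V :=
  if k is k'.+1 then [set f | dom T f /\ ker_shift_exp T l k' (shift T l f)]
  else [set 0].

Definition root_subspace T l : set V :=
  \bigcup_(k in [set: nat]) ker_shift_exp T l k.

Definition is_basis (S : set V) (m : nat) (e : 'I_m -> V) : Prop :=
  (forall c : 'I_m -> C, S (\sum_i c i *: e i)) /\
  (forall f, S f -> exists! c : 'I_m -> C, f = \sum_i c i *: e i).

Definition has_dim (S : set V) (m : nat) : Prop := exists e, @is_basis S m e.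

(* Multiplicity 0 means that l is not an eigenvalue. *)
Definition has_algebraic_multiplicity T l (m : nat) : Prop :=
  has_dim (root_subspace T l) m.

Definition purely_discrete_spectrum T : Prop := forall l, spectrum T l ->
  [/\ isolated (spectrum T : set C^o) l, point_spectrum T l &
      exists m, has_algebraic_multiplicity T l m].

End Operators.

Notation L2G R n := {ffun 'I_n -> L2 R}.

Section StarGraph.
Variables (R : realType) (np nm : nat).
Local Notation C := (R[i]).
Local Notation H := (L2G R (np + nm)).

(* The edges with index j < np are the positive ones. *)
Definition L2G_dot (f g : H) : C := \sum_j L2_dot (f j) (g j).

Definition L2G_norm (f : H) : R := Num.sqrt (complex.Re (L2G_dot f f)).

Definition krein_dot (f g : H) : C :=
  \sum_(j < np + nm | (j < np)%N) L2_dot (f j) (g j)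
  - \sum_(j < np + nm | (np <= j)%N) L2_dot (f j) (g j).

Definition kirchhoff_domain : set H := [set f |
  [/\ forall j, H2 (f j),
      forall j, trace (f j) 1 = 0,
      forall i j, trace (f i) 0 = trace (f j) 0 &
      \sum_j trace (weak_derivative (f j)) 0 = 0]].

Definition kirchhoff_app (f : H) : H :=
  [ffun j : 'I_(np + nm) =>
    if (j < np)%N then - weak_derivative (weak_derivative (f j))
    else weak_derivative (weak_derivative (f j))].

Definition indefinite_kirchhoff : operator H :=
  Operator kirchhoff_domain kirchhoff_app.

(* The order of R[i] makes 0 < z mean that z is real and positive. *)
Definition krein_positive (T : operator H) : Prop :=
  forall f, dom T f -> f != 0 -> 0 < krein_dot (app T f) f.

End StarGraph.

(* Main.v *)
(** A function of H^2(0,1) is a pair w' = w1, w1' = h in the absolutely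
    continuous sense (du Bois-Reymond), so an equation (B - l) f = g becomes a
    star of ordinary differential equations w'' = +-(l w + g) coupled by the
    vertex conditions.
    - Shooting from the outer vertices turns the coupling into a square linear
      system for the outer slopes; hence l is in the resolvent set as soon as
      the homogeneous problem has only the zero solution.
    - The energy identity l sum_j +-|w_j|^2 + sum_j |w_j'|^2 = 0 gives
      positivity, excludes the nonreal numbers and 0, and, applied to a Jordan
      chain, shows that every real eigenvalue is semisimple.
    - For l = +-m^2 the solutions are a_j sin(m(1-x)) and a_j sinh(m(1-x)); if
      sin m = 0 the slopes on the trigonometric edges sum to 0, otherwise the
      kernel is at most one-dimensional and nonzero iff coth m = - r cot m.
    - On (k pi, (k+1) pi) this last equation reads
      m + atan (r tanh m) = (k+1) pi, whose left-hand side is increasing; this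
      gives the eta_k and their asymptotics. *)
Require Import Defs.
From mathcomp Require Import all_boot all_order all_algebra.
From mathcomp Require Import complex ring lra.
From mathcomp Require Import all_classical all_reals all_analysis.
From mathcomp Require Import measurable_realfun.
Import Order.TTheory GRing.Theory Num.Theory.
Import numFieldNormedType.Exports.
Local Open Scope classical_set_scope.
Local Open Scope ring_scope.
Local Open Scope complex_scope.

Set Implicit Arguments.
Unset Strict Implicit.
Unset Printing Implicit Defensive.

(** Functions in [H2] have slopes that are only absolutely continuous, with second derivatives
    defined almost everywhere. The central analytic tool is therefore the product rule for pairs
    (function, integrable derivative), obtained from Fubini on a triangle. It gives integration by
    parts against test functions, the integrating factor for first-order equations, and both the
    energy and the Lagrange identities. B is symmetric only for the indefinite product, so symmetry
    alone gives neither real spectrum, nor surjectivity of B - l, nor semisimplicity. Surjectivity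
    comes from counting: there are n unknown outer slopes and n vertex conditions at the centre (n -
    1 for continuity, one for the fluxes), so injectivity suffices, and explicit estimates of the
    solution operators bound the inverse. Multiplicities are computed for every l = +-m^2 with m >
    0, the value 0 included. Since multiplicity 0 is equivalent to lying in the resolvent set, the
    real spectrum is read off from the multiplicities alone. *)

(** * Fubini's theorem on the two halves of a product square *)

Section Fubini_triangle.
Variable R : realType.
Local Notation mu := (@lebesgue_measure R).

(** The plane is cut along the diagonal, and each half is integrated in the order that turns the
    inner integral into a primitive. This is the product rule in integrated form. *)
Lemma lebesgue_Fubini_triangle (h k : R -> R) :
  mu.-integrable setT (EFin \o h) -> mu.-integrable setT (EFin \o k) ->
  (\int[mu]_s h s) * (\int[mu]_t k t) =
  \int[mu]_s (h s * \int[mu]_(t in `]-oo, s]) k t) +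
  \int[mu]_t ((\int[mu]_(s in `]-oo, t]) h s) * k t).
Proof.
move=> ih ik.
have mh : measurable_fun setT h by apply/measurable_EFinP; exact: (measurable_int mu).
have mk : measurable_fun setT k by apply/measurable_EFinP; exact: (measurable_int mu).
have mabs d (X : measurableType d) (g : X -> R) : measurable_fun setT g ->
    measurable_fun setT (fun x => `|(g x)%:E|)%E.
  by move=> mg; apply: measurableT_comp => //; exact/measurable_EFinP.
pose T : set (R * R) := [set z | z.2 <= z.1].
have mT : measurable T.
  have := @measurable_fun_le _ _ R [set: (measurableTypeR R * measurableTypeR R)%type]
    snd fst measurableT.
  by rewrite setTI; apply; [exact: measurable_snd|exact: measurable_fst].
pose f (A : set (R * R)) (z : measurableTypeR R * measurableTypeR R) : R :=
  h z.1 * k z.2 * \1_A z.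
have mf (A : set (R * R)) : measurable A -> measurable_fun setT (f A).
  move=> mA; apply: measurable_funM; last exact: measurable_indic.
  by apply: measurable_funM; apply: measurableT_comp => //.
have iprod (A : set (R * R)) : measurable A ->
    (mu \x mu)%E.-integrable setT (EFin \o f A).
  move=> mA; apply/integrable12ltyP; first by apply/measurable_EFinP; exact: mf.
  apply: (@le_lt_trans _ _ (\int[mu]_x (`|(h x)%:E| * \int[mu]_y `|(k y)%:E|))%E).
    apply: ge0_le_integral => //.
    - by move=> x _; exact: integral_ge0.
    - apply: (@measurable_fun_fubini_tonelli_F _ _ _ _ _ mu (fun z => `|(EFin \o f A) z|%E)) => //.
      exact: mabs (mf A mA).
    - apply: emeasurable_funM; last exact: measurable_cst.
      exact: mabs.
    move=> x _; rewrite -ge0_integralZl//; last first.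
      exact: mabs.
    apply: ge0_le_integral => //.
    - apply: mabs.
      by apply: (measurableT_comp (mf A mA)); exact: measurable_pair1.
    - by apply: measurable_funeM; exact: mabs.
    move=> y _; rewrite /f/= !lee_fin normrM normrM ler_piMr ?mulr_ge0//.
    by rewrite indicE; case: (_ \in _); rewrite ?normr1 ?normr0.
  have fk : (\int[mu]_y `|(k y)%:E|)%E \is a fin_num.
    rewrite ge0_fin_numE ?integral_ge0//; by have /integrableP[] := ik.
  have fh : (\int[mu]_y `|(h y)%:E|)%E \is a fin_num.
    rewrite ge0_fin_numE ?integral_ge0//; by have /integrableP[] := ih.
  rewrite -(fineK fk) ge0_integralZr//; last 2 first.
    exact: mabs.
    by rewrite lee_fin fine_ge0// integral_ge0.
  by rewrite -(fineK fh) -EFinM ltry.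
have row1 x : \int[mu]_y f T (x, y) = h x * \int[mu]_(t in `]-oo, x]) k t.
  rewrite -RintegralZl//; last by apply: integrableS ik.
  rewrite [RHS]Rintegral_mkcond; apply: eq_Rintegral => y _.
  rewrite /f/= patchE indicE; have [yx|xy] := leP y x.
    by rewrite !mem_set ?mulr1//= in_itv.
  rewrite !memNset ?mulr0//= ?in_itv/=; apply/negP; by rewrite -ltNge.
(* Off [T] the inner domain is an open half-line; adding its endpoint changes nothing, a point being
   null. *)
have row2 y : \int[mu]_x f (~` T) (x, y) = (\int[mu]_(s in `]-oo, y]) h s) * k y.
  rewrite -Rintegral_itv_bndo_bndc; last by apply: integrableS ih.
  rewrite -RintegralZr//; last by apply: integrableS ih.
  rewrite [RHS]Rintegral_mkcond; apply: eq_Rintegral => x _.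
  rewrite /f/= patchE indicE; have [yx|xy] := ltP x y.
    by rewrite !mem_set ?mulr1//= ?in_itv//=; apply/negP; rewrite -ltNge.
  rewrite !memNset ?mulr0//= ?in_itv/=; by [apply/negP; rewrite -leNgt | move=> /(_ xy)].
have full x : \int[mu]_y f setT (x, y) = h x * \int[mu]_t k t.
  rewrite -RintegralZl//; apply: eq_Rintegral => y _.
  by rewrite /f/= indicT mulr1.
have E12 (A : set (R * R)) : measurable A ->
   \int[mu]_x \int[mu]_y f A (x, y) = \int[(mu \x mu)%E]_z f A z.
  move=> mA; rewrite /Rintegral -integral12_prod_meas1; last exact: iprod.
  congr fine; apply: ae_eq_integral => //.
  - apply/measurable_EFinP; apply: measurableT_comp => //.
    exact: (@measurable_fubini_F _ _ _ _ _ mu mu _ (iprod A mA)).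
  - exact: (@measurable_fubini_F _ _ _ _ _ mu mu _ (iprod A mA)).
  apply: filterS (integrable_ae measurableT (integrable_fubini_F (iprod A mA))).
  by move=> x /(_ I) fx _; rewrite fineK.
have E21 (A : set (R * R)) : measurable A ->
   \int[mu]_y \int[mu]_x f A (x, y) = \int[(mu \x mu)%E]_z f A z.
  move=> mA; rewrite /Rintegral -integral21_prod_meas1; last exact: iprod.
  congr fine; apply: ae_eq_integral => //.
  - apply/measurable_EFinP; apply: measurableT_comp => //.
    exact: (@measurable_fubini_G _ _ _ _ _ mu mu _ (iprod A mA)).
  - exact: (@measurable_fubini_G _ _ _ _ _ mu mu _ (iprod A mA)).
  apply: filterS (ae_integrable2 (iprod A mA)).
  by move=> y iy _; rewrite fineK//; exact: integrable_fin_num.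
rewrite -RintegralZr//.
under eq_Rintegral do rewrite -full.
under [in RHS]eq_Rintegral do rewrite -row1.
under [X in _ = _ + X]eq_Rintegral do rewrite -row2.
rewrite E12// E12// E21; last exact: measurableC.
rewrite -RintegralD//; [|exact: iprod|by apply: iprod; exact: measurableC].
apply: eq_Rintegral => z _; rewrite /f -mulrDr indicC indicT/=.
by rewrite indicE /=; case: (_ \in _); rewrite ?(subrr, subr0, addr0, add0r).
Qed.

End Fubini_triangle.

(** * Absolutely continuous real functions on [0, 1] *)

Section AC_real.
Variable R : realType.
Local Notation mu := (@lebesgue_measure R).
Local Notation I := (@unit_itv R).
Local Notation J := (`[0, 1]%classic : set R).
Implicit Types v w f g h : R -> R.

Lemma unit_itv_sub_cc : I `<=` J.
Proof. exact: subset_itv_oo_cc. Qed.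

Lemma mem0_itv01 : (0 : R) \in `[0, 1].
Proof. by rewrite in_itv/= lexx ler01. Qed.

Lemma mem1_itv01 : (1 : R) \in `[0, 1].
Proof. by rewrite in_itv/= lexx ler01. Qed.

Lemma lebesgue_itv01 : mu J = 1%E.
Proof. by rewrite lebesgue_measure_itv/= lte_fin ltr01 oppr0 adde0. Qed.

Lemma integrable_unit_itv_cc f :
  mu.-integrable I (EFin \o f) <-> mu.-integrable J (EFin \o f).
Proof.
split; last first.
  by apply: integrableS => //; [exact: unit_itv_measurable|exact: unit_itv_sub_cc].
move=> /integrableP[mf if_].
have mf1 : measurable_fun I f by apply/measurable_EFinP.
have mf' : measurable_fun J f by apply: measurable_fun_itv_cc mf1.
apply/integrableP; split; first exact/measurable_EFinP.
move: if_; rewrite integral_itv_bndo_bndc ?integral_itv_obnd_cbnd//.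
  apply: measurableT_comp => //; apply/measurable_EFinP.
  exact: measurable_fun_itv_oc mf1.
exact: measurableT_comp.
Qed.

Lemma Rintegral_unit_itv_cc f : measurable_fun I f ->
  \int[mu]_(x in I) f x = \int[mu]_(x in J) f x.
Proof.
move=> mf; rewrite /Rintegral integral_itv_bndo_bndc ?integral_itv_obnd_cbnd//.
  by apply/measurable_EFinP; exact: measurable_fun_itv_oc mf.
exact/measurable_EFinP.
Qed.

Lemma ae_eq_unit_itv_cc T (f g : R -> T) : ae_eq mu I f g -> ae_eq mu J f g.
Proof.
move=> fg.
have n0 : {ae mu, forall x : R, x <> 0 /\ x <> 1}.
  exists [set 0; 1]; split.
  - exact: measurableU.
  - apply/eqP; rewrite eq_le measure_ge0 andbT.
    by rewrite (le_trans (measureU2 _ _ _))//= !lebesgue_measure_set1 adde0.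
  - move=> x /= /not_andP[] /contrapT ->; [by left|by right].
move: fg; rewrite /ae_eq => fg; apply: filterS2 fg n0 => x fgx [x0 x1] Jx.
apply: fgx; move: Jx; rewrite /unit_itv /= !in_itv/= !lt_neqAle => /andP[-> ->].
by rewrite !andbT eq_sym; apply/andP; split; apply/eqP.
Qed.

(** Absolute continuity with the almost everywhere derivative [v] carried along: [w] never has to be
    differentiated, and [v] matters only up to null sets. *)
Definition ac w v := mu.-integrable J (EFin \o v) /\
  forall x, x \in `[0, 1] -> w x = w 0 + \int[mu]_(t in `[0, x]) v t.

Lemma prefix_sub x : x <= 1 -> (`[0, x]%classic : set R) `<=` J.
Proof. by move=> x1 y/=; rewrite !in_itv/= => /andP[-> /le_trans->]. Qed.

Lemma integrable_prefix v x : x \in `[0, 1] -> mu.-integrable J (EFin \o v) ->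
  mu.-integrable `[0, x] (EFin \o v).
Proof.
rewrite in_itv/= => /andP[_ x1]; apply: integrableS => //.
exact: prefix_sub.
Qed.

Lemma ac_ext w w' v : {in `[0, 1], w =1 w'} -> ac w v -> ac w' v.
Proof.
move=> ww' [iv wE]; split => // x x01; rewrite -(ww' x)// -(ww' 0) 1?(wE x)//.
by rewrite in_itv/= lexx ler01.
Qed.

Lemma ac_ae w v v' : mu.-integrable J (EFin \o v') -> ae_eq mu I v v' ->
  ac w v -> ac w v'.
Proof.
move=> iv' vv' [iv wE]; split => // x x01; rewrite wE//; congr (_ + _).
congr fine; apply: ae_eq_integral => //.
- exact: (measurable_int mu (integrable_prefix x01 iv)).
- exact: (measurable_int mu (integrable_prefix x01 iv')).
apply: (@ae_eq_subset _ _ _ _ mu J).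
  by apply: prefix_sub; move: x01; rewrite in_itv/= => /andP[].
by apply: ae_eq_comp; exact: ae_eq_unit_itv_cc.
Qed.

Lemma ac_cst c : ac (fun=> c) (fun=> 0).
Proof.
split; first exact: integrable0.
by move=> x _; rewrite Rintegral_cst// mul0r addr0.
Qed.

Lemma acD w w' v v' : ac w v -> ac w' v' ->
  ac (fun x => w x + w' x) (fun x => v x + v' x).
Proof.
move=> [iv wE] [iv' wE']; split; first exact: (integrableD _ iv iv').
move=> x x01; rewrite RintegralD//; try exact: integrable_prefix.
by rewrite wE// wE'// addrACA.
Qed.

Lemma acZ c w v : ac w v -> ac (fun x => c * w x) (fun x => c * v x).
Proof.
move=> [iv wE]; split; first exact: (integrableZl _ c iv).
move=> x x01; rewrite RintegralZl//; last exact: integrable_prefix.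
by rewrite wE// mulrDr.
Qed.

Lemma acN w v : ac w v -> ac (fun x => - w x) (fun x => - v x).
Proof.
move=> /(acZ (-1)); rewrite (_ : (fun x => -1 * v x) = (fun x => - v x)).
  by apply: ac_ext => x _; rewrite mulN1r.
by apply/funext => x; rewrite mulN1r.
Qed.

Lemma acB w w' v v' : ac w v -> ac w' v' ->
  ac (fun x => w x - w' x) (fun x => v x - v' x).
Proof. by move=> wv /acN; exact: acD. Qed.

Lemma ac_continuous w v : ac w v -> {within `[0, 1], continuous w}.
Proof.
move=> [iv wE].
have c : {within `[0, 1], continuous (fun x => w 0 + parameterized_integral mu 0 x v)}.
  move=> x; apply: cvgD; first exact: cvg_cst.
  exact: (parameterized_integral_continuous ler01 iv).
apply: subspace_eq_continuous c => x; rewrite inE => x01 /=.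
by rewrite [RHS]wE.
Qed.

Lemma integrable_mul_continuous v w : mu.-integrable J (EFin \o v) ->
  {within `[0, 1], continuous w} ->
  mu.-integrable J (EFin \o (fun x => v x * w x)).
Proof.
move=> iv cw; apply: (@eq_integrable _ _ _ mu J _ ((EFin \o v) \* (EFin \o w))%E) => //.
apply: integrableMl => //.
  by apply: subspace_continuous_measurable_fun.
have /compact_bounded[M [_ mrt]] := continuous_compact cw (@segment_compact _ 0 1).
by exists M; split; rewrite ?num_real // => ? ? ? ?; exact: mrt.
Qed.

(** The triangle formula is applied to [v] and [v'] cut off outside [0, x]: the inner integrals
    become [w s - w 0] and [w' s - w' 0], and the rest is algebra. *)
Lemma acM w w' v v' : ac w v -> ac w' v' ->
  ac (fun x => w x * w' x) (fun x => v x * w' x + v' x * w x).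
Proof.
move=> a a'.
have i1 := integrable_mul_continuous a.1 (ac_continuous a').
have i2 := integrable_mul_continuous a'.1 (ac_continuous a).
split; first exact: (integrableD _ i1 i2).
move=> x x01.
have x0 : 0 <= x by move: x01; rewrite in_itv/= => /andP[].
have x1 : x <= 1 by move: x01; rewrite in_itv/= => /andP[].
pose D := (`[0, x]%classic : set R).
have iD f : mu.-integrable J (EFin \o f) -> mu.-integrable setT (EFin \o (f \_ D)).
  by move=> /(integrable_prefix x01) /integrable_mkcond; rewrite restrict_EFin; exact.
have pre f y : 0 <= y <= x -> mu.-integrable J (EFin \o f) ->
    \int[mu]_(t in `]-oo, y]) (f \_ D) t = \int[mu]_(t in `[0, y]) f t.
  move=> /andP[y0 yx] _; rewrite -Rintegral_mkcondr; congr (Rintegral _ _ _).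
  apply/seteqP; split => t; rewrite /D /= !in_itv/= => h.
  - by case: h => -> /andP[->].
  - by case/andP: h => -> h; rewrite h (le_trans h yx).
have tot f : \int[mu]_t (f \_ D) t = \int[mu]_(t in D) f t.
  by rewrite -Rintegral_mkcond.
have := lebesgue_Fubini_triangle (iD _ a.1) (iD _ a'.1).
rewrite !tot.
have -> : \int[mu]_s ((v \_ D) s * \int[mu]_(t in `]-oo, s]) (v' \_ D) t) =
    \int[mu]_(s in D) (v s * (w' s - w' 0)).
  rewrite -[RHS]tot; apply: eq_Rintegral => s _.
  rewrite !patchE; case: ifPn => [|_]; last by rewrite mul0r.
  rewrite inE /D/= in_itv/= => /andP[s0 sx]; rewrite pre ?s0//; last exact: a'.1.
  by rewrite [w' s]a'.2 ?in_itv/= ?s0 ?(le_trans sx)// [_ + _ - _]addrC addKr.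
have -> : \int[mu]_s ((\int[mu]_(t in `]-oo, s]) (v \_ D) t) * (v' \_ D) s) =
    \int[mu]_(s in D) (v' s * (w s - w 0)).
  rewrite -[RHS]tot; apply: eq_Rintegral => s _.
  rewrite !patchE; case: ifPn => [|_]; last by rewrite mulr0.
  rewrite inE /D/= in_itv/= => /andP[s0 sx]; rewrite pre ?s0//; last exact: a.1.
  by rewrite [w s]a.2 ?in_itv/= ?s0 ?(le_trans sx)// [_ + _ - _]addrC addKr mulrC.
rewrite /D.
have ip f g : mu.-integrable J (EFin \o f) -> {within `[0, 1], continuous g} ->
    \int[mu]_(t in `[0, x]) (f t * (g t - g 0)) =
    \int[mu]_(t in `[0, x]) (f t * g t) - (\int[mu]_(t in `[0, x]) f t) * g 0.
  move=> i_f cg; rewrite -RintegralZr//; last exact: integrable_prefix.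
  rewrite -RintegralB//.
  - by apply: eq_Rintegral => t _; rewrite mulrBr.
  - apply: integrable_prefix => //; exact: integrable_mul_continuous.
  - exact: (integrableZr _ (g 0) (integrable_prefix x01 i_f)).
rewrite (ip _ _ a.1 (ac_continuous a')) (ip _ _ a'.1 (ac_continuous a)).
rewrite RintegralD//; try exact: integrable_prefix.
rewrite [w x]a.2// [w' x]a'.2//.
move: (\int[mu]_(t in `[0, x]) (v t * w' t)) (\int[mu]_(t in `[0, x]) (v' t * w t)).
move: (\int[mu]_(t in `[0, x]) v t) (\int[mu]_(t in `[0, x]) v' t) => A B P Q E.
have -> : P + Q = A * B + A * w' 0 + B * w 0 by rewrite E; ring.
by ring.
Qed.

Lemma ac_Rintegral w v : ac w v -> \int[mu]_(x in I) v x = w 1 - w 0.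
Proof.
move=> a; rewrite Rintegral_unit_itv_cc.
  by rewrite [w 1]a.2 ?in_itv/= ?ler01 ?lexx// addrAC subrr add0r.
apply/measurable_EFinP; apply: (measurable_int mu).
by apply/integrable_unit_itv_cc; exact: a.1.
Qed.

Lemma ac_eq_cst w v x : ac w v -> ae_eq mu I v (fun=> 0) -> x \in `[0, 1] ->
  w x = w 0.
Proof.
move=> a v0 x01; have i0 : mu.-integrable J (EFin \o (fun=> 0 : R)).
  exact: integrable0.
by have [_ ->//] := ac_ae i0 v0 a; rewrite Rintegral_cst// mul0r addr0.
Qed.

(** The primitive of [v - v'] vanishes on [0, 1], and by Lebesgue's differentiation theorem its
    derivative is [v - v'] almost everywhere. *)
Lemma ac_derivative_unique w v v' : ac w v -> ac w v' -> ae_eq mu I v v'.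
Proof.
move=> a a'; have a0 := acB a a'.
set f := fun x => v x - v' x in a0.
pose g := f \_ J.
have ig : mu.-integrable setT (EFin \o g).
  by have /integrable_mkcond := a0.1; rewrite restrict_EFin; exact.
have lg : locally_integrable [set: R] g by exact: integrable_locally a0.1.
have := @FTC1 R g (BLeft 0) (fun y => integrableS measurableT _ (@subsetT _ _) ig) lg.
move=> /(_ (fun=> measurable_itv _)) h.
move: h; apply: filterS; first exact: (ae_filter_ringOfSetsType mu).
move=> x /= h Ix.
have [x0 x1] : 0 < x /\ x < 1 by move: Ix; rewrite /unit_itv/= in_itv/= => /andP[].
have [|_] := h; first by rewrite lte_fin.
have -> : g x = v x - v' x.
  by rewrite /g patchE mem_set//=; rewrite in_itv/= !ltW.
rewrite derive1E (@near_eq_derive _ _ _ _ (cst 0)) ?derive_cst//.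
  by move=> /esym /eqP; rewrite subr_eq0 => /eqP.
have : \forall y \near x, y \in `]0, 1[.
  by apply: near_in_itvoo; rewrite in_itv/= x0 x1.
apply: filterS => y; rewrite in_itv/= => /andP[y0 y1].
have y01 : y \in `[0, 1] by rewrite in_itv/= !ltW.
have := a0.2 y y01; rewrite !subrr.
rewrite add0r => /esym h0; rewrite -[RHS]h0; apply: eq_Rintegral => t.
rewrite inE => ty; rewrite /g patchE mem_set//.
exact: prefix_sub (ltW y1) _ ty.
Qed.

Lemma ac_primitive c v : mu.-integrable J (EFin \o v) ->
  ac (fun x => c + \int[mu]_(t in `[0, x]) v t) v.
Proof.
by move=> iv; split => // x _; rewrite set_itv1 Rintegral_set1 addr0.
Qed.

Lemma ac_C1 w v : (forall x : R, is_derive x 1 w (v x)) -> continuous v -> ac w v.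
Proof.
move=> dw cv; have iv a : mu.-integrable `[0, a] (EFin \o v).
  apply: continuous_compact_integrable; first exact: segment_compact.
  exact: continuous_subspaceT.
have cw : continuous w.
  move=> x; apply: differentiable_continuous; apply/derivable1_diffP.
  exact: @ex_derive.
split => // x; rewrite in_itv/= => /andP[]; rewrite le_eqVlt => /predU1P[<- _|x0 _].
  by rewrite set_itv1 Rintegral_set1 addr0.
rewrite /Rintegral (@continuous_FTC2 _ v w)//=.
- by rewrite addrCA subrr addr0.
- exact: continuous_subspaceT.
- split; first by move=> y _; exact: @ex_derive.
  + exact/cvg_at_right_filter/cw.
  + exact/cvg_at_left_filter/cw.
- by move=> y _; rewrite derive1E; apply: derive_val.
Qed.

End AC_real.
Arguments mem0_itv01 {R}.
Arguments mem1_itv01 {R}.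

(** * The du Bois-Reymond lemma: a function with zero weak derivative is constant *)

Section du_Bois_Reymond.
Variable R : realType.
Local Notation mu := (@lebesgue_measure R).
Local Notation I := (@unit_itv R).
Local Notation J := (`[0, 1]%classic : set R).

(** A ramp of slope n from 1/n to 2/n, and symmetrically down from x - 2/n to x - 1/n, capped at 1.
    It is continuous, supported away from 0 and 1, and tends pointwise to the indicator of ]0,
    x[. *)
Definition trapezoid (n : nat) (x t : R) : R :=
  Num.max 0 (Num.min 1 (Num.min (n%:R * t - 1) (n%:R * (x - t) - 1))).

Lemma trapezoid_continuous n x : continuous (trapezoid n x).
Proof.
have aff (a b : R) : continuous (fun t : R => a * t + b).
  by move=> t; apply: cvgD; [apply: cvgM; [exact: cvg_cst|exact: cvg_id]|exact: cvg_cst].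
have aff2 : continuous (fun t => n%:R * (x - t) - 1).
  rewrite (_ : (fun t => _) = (fun t => - n%:R * t + (n%:R * x - 1))) //.
  by apply/funext => s; ring.
have -> : trapezoid n x = cst 0 \max (cst 1 \min
    ((fun t => n%:R * t - 1) \min (fun t => n%:R * (x - t) - 1))) by [].
move=> t; apply: continuous_max; first exact: cvg_cst.
apply: continuous_min; first exact: cvg_cst.
by apply: continuous_min; [exact: aff|exact: aff2].
Qed.

Lemma trapezoid_itv n x t : 0 <= trapezoid n x t <= 1.
Proof. by rewrite /trapezoid le_max lexx/= ge_max ler01 ge_min lexx. Qed.

Lemma trapezoid_eq0 n x t : (1 < n)%N -> x <= 1 ->
  t \notin `[n%:R^-1, 1 - n%:R^-1] -> trapezoid n x t = 0.
Proof.
move=> n1 x1 h; have n0 : (0 : R) < n%:R by rewrite ltr0n; apply: leq_trans n1.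
apply/max_idPl; rewrite !ge_min; apply/orP; right.
move: h; rewrite in_itv/= negb_and -!ltNge => /orP[h|h].
  apply/orP; left; rewrite subr_le0 mulrC -ler_pdivlMr// mul1r; exact: ltW.
apply/orP; right; rewrite subr_le0 mulrC -ler_pdivlMr// mul1r.
move: h; move: (n%:R^-1) => q; lra.
Qed.

Lemma trapezoid_eq1 n x t : 2 <= n%:R * t -> 2 <= n%:R * (x - t) ->
  trapezoid n x t = 1.
Proof.
move=> h1 h2; rewrite /trapezoid (_ : Num.min 1 _ = 1); first exact/max_idPr.
by apply/min_idPl; rewrite le_min; apply/andP; split; lra.
Qed.

Lemma trapezoid_cvg x t : trapezoid n x t @[n --> \oo] --> (\1_(`]0, x[%classic) t : R).
Proof.
rewrite indicE; case: (boolP (t \in _)); rewrite ?inE /= ?notin_setE /= in_itv/=.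
  move=> /andP[t0 tx].
  apply: cvg_near_cst.
  have big (y : R) : 0 < y -> \forall n \near \oo, 2 <= n%:R * y.
    move=> y0; near=> n; rewrite -ler_pdivrMr//; near: n.
    exact: nbhs_infty_ger.
  have xt : 0 < x - t by rewrite subr_gt0.
  by apply: filterS2 (big _ t0) (big _ xt) => n h1 h2; exact: trapezoid_eq1.
move=> h; apply: cvg_near_cst; apply: nearW => n.
apply/max_idPl; rewrite !ge_min; apply/orP; right.
have n0 : (0 : R) <= n%:R by rewrite ler0n.
have [t0|t0] := leP t 0.
  by apply/orP; left; rewrite subr_le0 (le_trans _ ler01)// mulr_ge0_le0.
apply/orP; right; rewrite subr_le0 (le_trans _ ler01)// mulr_ge0_le0// subr_le0.
by rewrite leNgt; apply/negP => tx; apply: h; rewrite t0.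
Unshelve. all: by end_near. Qed.

Lemma integrable_continuous (psi : R -> R) : continuous psi ->
  mu.-integrable J (EFin \o psi).
Proof.
move=> c; apply: continuous_compact_integrable; first exact: segment_compact.
exact: continuous_subspaceT.
Qed.

(** The primitive vanishes to the left of the support trivially, and to the right of it because the
    mean of [psi] is zero. *)
Lemma test_function_primitive (psi : R -> R) (a b : R) : continuous psi ->
    0 < a -> b < 1 -> (forall x, x \notin `[a, b] -> psi x = 0) ->
    \int[mu]_(t in J) psi t = 0 ->
  exists phi, C1_compact_support phi /\ derive1 phi = psi.
Proof.
move=> c a0 b1 psi0 int0.
have iT : mu.-integrable setT (EFin \o psi).
  have -> : EFin \o psi = (EFin \o psi) \_ J.
    apply/funext => x; rewrite patchE; case: ifPn => //=.
    rewrite notin_setE/= in_itv/= => h; rewrite psi0// in_itv/=.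
    apply/negP => /andP[ax xb]; apply: h.
    by rewrite (le_trans (ltW a0) ax)/= (le_trans xb (ltW b1)).
  by have /integrable_mkcond h := integrable_continuous c; exact: h.
pose phi x := \int[mu]_(t in [set` `]-oo, x]]) psi t.
have dphi x : derivable phi x 1 /\ derive1 phi x = psi x.
  apply: (@continuous_FTC1 R psi -oo%O x (x + 1)).
  - by rewrite ltrDl.
  - by apply: integrableS iT.
  - exact: ltNyr.
  - exact: c.
have E : derive1 phi = psi by apply/funext => x; have [] := dphi x.
exists phi; split => //; split.
- by move=> x; have [] := dphi x.
- by rewrite E.
exists a, b; split => // x xab.
have [xa|ax] := ltP x a.
  rewrite /phi (_ : Rintegral _ _ _ = \int[mu]_(t in [set` `]-oo, x]]) 0).
    by rewrite Rintegral_cst// mul0r.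
  apply: eq_Rintegral => t; rewrite inE/= in_itv/= => tx; apply: psi0.
  by rewrite in_itv/= negb_and -ltNge (le_lt_trans tx xa).
have bx : b < x by move: xab; rewrite in_itv/= ax/= -ltNge.
rewrite -int0 /phi Rintegral_mkcond [RHS]Rintegral_mkcond; apply: eq_Rintegral => t _.
have [tab|tab] := boolP (t \in `[a, b]); last by rewrite !patchE !psi0// !if_same.
move: tab; rewrite in_itv/= => /andP[at_ tb].
rewrite !patchE !mem_set//=; rewrite in_itv/=.
  by rewrite (le_trans (ltW a0))//= (le_trans tb (ltW b1)).
by rewrite (le_trans tb (ltW bx)).
Qed.

(** The constant is chosen so that [f = g - c] is orthogonal to one bump [psi0] of nonzero mean.
    Every trapezoid is a multiple of [psi0] plus a function of zero mean, that is, plus the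
    derivative of a test function, so [f] is orthogonal to all trapezoids. In the limit its integral
    over each [0, x] vanishes. *)
Lemma du_Bois_Reymond (g : R -> R) : mu.-integrable J (EFin \o g) ->
  (forall phi, C1_compact_support phi ->
    \int[mu]_(t in J) (g t * derive1 phi t) = 0) ->
  exists c, ae_eq mu I g (fun=> c).
Proof.
move=> ig g0.
have ipsi := integrable_continuous.
have imul (h psi : R -> R) : mu.-integrable J (EFin \o h) -> continuous psi ->
    mu.-integrable J (EFin \o (fun t => h t * psi t)).
  move=> ih cpsi; apply: integrable_mul_continuous => //; exact: continuous_subspaceT.
(* The parameter 8 makes the bump equal to 1 on [1/4, 3/4], so its mean [m0] is at least 1/2. *)
pose psi0 := trapezoid 8 1.
have cpsi0 : continuous psi0 by exact: trapezoid_continuous.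
pose m0 := \int[mu]_(t in J) psi0 t.
have m0_gt0 : 0 < m0.
  have : \int[mu]_(t in J) (\1_(`[4^-1, 3/4]%classic) t : R) <= m0.
    apply: le_Rintegral => //.
    - by apply: integrableS (integrable_indic_itv (4^-1 : R) (3 / 4) true false).
    - exact: ipsi.
    move=> t _; rewrite indicE; case: (boolP (t \in _)); last first.
      by move=> _; have /andP[] := trapezoid_itv 8 1 t.
    by rewrite inE/= in_itv/= => /andP[h1 h2]; rewrite /psi0 trapezoid_eq1//; lra.
  apply: lt_le_trans.
  rewrite /Rintegral integral_indic//.
  rewrite (setIidl _); last first.
    by move=> t; rewrite /= !in_itv/= => /andP[h1 h2]; apply/andP; split; lra.
  have E : mu (`[4^-1, 3/4]%classic : set R) = (2^-1)%:E.
    rewrite lebesgue_measure_itv/= lte_fin ifT; last lra.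
    by rewrite -EFinD; congr EFin; lra.
  by rewrite [ltRHS](congr1 fine E)/=; lra.
pose c := (\int[mu]_(t in J) (g t * psi0 t)) / m0.
exists c; pose f t := g t - c.
have if_ : mu.-integrable J (EFin \o f).
  exact: (integrableB _ ig (ipsi (cst c) (@cst_continuous _ _ c))).
have fpsi0 : \int[mu]_(t in J) (f t * psi0 t) = 0.
  under eq_Rintegral do rewrite mulrBl.
  rewrite RintegralB//; [|exact: imul|exact: (integrableZl _ c (ipsi _ cpsi0))].
  by rewrite RintegralZl//; [rewrite /c divfK ?subrr// gt_eqF|exact: ipsi].
have fpsi n x : (1 < n)%N -> x <= 1 -> \int[mu]_(t in J) (f t * trapezoid n x t) = 0.
  move=> n1 x1; pose psi := trapezoid n x; pose k := (\int[mu]_(t in J) psi t) / m0.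
  have cpsi : continuous psi by exact: trapezoid_continuous.
  (* Subtracting this multiple of [psi0] gives mean zero, hence a derivative of a test function. *)
  pose psi' t := psi t - k * psi0 t.
  have ckpsi0 : continuous (fun t => k * psi0 t).
    by move=> t; apply: cvgM; [exact: cvg_cst|exact: cpsi0].
  have cpsi' : continuous psi'.
    by move=> t; apply: cvgB; [exact: cpsi|exact: ckpsi0].
  have int' : \int[mu]_(t in J) psi' t = 0.
    rewrite RintegralB//; [|exact: ipsi|exact: ipsi].
    rewrite RintegralZl//; last exact: ipsi.
    by rewrite /k divfK ?subrr// gt_eqF.
  have [phi [Cphi Ephi]] : exists phi, C1_compact_support phi /\ derive1 phi = psi'.
    (* This margin contains the supports of both trapezoids. *)
    apply: (@test_function_primitive _ (Num.min n%:R^-1 8^-1)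
      (1 - Num.min n%:R^-1 8^-1)) => //.
    - by rewrite lt_min !invr_gt0 !ltr0n (ltn_trans _ n1).
    - by rewrite gtrBl lt_min !invr_gt0 !ltr0n (ltn_trans _ n1).
    move=> t ht; rewrite /psi' /psi trapezoid_eq0//; last first.
      move: ht; apply: contra; rewrite !in_itv/= => /andP[h1 h2].
      by rewrite ge_min h1/= (le_trans h2)// lerB// ge_min lexx.
    rewrite /psi0 trapezoid_eq0 ?mulr0 ?subrr//.
    move: ht; apply: contra; rewrite !in_itv/= => /andP[h1 h2].
    by rewrite ge_min h1 orbT/= (le_trans h2)// lerB// ge_min lexx orbT.
  have h : \int[mu]_(t in J) (f t * psi' t) = 0.
    under eq_Rintegral do rewrite mulrBl.
    rewrite RintegralB//; [|exact: imul|exact: (integrableZl _ c (ipsi _ cpsi'))].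
    rewrite RintegralZl//; last exact: ipsi.
    by rewrite int' -Ephi g0// mulr0 subrr.
  have E : \int[mu]_(t in J) (f t * psi t) =
      \int[mu]_(t in J) (f t * psi' t + k * (f t * psi0 t)).
    by apply: eq_Rintegral => t _; rewrite /psi'; ring.
  rewrite E RintegralD//; [|exact: imul|exact: (integrableZl _ k (imul _ _ if_ cpsi0))].
  by rewrite RintegralZl ?fpsi0 ?h ?mulr0 ?addr0//; exact: imul.
have F0 x : x \in `[0, 1] -> \int[mu]_(t in `[0, x]) f t = 0.
  rewrite in_itv/= => /andP[x0 x1].
  have mJ : measurable J by exact: measurable_itv.
  (* The index starts at 2 because [fpsi] needs n > 1 for the support to stay inside ]0, 1[. *)
  have [|||||_ _ cv] := @dominated_convergence _ _ R mu J mJ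
    (fun n t => (f t * trapezoid n.+2 x t)%:E)
    (fun t => (f t * (\1_(`]0, x[%classic) t : R))%:E) (fun t => `|(f t)%:E|%E).
  - by move=> n; apply: (measurable_int mu); apply: imul => //; exact: trapezoid_continuous.
  - apply/measurable_EFinP; apply: measurable_funM.
      by apply/measurable_EFinP; exact: (measurable_int mu if_).
    by apply: measurable_indic; exact: measurable_itv.
  - apply: aeW => t _; apply: cvg_EFin; first exact: nearW.
    apply: cvgM; first exact: cvg_cst.
    have h := @trapezoid_cvg x t; move: h.
    by rewrite -(cvg_shiftn 2); under eq_fun do rewrite addn2.
  - exact: integrable_abse if_.
  - apply: aeW => t n _; rewrite lee_fin normrM ler_piMr//.
    have /andP[h0 h1] := trapezoid_itv n.+2 x t.
    by rewrite ger0_norm.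
  have ifx : mu.-integrable `[0, x] (EFin \o f).
    by apply: integrable_prefix => //; rewrite in_itv/= x0.
  have : (\int[mu]_(t in J) (f t * trapezoid n.+2 x t)%:E)%E @[n --> \oo] --> 0%E.
    apply: cvg_near_cst; apply: nearW => n.
    rewrite -[LHS]fineK; first by rewrite -/(Rintegral _ _ _) fpsi.
    by apply: integrable_fin_num => //; apply: imul => //; exact: trapezoid_continuous.
  move=> /(cvg_unique _ cv) h.
  have -> : \int[mu]_(t in `[0, x]) f t =
      \int[mu]_(t in J) (f t * (\1_(`]0, x[%classic) t : R)); last by rewrite /Rintegral h.
  have ioo : mu.-integrable `]0, x[ (EFin \o f).
    by apply: integrableS ifx => //; exact: subset_itv_oo_cc.
  have ioc : mu.-integrable `]0, x] (EFin \o f).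
    by apply: integrableS ifx => //; exact: subset_itv_oc_cc.
  rewrite -Rintegral_itv_obnd_cbnd// -Rintegral_itv_bndo_bndc//.
  rewrite (_ : `]0, x[%classic = J `&` `]0, x[%classic); last first.
    apply/esym/setIidPr => t; rewrite /= !in_itv/= => /andP[h1 h2].
    by rewrite (ltW h1)/= (le_trans (ltW h2)).
  rewrite Rintegral_mkcondr; apply: eq_Rintegral => t tJ.
  rewrite patchE indicE in_setI tJ /=.
  by case: (t \in _); rewrite ?mulr1 ?mulr0.
have : ae_eq mu I f (fun=> 0).
  apply: (@ac_derivative_unique _ (fun=> 0)); last exact: ac_cst.
  by split => // x x01; rewrite F0// addr0.
by apply: filterS => t h /h /eqP; rewrite subr_eq0 => /eqP.
Qed.

End du_Bois_Reymond.

(** * Weak derivatives versus absolute continuity, real case *)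

Section Sobolev_real.
Variable R : realType.
Local Notation mu := (@lebesgue_measure R).
Local Notation I := (@unit_itv R).
Local Notation J := (`[0, 1]%classic : set R).

Lemma C1_compact_support_ac (phi : R -> R) : C1_compact_support phi ->
  [/\ ac phi (derive1 phi), phi 0 = 0 & phi 1 = 0].
Proof.
move=> [dphi cphi [a [b [a0 b1 phi0]]]]; split.
- apply: ac_C1 => // x; split; first exact: dphi.
  by rewrite derive1E.
- by apply: phi0; rewrite in_itv/= negb_and -ltNge a0.
- by apply: phi0; rewrite in_itv/= negb_and -!ltNge b1 orbT.
Qed.

Lemma ac_weak (w v phi : R -> R) : ac w v -> C1_compact_support phi ->
  \int[mu]_(t in J) (w t * derive1 phi t) = - \int[mu]_(t in J) (v t * phi t).
Proof.
move=> a /C1_compact_support_ac[b p0 p1].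
have := (acM a b).2 1; rewrite p0 p1 !mulr0 add0r in_itv/= ler01 lexx => /(_ isT).
rewrite RintegralD//.
- rewrite addrC => /esym/eqP; rewrite addr_eq0.
  by under eq_Rintegral do rewrite mulrC; move=> /eqP.
- exact: integrable_mul_continuous a.1 (ac_continuous b).
- exact: integrable_mul_continuous b.1 (ac_continuous a).
Qed.

(** If V is the primitive of [v], then [u - V] has zero weak derivative, so [u] is V plus a constant
    almost everywhere. *)
Lemma weak_ac (u v : R -> R) :
  mu.-integrable J (EFin \o u) -> mu.-integrable J (EFin \o v) ->
  (forall phi, C1_compact_support phi -> \int[mu]_(t in J) (u t * derive1 phi t) =
    - \int[mu]_(t in J) (v t * phi t)) ->
  exists2 w, ac w v & ae_eq mu I w u.
Proof.
move=> iu iv h.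
pose V x := 0 + \int[mu]_(t in `[0, x]) v t.
have aV : ac V v by exact: ac_primitive.
have iV : mu.-integrable J (EFin \o V).
  apply: continuous_compact_integrable; first exact: segment_compact.
  exact: ac_continuous aV.
have [|phi Cphi|c uc] := @du_Bois_Reymond _ (fun t => u t - V t).
- exact: (integrableB _ iu iV).
- have [b _ _] := C1_compact_support_ac Cphi.
  have cphi' : {within `[0, 1], continuous (derive1 phi)}.
    by apply: continuous_subspaceT; have [] := Cphi.
  under eq_Rintegral do rewrite mulrBl.
  rewrite RintegralB//; try exact: integrable_mul_continuous.
  by rewrite (ac_weak aV Cphi) h// subrr.
exists (fun x => V x + c).
  apply: ac_ae (acD aV (ac_cst c)); first exact: iv.
  by apply: aeW => t _; rewrite addr0.
by apply: filterS uc => t uc It; rewrite -uc//; ring.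
Qed.

(** A nonzero value would persist on a nonempty open interval, which is not negligible. *)
Lemma continuous_ae_eq0 (d : R -> R) : {within `[0, 1], continuous d} ->
  ae_eq mu I d (fun=> 0) -> {in `[0, 1], forall x, d x = 0}.
Proof.
move=> cd d0 x x01; apply/eqP/negPn/negP => dx.
have /subspace_continuousP/(_ x x01)/cvgrPdist_lt/(_ `|d x|) := cd.
rewrite normr_gt0 => /(_ dx); rewrite near_withinE.
move=> /nbhs_ballP[e /= e0 he].
move: x01; rewrite in_itv/= => /andP[x0 x1].
(* Clipping to [0, 1] covers the endpoints too, where the neighbourhood is one-sided. *)
pose a := Num.max 0 (x - e); pose b := Num.min 1 (x + e).
have ab : a < b.
  by rewrite /a /b lt_min !gt_max; apply/andP; split; apply/andP; split; lra.
have : mu.-negligible (`]a, b[%classic : set R).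
  apply: negligibleS d0 => y; rewrite /= in_itv/= => /andP[ay yb] /=.
  move: ay yb; rewrite /a /b gt_max lt_min => /andP[y0 y1] /andP[y2 y3].
  have Iy : I y by rewrite /unit_itv/= in_itv/= y0.
  move=> /(_ Iy) dy.
  have : `|d x - d y| < `|d x|.
    apply: he; last by rewrite /= in_itv/= !ltW.
    by rewrite /ball/= ltr_norml; apply/andP; split; lra.
  by rewrite dy subr0 ltxx.
have E : mu (`]a, b[%classic : set R) = (b - a)%:E.
  by rewrite lebesgue_measure_itv/= lte_fin ab EFinD.
move=> /negligibleP h; have := etrans (esym E) (h (measurable_itv _)).
by move=> /eqP; rewrite eqe subr_eq0 gt_eqF.
Qed.

End Sobolev_real.

(** * Complex-valued absolutely continuous functions, traces and [H2] *)

Section Sobolev_complex.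
Variable R : realType.
Local Notation C := R[i].
Local Notation mu := (@lebesgue_measure R).
Local Notation I := (@unit_itv R).
Local Notation J := (`[0, 1]%classic : set R).
Local Notation Re := complex.Re.
Local Notation Im := complex.Im.
Implicit Types (w v : R -> C) (f g : L2 R).

Definition cac w v :=
  ac (fun x => Re (w x)) (fun x => Re (v x)) /\
  ac (fun x => Im (w x)) (fun x => Im (v x)).

Definition cintegrable (v : R -> C) :=
  mu.-integrable J (EFin \o (fun x => Re (v x))) /\
  mu.-integrable J (EFin \o (fun x => Im (v x))).

Lemma cac_ext w w' v : {in `[0, 1], w =1 w'} -> cac w v -> cac w' v.
Proof.
by move=> ww' [aR aI]; split; [move: aR|move: aI]; apply: ac_ext => x x01;
  rewrite ww'.
Qed.

Lemma cac_ae w v v' : cintegrable v' -> ae_eq mu I v v' -> cac w v -> cac w v'.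
Proof.
move=> [iR iI] vv' [aR aI]; split; [apply: ac_ae aR|apply: ac_ae aI] => //.
- by apply: filterS vv' => x h /h ->.
- by apply: filterS vv' => x h /h ->.
Qed.

Lemma cac_cst c : cac (fun=> c) (fun=> 0).
Proof. by split; exact: ac_cst. Qed.

Lemma cacD w w' v v' : cac w v -> cac w' v' ->
  cac (fun x => w x + w' x) (fun x => v x + v' x).
Proof.
move=> [a b] [a' b']; split.
  by rewrite (_ : (fun x => Re (w x + w' x)) = (fun x => Re (w x) + Re (w' x)))
    1?(_ : (fun x => Re (v x + v' x)) = (fun x => Re (v x) + Re (v' x)));
    [exact: acD|apply/funext => x; rewrite raddfD..].
by rewrite (_ : (fun x => Im (w x + w' x)) = (fun x => Im (w x) + Im (w' x)))
    1?(_ : (fun x => Im (v x + v' x)) = (fun x => Im (v x) + Im (v' x)));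
    [exact: acD|apply/funext => x; rewrite raddfD..].
Qed.

Lemma complex_ReM (a b : C) : Re (a * b) = Re a * Re b - Im a * Im b.
Proof. by case: a b => [? ?] [? ?]. Qed.

Lemma complex_ImM (a b : C) : Im (a * b) = Re a * Im b + Im a * Re b.
Proof. by case: a b => [? ?] [? ?]. Qed.

Lemma cacM w w' v v' : cac w v -> cac w' v' ->
  cac (fun x => w x * w' x) (fun x => v x * w' x + w x * v' x).
Proof.
move=> [a b] [a' b']; split.
  under eq_fun do rewrite complex_ReM.
  under [X in ac _ X]eq_fun do rewrite raddfD/= !complex_ReM.
  have := acB (acM a a') (acM b b'); rewrite /=.
  by congr ac; apply/funext => x; ring.
under eq_fun do rewrite complex_ImM.
under [X in ac _ X]eq_fun do rewrite raddfD/= !complex_ImM.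
have := acD (acM a b') (acM b a'); rewrite /=.
by congr ac; apply/funext => x; ring.
Qed.

Lemma cacZ c w v : cac w v -> cac (fun x => c * w x) (fun x => c * v x).
Proof.
move=> /(cacM (cac_cst c)); congr cac.
by apply/funext => x; rewrite mul0r add0r.
Qed.

Lemma cacN w v : cac w v -> cac (fun x => - w x) (fun x => - v x).
Proof.
by move=> /(cacZ (-1)); congr cac; apply/funext => x; rewrite mulN1r.
Qed.

Lemma cacB w w' v v' : cac w v -> cac w' v' ->
  cac (fun x => w x - w' x) (fun x => v x - v' x).
Proof. by move=> wv /cacN; exact: cacD. Qed.

Lemma cac_conj w v : cac w v -> cac (fun x => (w x)^*) (fun x => (v x)^*).
Proof.
move=> [a b]; split; [move: a|move: (acN b)]; congr ac; apply/funext => x.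
- by case: (w x).
- by case: (v x).
- by case: (w x).
- by case: (v x).
Qed.

Lemma cac_eq_cst w v x : cac w v -> ae_eq mu I v (fun=> 0) -> x \in `[0, 1] ->
  w x = w 0.
Proof.
move=> [a b] v0 x01; have hR : ae_eq mu I (fun x => Re (v x)) (fun=> 0).
  by apply: filterS v0 => y h /h ->.
have hI : ae_eq mu I (fun x => Im (v x)) (fun=> 0).
  by apply: filterS v0 => y h /h ->.
have := ac_eq_cst b hI x01; have := ac_eq_cst a hR x01.
by case: (w x) (w 0) => [? ?] [? ?] /= -> ->.
Qed.

Lemma cac_cintegral w v : cac w v -> cintegral v = w 1 - w 0.
Proof.
move=> [a b]; rewrite /cintegral (ac_Rintegral a) (ac_Rintegral b).
by case: (w 1) (w 0) => [? ?] [? ?].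
Qed.

Lemma cac_derivative_unique w v v' : cac w v -> cac w v' -> ae_eq mu I v v'.
Proof.
move=> [a b] [a' b'].
have := ac_derivative_unique b b'; have := ac_derivative_unique a a'.
apply: filterS2 => x hR hI Ix; move: (hR Ix) (hI Ix).
by case: (v x) (v' x) => [? ?] [? ?] /= -> ->.
Qed.

(** On an interval of finite length, |a| <= 1 + a^2 + b^2 puts L2 inside L1. *)
Lemma square_integrable_cintegrable (v : R -> C) :
  square_integrable v -> cintegrable v.
Proof.
move=> [mR mI iv].
have i1 : mu.-integrable I (EFin \o (cst 1 : R -> R)).
  by apply/integrable_unit_itv_cc/integrable_continuous; exact: cst_continuous.
have i2 : mu.-integrable I
    (EFin \o (fun x => 1 + (Re (v x) ^+ 2 + Im (v x) ^+ 2))).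
  by apply: (integrableD _ i1 iv); exact: unit_itv_measurable.
have dom (g : R -> R) : measurable_fun I g ->
    (forall x, `|g x| <= 1 + (Re (v x) ^+ 2 + Im (v x) ^+ 2)) ->
    mu.-integrable J (EFin \o g).
  move=> mg gv; apply/integrable_unit_itv_cc.
  move: i2; apply: le_integrable => //.
    exact: unit_itv_measurable.
    exact/measurable_EFinP.
  move=> x _ /=; rewrite lee_fin (le_trans (gv x))//.
  exact: ler_norm.
have sq (a b : R) : `|a| <= 1 + (a ^+ 2 + b ^+ 2).
  rewrite -[a ^+ 2]real_normK ?num_real//; move: `|a| => c.
  have := sqr_ge0 (c - 1); have := sqr_ge0 b; have := sqr_ge0 c.
  move: (b ^+ 2) => d; rewrite !expr2; nra.
split; first by apply: dom => // x; exact: sq.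
by apply: dom => // x; rewrite (addrC (Re (v x) ^+ 2)); exact: sq.
Qed.

Lemma square_integrable_continuous v :
  {within `[0, 1], continuous (fun x => Re (v x))} ->
  {within `[0, 1], continuous (fun x => Im (v x))} -> square_integrable v.
Proof.
move=> cR cI.
have m (g : R -> R) : {within `[0, 1], continuous g} -> measurable_fun I g.
  move=> cg; apply: (@measurable_funS _ _ _ _ J) => //.
    exact: unit_itv_sub_cc.
  by apply: subspace_continuous_measurable_fun.
split; [exact: m|exact: m|].
apply/(integrable_unit_itv_cc (fun x => Re (v x) ^+ 2 + Im (v x) ^+ 2)).
apply: continuous_compact_integrable; first exact: segment_compact.
move=> x; apply: cvgD; apply: cvgM; by [exact: cR|exact: cI].
Qed.

Lemma cac_square_integrable w v : cac w v -> square_integrable w.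
Proof.
move=> [a b]; apply: square_integrable_continuous.
  exact: ac_continuous a.
exact: ac_continuous b.
Qed.

Lemma L2_square_integrable f : square_integrable f.
Proof. by rewrite /L2_repr; case: (repr f) => g hg; exact/L2predP. Qed.

Lemma L2_cintegrable f : cintegrable f.
Proof. exact/square_integrable_cintegrable/L2_square_integrable. Qed.

Definition mkL2 v (hv : square_integrable v) : L2 R :=
  L2_class (MkL2fun (introT (L2predP v) hv)).

Lemma mkL2E v (hv : square_integrable v) : ae_eq mu I (mkL2 hv) v.
Proof. exact: L2_class_repr. Qed.

Lemma L2_eqP f g : f = g <-> ae_eq mu I f g.
Proof.
split=> [->|]; first exact: ae_eq_refl.
rewrite -{2}(reprK f) -{2}(reprK g) => h; exact/L2_classP.
Qed.

Lemma cintegral_test f (psi : R -> R) : continuous psi ->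
  cintegral (fun x => f x * (psi x)%:C) =
    (\int[mu]_(x in J) (Re (f x) * psi x)) +i* (\int[mu]_(x in J) (Im (f x) * psi x)).
Proof.
move=> cpsi; rewrite /cintegral.
have cw : {within `[0, 1], continuous psi} by exact: continuous_subspaceT.
have [fR fI] := L2_cintegrable f.
have m (g : R -> R) : mu.-integrable J (EFin \o g) ->
    \int[mu]_(x in I) (g x * psi x) = \int[mu]_(x in J) (g x * psi x).
  move=> ig; apply: Rintegral_unit_itv_cc.
  apply: (@measurable_funS _ _ _ _ J) => //.
    exact: unit_itv_sub_cc.
  by apply/measurable_EFinP; exact: (measurable_int mu (integrable_mul_continuous ig cw)).
rewrite -(m _ fR) -(m _ fI); congr (_ +i* _); apply: eq_Rintegral => x _.
  by rewrite complex_ReM/= mulr0 subr0.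
by rewrite complex_ImM/= mulr0 add0r.
Qed.

Lemma ae_eq_Rintegral_mul (a b psi : R -> R) :
  mu.-integrable J (EFin \o a) -> mu.-integrable J (EFin \o b) ->
  {within `[0, 1], continuous psi} -> ae_eq mu I a b ->
  \int[mu]_(x in J) (a x * psi x) = \int[mu]_(x in J) (b x * psi x).
Proof.
move=> ia ib cpsi ab; congr fine; apply: ae_eq_integral => //.
- exact: (measurable_int mu (integrable_mul_continuous ia cpsi)).
- exact: (measurable_int mu (integrable_mul_continuous ib cpsi)).
apply: ae_eq_comp; apply: ae_eq_unit_itv_cc.
by apply: filterS ab => x h /h ->.
Qed.

(** Real test functions act separately on real and imaginary parts, so the real case applies to
    each. From here on distributional derivatives are replaced by [cac]. *)
Lemma is_weak_derivativeP f g :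
  is_weak_derivative f g <-> exists2 w, cac w g & ae_eq mu I w f.
Proof.
have [fR fI] := L2_cintegrable f; have [gR gI] := L2_cintegrable g.
split=> [h|[w [aR aI] wf] phi Cphi].
  have h' phi : C1_compact_support phi ->
    (\int[mu]_(x in J) (Re (f x) * derive1 phi x) =
      - \int[mu]_(x in J) (Re (g x) * phi x)) /\
    (\int[mu]_(x in J) (Im (f x) * derive1 phi x) =
      - \int[mu]_(x in J) (Im (g x) * phi x)).
    move=> Cphi; have := h phi Cphi; have [dphi cphi' _] := Cphi.
    have cphi : continuous phi.
      by move=> x; apply/differentiable_continuous/derivable1_diffP/dphi.
    by rewrite !cintegral_test// => -[].
  have [wR aR wfR] := weak_ac fR gR (fun phi C => (h' phi C).1).
  have [wI aI wfI] := weak_ac fI gI (fun phi C => (h' phi C).2).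
  exists (fun x => wR x +i* wI x); first by split.
  apply: filterS2 wfR wfI => x hR hI Ix; rewrite hR// hI//.
  by case: (f x).
have [dphi cphi' _] := Cphi.
have cphi : continuous phi.
  by move=> x; apply/differentiable_continuous/derivable1_diffP/dphi.
have cw' := continuous_subspaceT cphi'.
rewrite !cintegral_test//.
have [wR wI] := square_integrable_cintegrable (cac_square_integrable (conj aR aI)).
rewrite -(ae_eq_Rintegral_mul wR fR (cw' _)); last first.
  by apply: filterS wf => x h /h ->.
rewrite -(ae_eq_Rintegral_mul wI fI (cw' _)); last first.
  by apply: filterS wf => x h /h ->.
by rewrite (ac_weak aR Cphi) (ac_weak aI Cphi).
Qed.

Lemma cac_continuous_representative f w v : cac w v -> ae_eq mu I w f ->
  is_continuous_representative f w.
Proof.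
by move=> [a b] wf; split => //; [exact: ac_continuous a|exact: ac_continuous b].
Qed.

Lemma continuous_representative_unique f w w' :
  is_continuous_representative f w -> is_continuous_representative f w' ->
  {in `[0, 1], w =1 w'}.
Proof.
move=> [cR cI wf] [cR' cI' wf'] x x01.
have cB (a b : R -> R) : {within `[0, 1], continuous a} ->
    {within `[0, 1], continuous b} -> {within `[0, 1], continuous (fun x => a x - b x)}.
  by move=> ca cb y; apply: cvgB; [exact: ca|exact: cb].
have hR := continuous_ae_eq0 (cB _ _ cR cR').
have hI := continuous_ae_eq0 (cB _ _ cI cI').
have /eqP : Re (w x) - Re (w' x) = 0.
  by apply: hR => //; apply: filterS2 wf wf' => y h h' Iy; rewrite h// h'// subrr.
have /eqP : Im (w x) - Im (w' x) = 0.
  by apply: hI => //; apply: filterS2 wf wf' => y h h' Iy; rewrite h// h'// subrr.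
rewrite !subr_eq0 => /eqP + /eqP.
by case: (w x) (w' x) => [? ?] [? ?] /= -> ->.
Qed.

(** The choice made by [xget] in [trace] is harmless because continuous representatives agree on the
    whole closed interval. *)
Lemma traceE f w v x : cac w v -> ae_eq mu I w f -> x \in `[0, 1] ->
  trace f x = w x.
Proof.
move=> a wf x01; have wr := cac_continuous_representative a wf.
rewrite /trace; case: xgetP => [c _ [w' wr' ->]|/(_ (w x))].
  exact: continuous_representative_unique wr' wr _ x01.
by move=> h; exfalso; apply: h; exists w.
Qed.

Lemma cac_unique f w w' v v' : cac w v -> cac w' v' ->
  ae_eq mu I w f -> ae_eq mu I w' f -> {in `[0, 1], w =1 w'}.
Proof.
move=> a a' wf wf'; apply: continuous_representative_unique.
  exact: cac_continuous_representative a wf.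
exact: cac_continuous_representative a' wf'.
Qed.

Lemma weak_derivativeE f g : is_weak_derivative f g -> weak_derivative f = g.
Proof.
move=> fg; rewrite /weak_derivative; case: xgetP => [g' _ /=|/(_ g)//].
move=> /is_weak_derivativeP[w' a' wf']; move: fg => /is_weak_derivativeP[w a wf].
apply/L2_eqP; apply: (cac_derivative_unique _ a).
exact: cac_ext (cac_unique a' a wf' wf) a'.
Qed.

Lemma H2_representative f : H2 f -> exists w w1,
  [/\ cac w w1, cac w1 (weak_derivative (weak_derivative f)),
      ae_eq mu I w f & ae_eq mu I w1 (weak_derivative f)].
Proof.
move=> [[g fg] [h]]; rewrite (weak_derivativeE fg) => gh.
rewrite (weak_derivativeE gh).
move: fg => /is_weak_derivativeP[w a wf]; move: gh => /is_weak_derivativeP[w1 a1 w1g].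
exists w, w1; split => //; apply: cac_ae a; last exact: ae_eq_sym.
exact/square_integrable_cintegrable/(cac_square_integrable a1).
Qed.

(** Being continuous on [0, 1], [w1] is square integrable, so its class can serve as the weak
    derivative of [f]. *)
Lemma representative_H2 f w w1 (h : L2 R) : cac w w1 -> cac w1 h ->
  ae_eq mu I w f ->
  [/\ H2 f, weak_derivative (weak_derivative f) = h &
      ae_eq mu I w1 (weak_derivative f)].
Proof.
move=> a a1 wf; pose g := mkL2 (cac_square_integrable a1).
have gE : ae_eq mu I g w1 by exact: mkL2E.
have fg : is_weak_derivative f g.
  apply/is_weak_derivativeP; exists w => //; apply: cac_ae a; last exact: ae_eq_sym.
  exact: L2_cintegrable.
have gh : is_weak_derivative g h.
  by apply/is_weak_derivativeP; exists w1 => //; exact: ae_eq_sym.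
rewrite (weak_derivativeE fg) (weak_derivativeE gh); split => //; last exact: ae_eq_sym.
by split; [exists g|rewrite (weak_derivativeE fg); exists h].
Qed.

End Sobolev_complex.

(** * The equation (B - l) f = g as a boundary value problem for pointwise functions *)

Section Kirchhoff_solutions.
Variable R : realType.
Local Notation C := R[i].
Local Notation mu := (@lebesgue_measure R).
Local Notation I := (@unit_itv R).
Local Notation J := (`[0, 1]%classic : set R).
Local Notation Re := complex.Re.
Local Notation Im := complex.Im.
Implicit Types (u v : R -> C).

Lemma cintegrableD u v : cintegrable u -> cintegrable v ->
  cintegrable (fun x => u x + v x).
Proof.
move=> [uR uI] [vR vI]; split.
  rewrite (_ : (fun x => _) = (fun x => Re (u x) + Re (v x))).
    exact: (integrableD _ uR vR).
  by apply/funext => x; rewrite raddfD.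
rewrite (_ : (fun x => _) = (fun x => Im (u x) + Im (v x))).
  exact: (integrableD _ uI vI).
by apply/funext => x; rewrite raddfD.
Qed.

Lemma cintegrableZ c u : cintegrable u -> cintegrable (fun x => c * u x).
Proof.
move=> [uR uI]; split.
  rewrite (_ : (fun x => _) = (fun x => Re c * Re (u x) - Im c * Im (u x))).
    exact: (integrableB _ (integrableZl _ (Re c) uR) (integrableZl _ (Im c) uI)).
  by apply/funext => x; rewrite complex_ReM.
rewrite (_ : (fun x => _) = (fun x => Re c * Im (u x) + Im c * Re (u x))).
  exact: (integrableD _ (integrableZl _ (Re c) uI) (integrableZl _ (Im c) uR)).
by apply/funext => x; rewrite complex_ImM.
Qed.

Lemma cintegrable0 : cintegrable (fun=> 0 : C).
Proof. by split; exact: integrable0. Qed.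

Lemma cac_cintegrable u v : cac u v -> cintegrable u.
Proof. by move=> a; exact/square_integrable_cintegrable/(cac_square_integrable a). Qed.

Lemma L2_addE (f g : L2 R) : ae_eq mu I (f + g : L2 R) (fun x => f x + g x).
Proof. exact: L2_class_repr. Qed.

Lemma L2_scaleE c (f : L2 R) : ae_eq mu I (c *: f : L2 R) (fun x => c * f x).
Proof. exact: L2_class_repr. Qed.

Lemma L2_zeroE : ae_eq mu I (0 : L2 R) (fun=> 0).
Proof. exact: L2_class_repr. Qed.

Variables np nm : nat.
Local Notation n := (np + nm)%N.
Local Notation B := (indefinite_kirchhoff R np nm).
Implicit Types (w g : 'I_n -> R -> C) (l : C).

(** The sign in w'' = eps (l w + g), which is opposite to the sign of the edge in the Krein product.
    Since it squares to 1, the equation is solved for w'' by multiplying with it. *)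
Definition edge_sign (j : 'I_n) : C := if (j < np)%N then -1 else 1.

Lemma edge_sign_sqr j : edge_sign j * edge_sign j = 1.
Proof. by rewrite /edge_sign; case: ifP; rewrite ?mulrNN mulr1. Qed.

Lemma kirchhoff_appE (f : L2G R n) j :
  app B f j = edge_sign j *: weak_derivative (weak_derivative (f j)).
Proof. by rewrite ffunE /edge_sign; case: ifP; rewrite ?scaleN1r ?scale1r. Qed.

Lemma shift_kirchhoffE l (f : L2G R n) j : Defs.shift B l f j =
  edge_sign j *: weak_derivative (weak_derivative (f j)) - l *: f j.
Proof. by rewrite -kirchhoff_appE /Defs.shift !ffunE. Qed.

(** Values and slopes are genuine functions, so vertex conditions are plain evaluations; only [g] is
    subject to almost everywhere equality. *)
Definition kirchhoff_solution l g w (w1 : 'I_n -> R -> C) :=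
  [/\ forall j, cac (w j) (w1 j) /\
        cac (w1 j) (fun x => edge_sign j * (l * w j x + g j x)),
      forall j, w j 1 = 0, forall i j, w i 0 = w j 0 & \sum_j w1 j 0 = 0].

Lemma kirchhoff_solution_ae l g g' w w1 : (forall j, cintegrable (g' j)) ->
  (forall j, ae_eq mu I (g j) (g' j)) ->
  kirchhoff_solution l g w w1 -> kirchhoff_solution l g' w w1.
Proof.
move=> ig gg' [a w1_0 c k]; split => // j; have [a0 a1] := a j; split => //.
apply: cac_ae a1.
  apply/cintegrableZ/cintegrableD => //; exact/cintegrableZ/(cac_cintegrable a0).
by apply: filterS (gg' j) => x h /h ->.
Qed.

Lemma shift_kirchhoffP l (f g : L2G R n) :
  (dom B f /\ Defs.shift B l f = g) <-> exists w w1,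
    kirchhoff_solution l (fun j => g j : R -> C) w w1 /\
    forall j, ae_eq mu I (w j) (f j).
Proof.
split=> [[[f_H2 f1 f0 fk] fg]|[w [w1 [[a w_1 w_0 wk] wf]]]].
  have /choice [w /choice [w1 h]] : forall j, exists u u1,
    [/\ cac u u1, cac u1 (weak_derivative (weak_derivative (f j))),
      ae_eq mu I u (f j) & ae_eq mu I u1 (weak_derivative (f j))].
    by move=> j; exact: H2_representative.
  exists w, w1; split; last by move=> j; have [] := h j.
  split.
  - move=> j; have [a a1 wf w1f] := h j; split => //.
    have E : weak_derivative (weak_derivative (f j)) = edge_sign j *: (l *: f j + g j).
      by rewrite -fg shift_kirchhoffE [l *: _ + _]addrC subrK scalerA edge_sign_sqr scale1r.
    rewrite E in a1; apply: cac_ae a1.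
      apply/cintegrableZ/cintegrableD; last exact: L2_cintegrable.
      exact/cintegrableZ/(cac_cintegrable a).
    have := L2_scaleE (edge_sign j) (l *: f j + g j).
    have := L2_addE (l *: f j) (g j); have := L2_scaleE l (f j); move: wf.
    move=> A1 A2 A3 A4; apply: filterS2 (filterI A1 A2) (filterI A3 A4).
    by move=> x [h1 h2] [h3 h4] Ix; rewrite h4// h3// h2// h1.
  - move=> j; have [a a1 wf w1f] := h j.
    by rewrite -(traceE a wf mem1_itv01) f1.
  - move=> i j; have [a a1 wf w1f] := h j; have [a' a1' wf' w1f'] := h i.
    by rewrite -(traceE a wf mem0_itv01) -(traceE a' wf' mem0_itv01) (f0 i j).
  - rewrite -[RHS]fk; apply: eq_bigr => j _; have [a a1 wf w1f] := h j.
    by rewrite -(traceE a1 w1f mem0_itv01).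
pose h j : L2 R := edge_sign j *: (l *: f j + g j).
have ah j : cac (w1 j) (h j).
  have [a0 a1] := a j; apply: cac_ae a1; first exact: L2_cintegrable.
  have := L2_scaleE (edge_sign j) (l *: f j + g j).
  have := L2_addE (l *: f j) (g j); have := L2_scaleE l (f j); move: (wf j).
  move=> A1 A2 A3 A4; apply: filterS2 (filterI A1 A2) (filterI A3 A4).
  by move=> x [h1 h2] [h3 h4] Ix; rewrite h4// h3// h2// h1.
have H j := representative_H2 (a j).1 (ah j) (wf j).
split; first split.
- by move=> j; have [] := H j.
- by move=> j; rewrite (traceE (a j).1 (wf j) mem1_itv01) w_1.
- by move=> i j; rewrite (traceE (a i).1 (wf i) mem0_itv01) (traceE (a j).1 (wf j) mem0_itv01).
- rewrite -[RHS]wk; apply: eq_bigr => j _; have [_ _ w1f] := H j.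
  by rewrite (traceE (ah j) w1f mem0_itv01).
apply/ffunP => j; rewrite shift_kirchhoffE; have [_ -> _] := H j.
by rewrite scalerA edge_sign_sqr scale1r addrC addKr.
Qed.

End Kirchhoff_solutions.

(** * Linear equations of first and second order on one edge, with estimates *)

Section ODE.
Variable R : realType.
Local Notation C := R[i].
Local Notation mu := (@lebesgue_measure R).
Local Notation I := (@unit_itv R).
Local Notation J := (`[0, 1]%classic : set R).
Local Notation Re := complex.Re.
Local Notation Im := complex.Im.
Implicit Types (u v : R -> C).

(** A submultiplicative real-valued size; the norm of [R[i]] takes its values in [R[i]]. *)
Definition cl1 (z : C) : R := `|Re z| + `|Im z|.

Lemma cl1_ge0 z : 0 <= cl1 z. Proof. exact: addr_ge0. Qed.

Lemma cl1_0 : cl1 0 = 0. Proof. by rewrite /cl1/= normr0 addr0. Qed.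

Lemma cl1D a b : cl1 (a + b) <= cl1 a + cl1 b.
Proof. by rewrite /cl1 !raddfD/= addrACA lerD// ler_normD. Qed.

Lemma cl1N a : cl1 (- a) = cl1 a.
Proof. by rewrite /cl1 !raddfN/= !normrN. Qed.

Lemma cl1B a b : cl1 (a - b) <= cl1 a + cl1 b.
Proof. by rewrite -(cl1N b); exact: cl1D. Qed.

Lemma cl1M a b : cl1 (a * b) <= cl1 a * cl1 b.
Proof.
rewrite /cl1 complex_ReM complex_ImM.
apply: (le_trans (lerD (ler_normB _ _) (ler_normD _ _))).
rewrite !normrM; move: `|Re a| `|Im a| `|Re b| `|Im b| => p q r s.
by rewrite le_eqVlt; apply/orP; left; apply/eqP; ring.
Qed.

Lemma cl1_sum (I : finType) (F : I -> C) : cl1 (\sum_i F i) <= \sum_i cl1 (F i).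
Proof.
elim/big_rec2 : _ => [|i y x _ h]; first by rewrite cl1_0.
by apply: (le_trans (cl1D _ _)); rewrite lerD2l.
Qed.

Lemma cintegrable_mul u v v' : cac v v' -> cintegrable u ->
  cintegrable (fun x => v x * u x).
Proof.
move=> [a b] [iR iI]; have ca := ac_continuous a; have cb := ac_continuous b.
split.
  rewrite (_ : (fun x => _) = (fun x => Re (u x) * Re (v x) - Im (u x) * Im (v x))).
    exact: (integrableB _ (integrable_mul_continuous iR ca) (integrable_mul_continuous iI cb)).
  by apply/funext => x; rewrite complex_ReM; ring.
rewrite (_ : (fun x => _) = (fun x => Im (u x) * Re (v x) + Re (u x) * Im (v x))).
  exact: (integrableD _ (integrable_mul_continuous iI ca) (integrable_mul_continuous iR cb)).
by apply/funext => x; rewrite complex_ImM; ring.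
Qed.

Definition L1norm u : R := \int[mu]_(x in J) cl1 (u x).

Lemma cintegrable_cl1 u : cintegrable u -> mu.-integrable J (EFin \o (fun x => cl1 (u x))).
Proof.
by move=> [iR iI]; exact: (integrableD _ (integrable_norm iR) (integrable_norm iI)).
Qed.

Lemma L1norm_ge0 u : 0 <= L1norm u.
Proof. by apply: Rintegral_ge0 => x _; exact: cl1_ge0. Qed.

Lemma cac_primitive u : cintegrable u -> exists v, [/\ cac v u, v 0 = 0 &
  forall x, x \in `[0, 1] -> cl1 (v x) <= L1norm u].
Proof.
move=> [iR iI].
have pre (h : R -> R) x : x \in `[0, 1] -> mu.-integrable J (EFin \o h) ->
    `|\int[mu]_(t in `[0, x]) h t| <= \int[mu]_(t in J) `|h t|.
  move=> x01 ih; apply: (le_trans (le_normr_Rintegral _ (integrable_prefix x01 ih))) => //.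
  rewrite Rintegral_mkcond [leRHS]Rintegral_mkcond.
  apply: le_Rintegral => //.
  - have /integrable_mkcond := integrable_prefix x01 (integrable_norm ih).
    by rewrite restrict_EFin; exact.
  - have /integrable_mkcond := integrable_norm ih.
    by rewrite restrict_EFin; exact.
  move=> t _; rewrite !patchE; case: ifPn => [|_]; last first.
    by case: ifPn => _; [exact: normr_ge0|exact: lexx].
  rewrite inE => tx; rewrite mem_set//; apply: prefix_sub tx.
  by move: x01; rewrite in_itv/= => /andP[].
exists (fun x => (0 + \int[mu]_(t in `[0, x]) Re (u t)) +i*
                 (0 + \int[mu]_(t in `[0, x]) Im (u t))); split.
- by split; exact: ac_primitive.
- by rewrite set_itv1 !Rintegral_set1 !addr0.
move=> x x01; rewrite /L1norm /cl1 RintegralD//=; last 2 first.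
- exact: (integrable_norm iR).
- exact: (integrable_norm iI).
by rewrite !add0r lerD//; exact: pre.
Qed.

Definition cexp (z : C) (x : R) : C :=
  (expR (Re z * x) * cos (Im z * x)) +i* (expR (Re z * x) * sin (Im z * x)).

Lemma cexpMN z x : cexp (- z) x * cexp z x = 1.
Proof.
rewrite /cexp !raddfN/= !mulNr expRN cosN sinN.
have h : (expR (Re z * x))^-1 * expR (Re z * x) = 1 by rewrite mulVf// gt_eqF// expR_gt0.
have k := cos2Dsin2 (Im z * x).
move: (cos (Im z * x)) (sin (Im z * x)) k => c s k.
move: h; move: (expR (Re z * x))^-1 => p; move: (expR (Re z * x)) => q h.
apply/eqP; rewrite eq_complex/=; apply/andP; split; apply/eqP.
  transitivity ((p * q) * (c ^+ 2 + s ^+ 2)); first by ring.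
  by rewrite h k mulr1.
by ring.
Qed.

Lemma cac_cexp z : cac (cexp z) (fun x => z * cexp z x).
Proof.
pose a := Re z; pose b := Im z.
have ce : continuous (fun x : R => expR (a * x)).
  by move=> x; apply: continuous_comp; [exact: mulrl_continuous|exact: continuous_expR].
have cc : continuous (fun x : R => cos (b * x)).
  by move=> x; apply: continuous_comp; [exact: mulrl_continuous|exact: continuous_cos].
have cs : continuous (fun x : R => sin (b * x)).
  by move=> x; apply: continuous_comp; [exact: mulrl_continuous|exact: continuous_sin].
have lin (c x : R) : is_derive x 1 (fun y : R => c * y) c.
  by apply: is_derive_eq; rewrite scaler1.
have cec : ac (fun x => expR (a * x)) (fun x => a * expR (a * x)).
  apply: ac_C1 => [x|]; last by move=> x; apply: cvgM; [exact: cvg_cst|exact: ce].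
  by have := lin a x => ?; apply: is_derive_eq; rewrite /GRing.scale/= mulrC.
have ccc : ac (fun x => cos (b * x)) (fun x => - (b * sin (b * x))).
  apply: ac_C1 => [x|]; last by move=> x; apply: cvgN; apply: cvgM; [exact: cvg_cst|exact: cs].
  by have := lin b x => ?; apply: is_derive_eq; rewrite /GRing.scale/=; ring.
have csc : ac (fun x => sin (b * x)) (fun x => b * cos (b * x)).
  apply: ac_C1 => [x|]; last by move=> x; apply: cvgM; [exact: cvg_cst|exact: cc].
  by have := lin b x => ?; apply: is_derive_eq; rewrite /GRing.scale/=; ring.
split; [have := acM cec ccc|have := acM cec csc]; congr ac; apply/funext => x.
  by rewrite complex_ReM /cexp/= -/a -/b; ring.
by rewrite complex_ImM /cexp/= -/a -/b; ring.
Qed.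

Lemma cac_bounded u v : cac u v -> exists2 K, 0 <= K & {in `[0, 1], forall x, cl1 (u x) <= K}.
Proof.
move=> [a b].
have bnd (h : R -> R) : {within `[0, 1], continuous h} ->
    exists2 K, 0 <= K & {in `[0, 1], forall x, `|h x| <= K}.
  move=> ch; have /compact_bounded[M [_ mrt]] := continuous_compact ch (@segment_compact _ 0 1).
  exists (`|M| + 1) => [|x x01]; first exact: addr_ge0.
  apply: mrt; first by rewrite (le_lt_trans (ler_norm _))// ltrDl.
  by exists x.
have [K K0 hK] := bnd _ (ac_continuous a).
have [L L0 hL] := bnd _ (ac_continuous b).
exists (K + L) => [|x x01]; first exact: addr_ge0.
by rewrite lerD// ?hK ?hL.
Qed.

(** The product of [u] with the integrating factor exp(-zx) has zero derivative and vanishes at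
    1. *)
Lemma cac_linear_unique z u v : cac u v -> {in `[0, 1], forall x, v x = z * u x} ->
  u 1 = 0 -> {in `[0, 1], forall x, u x = 0}.
Proof.
move=> a vE u1 x x01.
have ae0 := cacM (cac_cexp (- z)) a.
have E0 : ae_eq mu I (fun x => - z * cexp (- z) x * u x + cexp (- z) x * v x) (fun=> 0).
  apply: aeW => t It; rewrite vE; last exact: unit_itv_sub_cc.
  by ring.
have := cac_eq_cst ae0 E0 mem1_itv01; rewrite u1 mulr0 => /esym h.
have := cac_eq_cst ae0 E0 x01; rewrite h => /(congr1 (fun y => cexp z x * y)).
by rewrite mulr0 mulrA [cexp z x * _]mulrC cexpMN mul1r.
Qed.

(** Variation of constants, started at the outer vertex x = 1. The bound K depends on z alone, as a
    bounded inverse requires. *)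
Lemma ODE1_exists z : exists2 K, 0 <= K & forall g (c : C), cintegrable g ->
  exists u, [/\ cac u (fun x => z * u x + g x), u 1 = c &
    c = 0 -> {in `[0, 1], forall x, cl1 (u x) <= K * L1norm g}].
Proof.
have [K K0 hK] := cac_bounded (cac_cexp z).
have [L L0 hL] := cac_bounded (cac_cexp (- z)).
(* K and L bound exp(zx) and exp(-zx); L is doubled because the primitive [p] enters as
   [p x - p 1]. *)
exists (K * (L + L)); first by rewrite mulr_ge0// addr_ge0.
move=> g c ig.
have ig' := cintegrable_mul (cac_cexp (- z)) ig.
have [p [ap p0 pb]] := cac_primitive ig'.
have pL x : x \in `[0, 1] -> cl1 (p x) <= L * L1norm g.
  move=> x01; apply: (le_trans (pb x x01)).
  rewrite -RintegralZl//; last exact: cintegrable_cl1.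
  apply: le_Rintegral => //; first exact: cintegrable_cl1.
    exact: (integrableZl _ L (cintegrable_cl1 ig)).
  move=> t Jt; apply: (le_trans (cl1M _ _)); rewrite ler_wpM2r ?cl1_ge0//.
  exact: hL.
pose q x := p x - p 1 + cexp (- z) 1 * c.
have aq : cac q (fun x => cexp (- z) x * g x).
  have := cacD (cacB ap (cac_cst (p 1))) (cac_cst (cexp (- z) 1 * c)).
  by congr cac; apply/funext => x; rewrite subr0 addr0.
exists (fun x => cexp z x * q x); split.
- have := cacM (cac_cexp z) aq; congr cac; apply/funext => x.
  by rewrite !mulrA [cexp z x * _]mulrC cexpMN mul1r.
- by rewrite /q subrr add0r mulrA [cexp z 1 * _]mulrC cexpMN mul1r.
move=> c0 x x01; rewrite /q c0 mulr0 addr0.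
apply: (le_trans (cl1M _ _)); rewrite -[leRHS]mulrA.
apply: ler_pM; rewrite ?cl1_ge0 ?hK//.
by rewrite mulrDl (le_trans (cl1B _ _))// lerD// pL ?mem1_itv01.
Qed.

Lemma L1norm_le u K : {in `[0, 1], forall x, cl1 (u x) <= K} ->
  cintegrable u -> L1norm u <= K.
Proof.
move=> uK iu; rewrite /L1norm.
apply: (@le_trans _ _ (\int[mu]_(x in J) K)).
  apply: le_Rintegral => //; first exact: cintegrable_cl1.
  exact: (integrable_continuous (@cst_continuous _ _ K)).
by rewrite Rintegral_cst// (congr1 fine (lebesgue_itv01 R)) mulr1.
Qed.

(* y'' - z y factors as (D - o)(D + o) y when o ^ 2 = z *)
Lemma ODE2_exists (z : C) : exists2 K : R, 0 <= K & forall g : R -> C, cintegrable g ->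
  exists y y1 : R -> C, [/\ cac y y1, cac y1 (fun x => z * y x + g x), y 1 = 0 /\ y1 1 = 0,
    {in `[0, 1], forall x, cl1 (y x) <= K * L1norm g} &
    {in `[0, 1], forall x, cl1 (y1 x) <= K * L1norm g}].
Proof.
have zE := sqr_sqrtc z; set o := sqrtc z in zE.
have [K K0 hK] := ODE1_exists o; have [L L0 hL] := ODE1_exists (- o).
exists (L * K + (K + cl1 o * (L * K))).
  by rewrite !addr_ge0// ?mulr_ge0// ?cl1_ge0// mulr_ge0.
move=> g ig; have [u [au u1 ub]] := hK g 0 ig.
have iu := cac_cintegrable au.
have [y [ay y1 yb]] := hL u 0 iu.
have uG := L1norm_le (ub erefl) iu.
have yb' : {in `[0, 1], forall x, cl1 (y x) <= L * K * L1norm g}.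
  move=> x x01; apply: (le_trans (yb erefl x x01)).
  by rewrite -mulrA ler_wpM2l.
have G0 := L1norm_ge0 g.
exists y, (fun x => u x - o * y x); split.
- by move: ay; congr cac; apply/funext => x; ring.
- have := cacB au (cacZ o ay); congr cac; apply/funext => x.
  by rewrite -zE; ring.
- by rewrite u1 y1; split => //; ring.
- move=> x x01; apply: (le_trans (yb' x x01)).
  by rewrite ler_wpM2r// lerDl addr_ge0// mulr_ge0 ?cl1_ge0// mulr_ge0.
move=> x x01; apply: (le_trans (cl1B _ _)).
rewrite [leRHS]mulrDl -[leLHS]add0r lerD ?mulr_ge0//.
rewrite mulrDl lerD//; first exact: ub.
apply: (le_trans (cl1M _ _)); rewrite -mulrA ler_wpM2l ?cl1_ge0//.
exact: yb'.
Qed.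

Lemma ODE2_fundamental (z : C) : exists y y1 : R -> C,
  [/\ cac y y1, cac y1 (fun x => z * y x), y 1 = 0 & y1 1 = 1].
Proof.
have zE := sqr_sqrtc z; set o := sqrtc z in zE.
have [K K0 hK] := ODE1_exists o; have [L L0 hL] := ODE1_exists (- o).
have [u [au u1 _]] := hK (fun=> 0) 1 (cintegrable0 R).
have [y [ay y1 _]] := hL u 0 (cac_cintegrable au).
exists y, (fun x => u x - o * y x); split => //.
- by move: ay; congr cac; apply/funext => x; ring.
- have := cacB au (cacZ o ay); congr cac; apply/funext => x.
  by rewrite -zE; ring.
- by rewrite u1 y1; ring.
Qed.

(** With o^2 = z, first y' + o y vanishes as a solution of u' = o u, then y as a solution of y' = -o
    y. *)
Lemma ODE2_unique (z : C) (y y1 v : R -> C) : cac y y1 -> cac y1 v ->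
  {in `[0, 1], forall x, v x = z * y x} -> y 1 = 0 -> y1 1 = 0 ->
  {in `[0, 1], forall x, y x = 0 /\ y1 x = 0}.
Proof.
move=> ay ay1 vE y_1 y1_1.
have zE := sqr_sqrtc z; set o := sqrtc z in zE.
have u0 := cac_linear_unique (z := o) (cacD ay1 (cacZ o ay)).
have {}u0 : {in `[0, 1], forall x, y1 x + o * y x = 0}.
  by apply: u0 => [x x01|]; [rewrite vE// -zE; ring|rewrite y_1 y1_1 mulr0 addr0].
have y0 : {in `[0, 1], forall x, y x = 0}.
  apply: (cac_linear_unique (z := - o) ay) => // x x01.
  by rewrite mulNr; apply/eqP; rewrite -addr_eq0 u0.
by move=> x x01; have := u0 x x01; rewrite y0// mulr0 addr0.
Qed.

End ODE.

(** * Solvability of the coupled problem and the resolvent set *)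

Section Shooting.
Variable R : realType.
Local Notation C := R[i].
Local Notation mu := (@lebesgue_measure R).
Local Notation J := (`[0, 1]%classic : set R).
Variables np nm : nat.
Local Notation n := (np + nm)%N.
Local Notation B := (indefinite_kirchhoff R np nm).
Local Notation eps := (@edge_sign R np nm).
Local Notation zero_data := (fun (_ : 'I_n) (_ : R) => 0 : C).
Implicit Types (w g : 'I_n -> R -> C) (l : C).


Lemma kernel_kirchhoffP l (f : L2G R n) :
  (dom B f /\ Defs.shift B l f = 0) <-> exists w w1,
    kirchhoff_solution l zero_data w w1 /\
    forall j, ae_eq mu (@unit_itv R) (w j) (f j).
Proof.
rewrite shift_kirchhoffP; split=> -[w [w1 [sol wf]]]; exists w, w1; split => //.
  apply: kirchhoff_solution_ae sol => j; first exact: cintegrable0.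
  by rewrite ffunE; exact: L2_zeroE.
apply: kirchhoff_solution_ae sol => j; first exact: L2_cintegrable.
by rewrite ffunE; apply: ae_eq_sym; exact: L2_zeroE.
Qed.

Lemma kirchhoff_solution0 l : kirchhoff_solution l zero_data zero_data zero_data.
Proof.
split => //; last by rewrite big1.
move=> j; split; first exact: cac_cst.
by have := cac_cst (0 : C); congr cac; apply/funext => x; rewrite addr0 !mulr0.
Qed.

Lemma kernel0 l : dom B (0 : L2G R n) /\ Defs.shift B l 0 = 0.
Proof.
apply/kernel_kirchhoffP; exists zero_data, zero_data; split.
  exact: kirchhoff_solution0.
by move=> j; rewrite ffunE; apply: ae_eq_sym; exact: L2_zeroE.
Qed.

Lemma kirchhoff_solutionB l g g' w w' w1 w1' :
  kirchhoff_solution l g w w1 -> kirchhoff_solution l g' w' w1' ->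
  kirchhoff_solution l (fun j x => g j x - g' j x) (fun j x => w j x - w' j x)
    (fun j x => w1 j x - w1' j x).
Proof.
move=> [a b c d] [a' b' c' d']; split.
- move=> j; have [a0 a1] := a j; have [a0' a1'] := a' j; split; first exact: cacB.
  by have := cacB a1 a1'; congr cac; apply/funext => x; ring.
- by move=> j; rewrite b b' subrr.
- by move=> i j; rewrite (c i j) (c' i j).
- by rewrite sumrB d d' subrr.
Qed.

(** The derivative vanishes almost everywhere, hence everywhere because it is itself absolutely
    continuous. *)
Lemma cac_derivative_eq0 (u v v' : R -> C) : cac u v -> cac v v' ->
  {in `[0, 1], forall x, u x = 0} -> {in `[0, 1], forall x, v x = 0}.
Proof.
move=> a b u0 x x01.
have a0 : cac u (fun=> 0).
  by apply: cac_ext (cac_cst 0) => y y01; rewrite u0.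
have v0 := cac_derivative_unique a a0.
have := cac_unique b (cac_cst 0) (f := 0).
apply => //; last by apply: ae_eq_sym; exact: L2_zeroE.
by apply: ae_eq_trans v0 _; apply: ae_eq_sym; exact: L2_zeroE.
Qed.

(** On each edge the solution is a particular one with zero data at 1 plus a multiple a_j of the
    fundamental one with slope 1 there. The central vertex conditions are a linear system for the
    a_j, whose invertibility is exactly the injectivity assumed. *)
Lemma shooting_solve l (j0 : 'I_n) :
  (forall w w1, kirchhoff_solution l zero_data w w1 ->
     forall j, {in `[0, 1], forall x, w j x = 0}) ->
  exists K : R, forall g, (forall j, cintegrable (g j)) ->
    exists w w1, kirchhoff_solution l g w w1 /\
    forall j, {in `[0, 1], forall x, cl1 (w j x) <= K * \sum_i L1norm (g i)}.
Proof.
move=> inj.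
have /choice[K hK] : forall j, exists K : R, 0 <= K /\ forall g : R -> C, cintegrable g ->
  exists y y1 : R -> C, [/\ cac y y1,
    cac y1 (fun x => eps j * l * y x + g x), y 1 = 0 /\ y1 1 = 0,
    {in `[0, 1], forall x, cl1 (y x) <= K * L1norm g} &
    {in `[0, 1], forall x, cl1 (y1 x) <= K * L1norm g}].
  by move=> j; have [K K0 h] := ODE2_exists (eps j * l); exists K.
have /choice[ss hs] : forall j, exists ss : (R -> C) * (R -> C),
  [/\ cac ss.1 ss.2, cac ss.2 (fun x => eps j * l * ss.1 x), ss.1 1 = 0 & ss.2 1 = 1].
  by move=> j; have [y [y1 h]] := ODE2_fundamental (eps j * l); exists (y, y1).
pose s j := (ss j).1; pose s1 j := (ss j).2.
have /choice[S hS] : forall j, exists S : R,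
    0 <= S /\ {in `[0, 1], forall x, cl1 (s j x) <= S}.
  by move=> j; have [a _ _ _] := hs j; have [S S0 h] := cac_bounded a; exists S.
(* Slopes form a row vector multiplied by [M] on the right: column [j0] computes the sum of
   derivatives at the centre, any other column i the jump between edge i and edge [j0]. *)
pose M : 'M[C]_n := \matrix_(j, i) if i == j0 then s1 j 0 else
   (j == i)%:R * s i 0 - (j == j0)%:R * s j0 0.
have aM (a : 'rV_n) i : (a *m M) 0 i =
   if i == j0 then \sum_j a 0 j * s1 j 0 else a 0 i * s i 0 - a 0 j0 * s j0 0.
  rewrite mxE; case: (eqVneq i j0) => [->|ij0].
    by apply: eq_bigr => j _; rewrite mxE eqxx.
  have pick (k : 'I_n) (c : C) : \sum_j a 0 j * ((j == k)%:R * c) = a 0 k * c.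
    rewrite (bigD1 k)//= eqxx mul1r big1 ?addr0// => j /negPf ->.
    by rewrite mul0r mulr0.
  rewrite -(pick i) -(pick j0) -sumrB; apply: eq_bigr => j _.
  by rewrite mxE (negPf ij0) mulrBr.
(* a solution is determined by its slopes a_j at the outer vertices *)
have sol g (p p1 : 'I_n -> R -> C) (a : 'rV_n) :
    (forall j, [/\ cac (p j) (p1 j), cac (p1 j) (fun x => eps j * l * p j x + eps j * g j x),
       p j 1 = 0 & p1 j 1 = 0]) ->
    (forall i, (a *m M) 0 i = - if i == j0 then \sum_j p1 j 0 else p i 0 - p j0 0) ->
  kirchhoff_solution l g (fun j x => a 0 j * s j x + p j x)
    (fun j x => a 0 j * s1 j x + p1 j x).
  move=> hp ha; split.
  - move=> j; have [p0 p1' _ _] := hp j; have [s0 s1' _ _] := hs j; split.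
      exact: (cacD (cacZ _ s0) p0).
    have := cacD (cacZ (a 0 j) s1') p1'; congr cac; apply/funext => x.
    by rewrite /s; ring.
  - move=> j; have [_ _ -> _] := hp j; rewrite /s.
    by have [_ _ -> _] := hs j; rewrite mulr0 addr0.
  - have E i : a 0 i * s i 0 + p i 0 = a 0 j0 * s j0 0 + p j0 0.
      case: (eqVneq i j0) => [->//|ij0].
      have := ha i; rewrite aM (negPf ij0) => h.
      by apply/eqP; rewrite -subr_eq0 opprD addrACA h addNr.
    by move=> i j; rewrite !E.
  - by have := ha j0; rewrite aM eqxx big_split/= => ->; rewrite addNr.
(* A vector killed by [M] gives a homogeneous solution; by [inj] it is zero, and its slopes at 1 are
   the entries of the vector. *)
have uM : M \in unitmx.
  rewrite unitmxE unitfE; apply/negP => /det0P[a /negP a0 aM0]; apply: a0.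
  apply/eqP/rowP => j; rewrite [RHS]mxE.
  have := sol zero_data zero_data zero_data a.
  case=> [i||h1 h2 h3 h4].
  - split => //; first exact: cac_cst.
    by have := cac_cst (0 : C); congr cac; apply/funext => x; rewrite !mulr0 addr0.
  - move=> i; rewrite aM0 mxE; case: eqP => _ /=; last by rewrite subrr oppr0.
    by rewrite big1 ?oppr0.
  have sl := And4 h1 h2 h3 h4.
  have w0 := inj _ _ sl j; have [c0 c1] := h1 j.
  have := cac_derivative_eq0 c0 c1 w0 mem1_itv01; rewrite /s1 addr0.
  by have [_ _ _ ->] := hs j; rewrite mulr1.
pose KK := \sum_j K j; pose SS := \sum_j S j.
pose N := \sum_i \sum_j cl1 (invmx M i j).
have K0 j : 0 <= K j by have [] := hK j.
have S0 j : 0 <= S j by have [] := hS j.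
have KK0 : 0 <= KK by exact: sumr_ge0.
have SS0 : 0 <= SS by exact: sumr_ge0.
have KKj j : K j <= KK by rewrite /KK (bigD1 j)//= lerDl sumr_ge0.
have SSj j : S j <= SS by rewrite /SS (bigD1 j)//= lerDl sumr_ge0.
(* In units of [KK * G], an entry of the right-hand side is at most n (column [j0]) or 2 (a jump).
   [N] bounds the inverse matrix, [SS] the fundamental solutions, and the last [KK] the particular
   ones. *)
exists ((n%:R + 2) * KK * N * SS + KK) => g ig.
set G := \sum_i L1norm (g i).
have G0 : 0 <= G by apply: sumr_ge0 => j _; exact: L1norm_ge0.
have Gj j : L1norm (fun x => eps j * g j x) <= G.
  rewrite (_ : L1norm _ = L1norm (g j)).
    by rewrite /G (bigD1 j)//= lerDl sumr_ge0// => i _; exact: L1norm_ge0.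
  apply: eq_Rintegral => x _; rewrite /edge_sign; case: ifP; rewrite ?mul1r//.
  by rewrite mulN1r cl1N.
have /choice[p /choice[p1 hp]] : forall j, exists y y1 : R -> C,
  [/\ cac y y1, cac y1 (fun x => eps j * l * y x + eps j * g j x), y 1 = 0 /\ y1 1 = 0,
    {in `[0, 1], forall x, cl1 (y x) <= KK * G} &
    {in `[0, 1], forall x, cl1 (y1 x) <= KK * G}].
  move=> j; have [_ h] := hK j.
  have [y [y1 [h1 h2 h3 h4 h5]]] := h _ (cintegrableZ (eps j) (ig j)).
  have le : K j * L1norm (fun x => eps j * g j x) <= KK * G.
    by apply: ler_pM => //; exact: L1norm_ge0.
  exists y, y1; split => // x x01; apply: le_trans le; [exact: h4|exact: h5].
pose b : 'rV[C]_n := \row_i - if i == j0 then \sum_j p1 j 0 else p i 0 - p j0 0.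
pose a := b *m invmx M.
have bb i : cl1 (b 0 i) <= (n%:R + 2) * (KK * G).
  have KG0 : 0 <= KK * G by exact: mulr_ge0.
  rewrite mxE cl1N; case: ifP => _.
    apply: (le_trans (cl1_sum _)); apply: (@le_trans _ _ (\sum_(j < n) KK * G)).
      by apply: ler_sum => j _; have [_ _ _ _ h] := hp j; exact: h mem0_itv01.
    by rewrite sumr_const card_ord -[leLHS]mulr_natl ler_wpM2r// lerDl.
  apply: (le_trans (cl1B _ _)); apply: (@le_trans _ _ (KK * G + KK * G)).
    have [_ _ _ hi _] := hp i; have [_ _ _ hj _] := hp j0.
    by apply: lerD; [exact: hi mem0_itv01|exact: hj mem0_itv01].
  by rewrite -mulr2n -[leLHS]mulr_natl ler_wpM2r// lerDr.
have ab j : cl1 (a 0 j) <= (n%:R + 2) * (KK * G) * N.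
  rewrite mxE (le_trans (cl1_sum _))// mulr_sumr; apply: ler_sum => i _.
  apply: (le_trans (cl1M _ _)); apply: ler_pM; rewrite ?cl1_ge0 ?bb//.
  by rewrite (bigD1 j)//= lerDl sumr_ge0// => k _; exact: cl1_ge0.
exists (fun j x => a 0 j * s j x + p j x), (fun j x => a 0 j * s1 j x + p1 j x); split.
  apply: sol => [j|i]; first by have [? ? [? ?] _ _] := hp j.
  by rewrite -mulmxA mulVmx// mulmx1 mxE.
move=> j x x01; apply: (le_trans (cl1D _ _)); rewrite mulrDl; apply: lerD; last first.
  by have [_ _ _ h _] := hp j; exact: h.
apply: (le_trans (cl1M _ _)).
have -> : (n%:R + 2) * KK * N * SS * G = (n%:R + 2) * (KK * G) * N * SS by ring.
apply: ler_pM; rewrite ?cl1_ge0 ?ab//.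
by apply: (le_trans _ (SSj j)); have [_ h] := hS j; exact: h.
Qed.

Let sqn (z : C) : R := complex.Re z ^+ 2 + complex.Im z ^+ 2.

Let integrable_sqn (u : R -> C) : square_integrable u ->
  mu.-integrable J (EFin \o (fun x => sqn (u x))).
Proof. by move=> [_ _ iu]; apply/(integrable_unit_itv_cc (fun x => sqn (u x))). Qed.

Lemma Re_L2_dot (f : L2 R) : complex.Re (L2_dot f f) =
  \int[mu]_(x in @unit_itv R) sqn (f x).
Proof.
by apply: eq_Rintegral => x _; rewrite /sqn; case: (f x) => a b /=; ring.
Qed.

Lemma Re_L2_dot_cc (f : L2 R) : complex.Re (L2_dot f f) =
  \int[mu]_(x in J) sqn (f x).
Proof.
rewrite Re_L2_dot Rintegral_unit_itv_cc//.
by have [_ _ /(measurable_int mu)/measurable_EFinP] := L2_square_integrable f.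
Qed.

Lemma Re_L2_dot_ge0 (f : L2 R) : 0 <= complex.Re (L2_dot f f).
Proof.
by rewrite Re_L2_dot; apply: Rintegral_ge0 => x _; rewrite addr_ge0 ?sqr_ge0.
Qed.

(** Cauchy-Schwarz by integrating 2 m c <= m^2 + c^2 with m the L1 norm itself; the factor 2 comes
    from (p + q)^2 <= 2 (p^2 + q^2) in [cl1]. *)
Lemma L1norm_L2 (f : L2 R) : L1norm f ^+ 2 <= 2 * complex.Re (L2_dot f f).
Proof.
have if1 := cintegrable_cl1 (L2_cintegrable f).
have if2 := integrable_sqn (L2_square_integrable f).
rewrite Re_L2_dot_cc; set m := L1norm f; set Q := Rintegral _ _ _.
have ic : mu.-integrable J (EFin \o (cst (m ^+ 2))).
  exact: (integrable_continuous (@cst_continuous _ _ (m ^+ 2))).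
have : \int[mu]_(x in J) (2 * m * cl1 (f x)) <=
       \int[mu]_(x in J) (m ^+ 2 + 2 * sqn (f x)).
  apply: le_Rintegral => //; first exact: (integrableZl _ (2 * m) if1).
    exact: (integrableD _ ic (integrableZl _ 2 if2)).
  move=> x _; rewrite /cl1 /sqn -[complex.Re _ ^+ 2]real_normK ?num_real//.
  rewrite -[complex.Im _ ^+ 2]real_normK ?num_real//.
  move: `|complex.Re _| `|complex.Im _| => p q.
  have := sqr_ge0 (m - (p + q)); have := sqr_ge0 (p - q).
  by rewrite !expr2; nra.
have -> : \int[mu]_(x in J) (m ^+ 2 + 2 * sqn (f x)) = m ^+ 2 + 2 * Q.
  rewrite RintegralD//; last exact: (integrableZl _ 2 if2).
  by rewrite RintegralZl// Rintegral_cst// (congr1 fine (lebesgue_itv01 R))/= mulr1.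
by rewrite RintegralZl// -/(L1norm f) -/m !expr2; lra.
Qed.

Lemma Re_L2_dot_le (f : L2 R) (w w1 : R -> C) K : cac w w1 ->
  ae_eq mu (@unit_itv R) w f -> {in `[0, 1], forall x, cl1 (w x) <= K} ->
  complex.Re (L2_dot f f) <= K ^+ 2.
Proof.
move=> a wf wK; rewrite Re_L2_dot_cc.
have iw := integrable_sqn (cac_square_integrable a).
have if_ := integrable_sqn (L2_square_integrable f).
have -> : \int[mu]_(x in J) sqn (f x) = \int[mu]_(x in J) sqn (w x).
  congr fine; apply: ae_eq_integral => //.
  - exact: (measurable_int mu if_).
  - exact: (measurable_int mu iw).
  by apply: ae_eq_unit_itv_cc; apply: filterS wf => x h /h ->.
apply: (@le_trans _ _ (\int[mu]_(x in J) (K ^+ 2))).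
  apply: le_Rintegral => //.
    exact: (integrable_continuous (@cst_continuous _ _ (K ^+ 2))).
  move=> x Jx; apply: (@le_trans _ _ (cl1 (w x) ^+ 2)).
    rewrite /cl1 /sqn -[complex.Re _ ^+ 2]real_normK ?num_real//.
    rewrite -[complex.Im _ ^+ 2]real_normK ?num_real//.
    by rewrite sqrrD lerD2r lerDl mulrn_wge0// mulr_ge0.
  by rewrite lerXn2r ?nnegrE ?cl1_ge0 ?(le_trans (cl1_ge0 _) (wK x Jx))// wK.
by rewrite Rintegral_cst// (congr1 fine (lebesgue_itv01 R)) mulr1.
Qed.

Lemma L2G_norm_sqr (f : L2G R n) :
  L2G_norm f ^+ 2 = \sum_j complex.Re (L2_dot (f j) (f j)).
Proof.
rewrite /L2G_norm /L2G_dot raddf_sum/= sqr_sqrtr//.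
by apply: sumr_ge0 => j _; exact: Re_L2_dot_ge0.
Qed.

Lemma L2G_norm_ge0 (f : L2G R n) : 0 <= L2G_norm f.
Proof. exact: sqrtr_ge0. Qed.

Lemma resolvent_of_injective l : (0 < n)%N ->
  (forall w w1, kirchhoff_solution l zero_data w w1 ->
     forall j, {in `[0, 1], forall x, w j x = 0}) ->
  resolvent_set (@L2G_norm R np nm) B l.
Proof.
move=> n0 inj; have [K hK] := shooting_solve (Ordinal n0) inj.
have uniq (f f' g : L2G R n) : dom B f /\ Defs.shift B l f = g ->
    dom B f' /\ Defs.shift B l f' = g -> f = f'.
  move=> /shift_kirchhoffP[w [w1 [sol wf]]] /shift_kirchhoffP[w' [w1' [sol' wf']]].
  have sol0 : kirchhoff_solution l zero_data (fun j x => w j x - w' j x)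
     (fun j x => w1 j x - w1' j x).
    have := kirchhoff_solutionB sol sol'; congr kirchhoff_solution.
    by apply/funext => j; apply/funext => x; rewrite subrr.
  have w0 := inj _ _ sol0.
  apply/ffunP => j; apply/L2_eqP; apply: filterS2 (wf j) (wf' j) => x h h' Ix.
  rewrite -h// -h'//; apply/eqP; rewrite -subr_eq0 w0//.
  exact: unit_itv_sub_cc.
(* The factor [n * |K|] passes from the uniform bound to the norm of [f], the factor [n * 2] from L1
   norms to the norm of [g]; the square roots of n and 2 are rounded up to n and 2. *)
have ex (g : L2G R n) : exists f : L2G R n, (dom B f /\ Defs.shift B l f = g) /\
    L2G_norm f <= (n%:R * `|K| * (n%:R * 2)) * L2G_norm g.
  have [w [w1 [sol wK]]] := hK (fun j => g j : R -> C) (fun j => L2_cintegrable (g j)).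
  have a j : cac (w j) (w1 j) by have [h _ _ _] := sol; have [] := h j.
  pose f : L2G R n := [ffun j => mkL2 (cac_square_integrable (a j))].
  have wf j : ae_eq mu (@unit_itv R) (w j) (f j).
    by rewrite ffunE; apply: ae_eq_sym; exact: mkL2E.
  exists f; split; first by apply/shift_kirchhoffP; exists w, w1.
  set G := \sum_i L1norm (g i) in wK.
  have G0 : 0 <= G by apply: sumr_ge0 => j _; exact: L1norm_ge0.
  have Gg : G <= n%:R * 2 * L2G_norm g.
    apply: (@le_trans _ _ (\sum_(j < n) 2 * L2G_norm g)); last first.
      by rewrite sumr_const card_ord -[leLHS]mulr_natl mulrA.
    apply: ler_sum => j _.
    rewrite -(@ler_pXn2r _ 2) ?nnegrE ?L1norm_ge0 ?mulr_ge0 ?L2G_norm_ge0//.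
    apply: (le_trans (L1norm_L2 _)); rewrite exprMn L2G_norm_sqr.
    apply: ler_pM => //; first exact: Re_L2_dot_ge0.
      by rewrite expr2; lra.
    rewrite (bigD1 j)//= lerDl; apply: sumr_ge0 => i _; exact: Re_L2_dot_ge0.
  rewrite -mulrA; apply: (@le_trans _ _ (n%:R * `|K| * G)); last first.
    by rewrite ler_wpM2l// mulr_ge0.
  rewrite -(@ler_pXn2r _ 2) ?nnegrE ?L2G_norm_ge0 ?mulr_ge0//.
  rewrite L2G_norm_sqr; apply: (@le_trans _ _ (\sum_(j < n) (`|K| * G) ^+ 2)).
    apply: ler_sum => j _; apply: (Re_L2_dot_le (a j) (wf j)) => x x01.
    by apply: (le_trans (wK j x x01)); rewrite ler_wpM2r// ler_norm.
  rewrite sumr_const card_ord -[leLHS]mulr_natl -mulrA [leRHS]exprMn.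
  rewrite ler_wpM2r ?sqr_ge0// expr2 -[leLHS]mulr1 ler_wpM2l//.
  by rewrite ler1n.
split.
  move=> g; have [f [hf _]] := ex g; exists f; split => // f' hf'.
  exact: uniq hf hf'.
exists (n%:R * `|K| * (n%:R * 2)) => f df.
have [f' [hf' hb]] := ex (Defs.shift B l f).
suff E : f' = f by move: hb; rewrite E.
exact (uniq f' f _ hf' (conj df (erefl (Defs.shift B l f)))).
Qed.

End Shooting.

(** * The energy identity: positivity, nonreal numbers, Jordan chains *)

Section Energy.
Variable R : realType.
Local Notation C := R[i].
Local Notation mu := (@lebesgue_measure R).
Local Notation J := (`[0, 1]%classic : set R).
Local Notation Re := complex.Re.
Local Notation Im := complex.Im.
Variables np nm : nat.
Local Notation n := (np + nm)%N.
Local Notation B := (indefinite_kirchhoff R np nm).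
Local Notation eps := (@edge_sign R np nm).
Local Notation zero_data := (fun (_ : 'I_n) (_ : R) => 0 : C).
Implicit Types (w g y : 'I_n -> R -> C) (l : C).


Lemma cintegralD (u v : R -> C) : cintegrable u -> cintegrable v ->
  cintegral (fun x => u x + v x) = cintegral u + cintegral v.
Proof.
move=> [/integrable_unit_itv_cc uR /integrable_unit_itv_cc uI].
move=> [/integrable_unit_itv_cc vR /integrable_unit_itv_cc vI].
have mI := @unit_itv_measurable R.
apply/eqP; rewrite eq_complex/=; apply/andP; split; apply/eqP.
  by rewrite -RintegralD//; apply: eq_Rintegral => x _; rewrite raddfD.
by rewrite -RintegralD//; apply: eq_Rintegral => x _; rewrite raddfD.
Qed.

Lemma cintegralZ (c : C) (u : R -> C) : cintegrable u ->
  cintegral (fun x => c * u x) = c * cintegral u.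
Proof.
move=> [/integrable_unit_itv_cc uR /integrable_unit_itv_cc uI].
have mI := @unit_itv_measurable R.
have z (a : R) (h : R -> R) : mu.-integrable (@unit_itv R) (EFin \o h) ->
    mu.-integrable (@unit_itv R) (EFin \o (fun x => a * h x)).
  by move=> ih; exact: (integrableZl _ a ih).
apply/eqP; rewrite eq_complex complex_ReM complex_ImM/=; apply/andP; split; apply/eqP.
  rewrite -!RintegralZl// -RintegralB//; [|exact: z|exact: z].
  by apply: eq_Rintegral => x _; rewrite complex_ReM.
rewrite -!RintegralZl// -RintegralD//; [|exact: z|exact: z].
by apply: eq_Rintegral => x _; rewrite complex_ImM.
Qed.

Lemma cintegral0 : cintegral (fun=> 0 : C) = 0.
Proof.
rewrite -[RHS](mul0r (cintegral (fun=> 0 : C))) -cintegralZ; first by rewrite mulr0.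
exact: cintegrable0.
Qed.

Definition sqnorm (u : R -> C) : R :=
  \int[mu]_(x in @unit_itv R) (Re (u x) ^+ 2 + Im (u x) ^+ 2).

Lemma sqnorm_ge0 u : 0 <= sqnorm u.
Proof. by apply: Rintegral_ge0 => x _; rewrite addr_ge0 ?sqr_ge0. Qed.

Lemma cintegral_conj (u : R -> C) : cintegral (fun x => u x * (u x)^*) = (sqnorm u)%:C.
Proof.
apply/eqP; rewrite eq_complex/=; apply/andP; split; apply/eqP.
  by apply: eq_Rintegral => x _; case: (u x) => a b /=; ring.
rewrite (_ : Rintegral _ _ _ = \int[mu]_(x in @unit_itv R) 0).
  by rewrite Rintegral_cst ?mul0r//; exact: unit_itv_measurable.
by apply: eq_Rintegral => x _; case: (u x) => a b /=; ring.
Qed.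

Lemma sqnorm_eq0 u u' : cac u u' -> sqnorm u = 0 -> ae_eq mu (@unit_itv R) u (fun=> 0).
Proof.
move=> a u0; have [mR mI iu] := cac_square_integrable a.
pose q x := Re (u x) ^+ 2 + Im (u x) ^+ 2.
have q0 x : 0 <= q x by rewrite addr_ge0 ?sqr_ge0.
have mJ := @unit_itv_measurable R.
have : (\int[mu]_(x in @unit_itv R) `|(q x)%:E| = 0)%E.
  under eq_integral do rewrite gee0_abs ?lee_fin//.
  rewrite -[LHS]fineK; last exact: integrable_fin_num.
  by congr EFin.
move/ae_eq_integral_abs => /(_ mJ (measurable_int mu iu)).
apply: filterS => x h Ix; have /= := h Ix => -[] /eqP.
rewrite paddr_eq0 ?sqr_ge0// !sqrf_eq0; case: (u x) => ? ? /= /andP[/eqP-> /eqP->].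
by [].
Qed.

(** The derivative of w' conj(w) is integrated over each edge. The boundary term at 1 vanishes;
    those at 0 share the factor conj(w(0)), and the slopes multiplying it sum to 0. *)
Lemma energy_identity l g w w1 : (forall j, cintegrable (g j)) ->
  kirchhoff_solution l g w w1 ->
  l * \sum_j eps j * (sqnorm (w j))%:C
  + \sum_j eps j * cintegral (fun x => g j x * (w j x)^*)
  + \sum_j (sqnorm (w1 j))%:C = 0.
Proof.
move=> ig [a w_1 w_0 wk].
have E j : l * (eps j * (sqnorm (w j))%:C)
    + eps j * cintegral (fun x => g j x * (w j x)^*)
    + (sqnorm (w1 j))%:C = - (w1 j 0 * (w j 0)^*).
  have [a0 a1] := a j; have ac0 := cac_conj a0; have ac1 := cac_conj a1.
  have aM := cacM a1 ac0.
  have iww : cintegrable (fun x => w j x * (w j x)^*).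
    exact: cac_cintegrable (cacM a0 ac0).
  have igw : cintegrable (fun x => g j x * (w j x)^*).
    have := cintegrable_mul ac0 (ig j); congr cintegrable.
    by apply/funext => x; rewrite mulrC.
  have ivv : cintegrable (fun x => w1 j x * (w1 j x)^*).
    exact: cac_cintegrable (cacM a1 ac1).
  have := cac_cintegral aM; rewrite w_1 conjc0 mulr0 sub0r => <-.
  rewrite -!cintegral_conj mulrA -!cintegralZ//.
  rewrite -cintegralD//; last 2 first.
  - exact: cintegrableZ.
  - exact: cintegrableZ.
  rewrite -cintegralD//; last by apply: cintegrableD; exact: cintegrableZ.
  by congr cintegral; apply/funext => x; ring.
rewrite mulr_sumr -!big_split/= (eq_bigr _ (fun j _ => E j)) sumrN.
case: (pickP 'I_n) => [j0 _|none]; last by rewrite big_pred0 ?oppr0.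
rewrite (eq_bigr (fun j => w1 j 0 * (w j0 0)^*)) => [|j _]; last by rewrite (w_0 j j0).
by rewrite -mulr_suml wk mul0r oppr0.
Qed.

(** Zero energy makes each component constant, and the outer vertex makes the constant 0. *)
Lemma kirchhoff_rigid l g w w1 : kirchhoff_solution l g w w1 ->
  \sum_j (sqnorm (w1 j))%:C = 0 ->  forall j, {in `[0, 1], forall x, w j x = 0}.
Proof.
move=> [a w_1 w_0 wk] h j x x01; have [a0 a1] := a j.
have /eqP : \sum_j sqnorm (w1 j) = 0.
  by move: h; rewrite -raddf_sum => /(congr1 (@complex.Re R)).
rewrite psumr_eq0 => [/allP/(_ j)|i _]; last exact: sqnorm_ge0.
rewrite mem_index_enum => /(_ isT) /= /eqP /(sqnorm_eq0 a1) w10.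
by rewrite (cac_eq_cst a0 w10 x01) -(cac_eq_cst a0 w10 mem1_itv01) w_1.
Qed.

Lemma edge_sign_real j : eps j = (Re (eps j))%:C.
Proof.
rewrite /edge_sign; case: ifP => _ //=.
by apply/eqP; rewrite eq_complex/= oppr0 !eqxx.
Qed.

(** The indefinite sum is real, so for nonreal l the imaginary part of the identity makes it vanish;
    in either case only the sum of the squared slope norms is left. *)
Lemma nonreal_injective l w w1 : l = 0 \/ Im l != 0 ->
  kirchhoff_solution l zero_data w w1 -> forall j, {in `[0, 1], forall x, w j x = 0}.
Proof.
move=> hl sol; apply: (kirchhoff_rigid sol).
have := energy_identity (fun _ => cintegrable0 R) sol.
set D := \sum_j (sqnorm (w1 j))%:C; set A := \sum_j _.
rewrite [X in _ + X + _]big1 ?addr0 => [|j _]; last first.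
  rewrite (_ : (fun x => _) = (fun=> 0)) ?cintegral0 ?mulr0//.
  by apply/funext => x; rewrite mul0r.
have AE : A = (\sum_j Re (eps j) * sqnorm (w j))%:C.
  rewrite raddf_sum; apply: eq_bigr => j _.
  by rewrite [eps j]edge_sign_real/= [RHS]rmorphM.
case: hl => [->|l0]; first by rewrite mul0r add0r.
have ID : Im D = 0 by rewrite /D -raddf_sum.
move=> h; have /eqP := congr1 (@complex.Im R) h.
rewrite raddfD/= ID addr0 complex_ImM AE/= mulr0 add0r mulf_eq0 (negPf l0)/= => /eqP A0.
by move: h; rewrite AE A0 mulr0 add0r.
Qed.

(** For real l the derivative of y' conj(w) - y conj(w') is eps |w|^2. Its boundary terms cancel
    over the star, so the indefinite sum of [w] vanishes and the energy identity for [w] leaves only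
    the slopes. *)
Lemma semisimple_kirchhoff l w w1 y y1 : Im l = 0 ->
  kirchhoff_solution l zero_data w w1 -> kirchhoff_solution l w y y1 ->
  forall j, {in `[0, 1], forall x, w j x = 0}.
Proof.
move=> l0 sol [b y_1 y_0 yk]; apply: (kirchhoff_rigid sol).
have lE : l^* = l by move: (l) l0 => [p q] /= ->; rewrite oppr0.
have := energy_identity (fun _ => cintegrable0 R) sol.
rewrite [X in _ + X + _]big1 => [|j _]; last first.
  rewrite (_ : (fun x => _) = (fun=> 0)) ?cintegral0 ?mulr0//.
  by apply/funext => x; rewrite mul0r.
suff -> : \sum_j eps j * (sqnorm (w j))%:C = 0 by rewrite mulr0 !add0r.
have [a w_1 w_0 wk] := sol.
have E j : eps j * (sqnorm (w j))%:C =
    - (y1 j 0 * (w j 0)^* - y j 0 * (w1 j 0)^*).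
  have [a0 a1] := a j; have ac0 := cac_conj a0; have ac1 := cac_conj a1.
  have [b0 b1] := b j.
  have aM := cacB (cacM b1 ac0) (cacM b0 ac1).
  have := cac_cintegral aM; rewrite w_1 y_1 conjc0 mulr0 mul0r subrr sub0r => <-.
  rewrite -cintegral_conj -cintegralZ//; last exact: cac_cintegrable (cacM a0 ac0).
  congr cintegral; apply/funext => x.
  rewrite addr0 !rmorphM/= lE.
  have -> : (eps j)^* = eps j by rewrite /edge_sign; case: ifP; rewrite ?rmorphN rmorph1.
  by ring.
rewrite (eq_bigr _ (fun j _ => E j)) sumrN.
case: (pickP 'I_n) => [j0 _|none]; last by rewrite big_pred0 ?oppr0.
rewrite (eq_bigr (fun j => y1 j 0 * (w j0 0)^* - y j0 0 * (w1 j 0)^*)) => [|j _]; last first.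
  by rewrite (w_0 j j0) (y_0 j j0).
rewrite sumrB -mulr_suml -mulr_sumr yk mul0r sub0r.
by rewrite -rmorph_sum wk rmorph0 mulr0 oppr0 oppr0.
Qed.

Lemma nonreal_resolvent l : (0 < n)%N -> l = 0 \/ Im l != 0 ->
  resolvent_set (@L2G_norm R np nm) B l.
Proof.
move=> n0 hl; apply: resolvent_of_injective => // w w1; exact: nonreal_injective.
Qed.

Lemma ker_solution_zero (f : L2G R n) w : (forall j, {in `[0, 1], forall x, w j x = 0}) ->
  (forall j, ae_eq mu (@unit_itv R) (w j) (f j)) -> f = 0.
Proof.
move=> w0 wf; apply/ffunP => j; rewrite ffunE; apply/L2_eqP.
apply: filterS2 (wf j) (L2_zeroE R) => x h hz Ix; rewrite -h// w0 ?hz//.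
exact: unit_itv_sub_cc.
Qed.

Lemma krein_dotE (f g : L2G R n) :
  krein_dot g f = - \sum_j eps j * L2_dot (g j) (f j).
Proof.
rewrite /krein_dot [X in _ = - X](bigID (fun j : 'I_n => (j < np)%N))/= opprD.
rewrite -!sumrN; congr (_ + _).
  by apply: eq_bigr => j jp; rewrite /edge_sign jp mulN1r opprK.
have E : (fun j : 'I_n => (np <= j)%N) =1 (fun j : 'I_n => ~~ (j < np)%N).
  by move=> j; rewrite -leqNgt.
by rewrite (eq_bigl _ _ E); apply: eq_bigr => j /negPf jp; rewrite /edge_sign jp mul1r.
Qed.

(** With l = 0 and g = B f, the energy identity says that [B f, f] is the sum of the squared slope
    norms. *)
Lemma kirchhoff_krein_positive : krein_positive B.
Proof.
suff pos (f g : L2G R n) : g = app B f -> dom B f -> f != 0 -> 0 < krein_dot g f.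
  by move=> f; exact: pos.
move=> gE df f0.
have [w [w1 [sol wf]]] : exists w w1,
    kirchhoff_solution 0 (fun j => g j : R -> C) w w1 /\
    forall j, ae_eq mu (@unit_itv R) (w j) (f j).
  by apply/shift_kirchhoffP; rewrite /Defs.shift scale0r subr0 gE.
have := energy_identity (fun j => L2_cintegrable (g j)) sol.
rewrite mul0r add0r => /eqP; rewrite addr_eq0 => /eqP h.
have E j : L2_dot (g j) (f j) = cintegral (fun x => g j x * (w j x)^*).
  have [a _ _ _] := sol; have [a0 _] := a j.
  have mI := @unit_itv_measurable R.
  have [w' w'E] : exists w' : L2 R, ae_eq mu (@unit_itv R) w' (w j).
    by exists (mkL2 (cac_square_integrable a0)); exact: mkL2E.
  have ig : cintegrable (fun x => g j x * (w j x)^*).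
    have := cintegrable_mul (cac_conj a0) (L2_cintegrable (g j)); congr cintegrable.
    by apply/funext => x; rewrite mulrC.
  have [iR iI] := ig.
  have [fR fI _] := L2_square_integrable (f j).
  have [gR gI _] := L2_square_integrable (g j).
  have ae : ae_eq mu (@unit_itv R) (fun x => g j x * (f j x)^*) (fun x => g j x * (w j x)^*).
    by apply: filterS (wf j) => x hx Ix; rewrite hx.
  have mR (u v : C) : Re (u * v^*) = Re u * Re v + Im u * Im v.
    by case: u v => ? ? [? ?] /=; ring.
  have mI' (u v : C) : Im (u * v^*) = Im u * Re v - Re u * Im v.
    by case: u v => ? ? [? ?] /=; ring.
  apply/eqP; rewrite eq_complex/=; apply/andP; split; apply/eqP; congr fine.
    apply: ae_eq_integral => //.
    - apply/measurable_EFinP; under eq_fun do rewrite mR.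
      by apply: measurable_funD; apply: measurable_funM.
    - exact: (measurable_int mu ((integrable_unit_itv_cc _).2 iR)).
    - by apply: filterS ae => x hx Ix; rewrite hx.
  apply: ae_eq_integral => //.
  - apply/measurable_EFinP; under eq_fun do rewrite mI'.
    by apply: measurable_funB; apply: measurable_funM.
  - exact: (measurable_int mu ((integrable_unit_itv_cc _).2 iI)).
  - by apply: filterS ae => x hx Ix; rewrite hx.
rewrite krein_dotE (eq_bigr _ (fun j _ => congr1 ( *%R (eps j)) (E j))) h opprK.
rewrite lt_neqAle; apply/andP; split; last first.
  by apply: sumr_ge0 => j _; rewrite lecR sqnorm_ge0.
rewrite eq_sym; apply/eqP => D0; move/eqP: f0; apply.
exact: ker_solution_zero (kirchhoff_rigid sol D0) wf.
Qed.

(** By induction on the chain length, (B - l) f lies in the kernel; having the preimage f, it is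
    zero by semisimplicity. *)
Lemma root_subspace_real l (f : L2G R n) : Im l = 0 ->
  root_subspace B l f <-> dom B f /\ Defs.shift B l f = 0.
Proof.
move=> l0; split=> [[k _]|[df sf]]; last first.
  by exists 1%N => //=; split.
elim: k f => [|k IH] f /=.
  by move=> ->; exact: kernel0.
move=> [df /IH hg]; split => //.
have [w [w1 [sol wg]]] := (kernel_kirchhoffP _ _).1 hg.
have [y [y1 [sol' _]]] := (shift_kirchhoffP _ _ _).1 (conj df (erefl (Defs.shift B l f))).
have {}sol' : kirchhoff_solution l w y y1.
  apply: kirchhoff_solution_ae sol' => j; last exact: ae_eq_sym.
  by have [a _ _ _] := sol; have [a0 _] := a j; exact: cac_cintegrable a0.
exact: ker_solution_zero (semisimple_kirchhoff l0 sol sol') wg.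
Qed.

End Energy.

(** * Explicit kernels and multiplicities for l = m^2 and l = -m^2 *)

Section Real_eigenvalues.
Variable R : realType.
Local Notation C := R[i].
Local Notation mu := (@lebesgue_measure R).
Variables np nm : nat.
Local Notation n := (np + nm)%N.
Local Notation B := (indefinite_kirchhoff R np nm).
Local Notation eps := (@edge_sign R np nm).
Local Notation zero_data := (fun (_ : 'I_n) (_ : R) => 0 : C).
Variables (P : pred 'I_n) (m : R) (l : C).
Hypothesis m_gt0 : 0 < m.
(** [P] marks the trigonometric edges: the positive ones for l = m^2, the negative ones for l =
    -m^2. Both signs thus share every proof below. *)
Hypothesis epsl : forall j, eps j * l = (if P j then - m ^+ 2 else m ^+ 2)%:C.


Definition sh (x : R) : R := (expR x - expR (- x)) / 2.
Definition ch (x : R) : R := (expR x + expR (- x)) / 2.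

Definition profile (b : bool) (x : R) : R :=
  if b then sin (m * (1 - x)) else sh (m * (1 - x)).
Definition dprofile (b : bool) (x : R) : R :=
  - m * (if b then cos (m * (1 - x)) else ch (m * (1 - x))).

Lemma ac_real_complex (f f' : R -> R) : ac f f' ->
  cac (fun x => (f x)%:C) (fun x => (f' x)%:C).
Proof. by move=> a; split => //=; exact: ac_cst. Qed.

Lemma profile_ac b : ac (profile b) (dprofile b) /\
  ac (dprofile b) (fun x => (if b then - m ^+ 2 else m ^+ 2) * profile b x).
Proof.
have lin (x : R) : is_derive x 1 (fun y : R => m * (1 - y)) (- m).
  by apply: is_derive_eq; rewrite /GRing.scale/=; ring.
have clin : continuous (fun y : R => m * (1 - y)).
  move=> x; apply: cvgM; first exact: cvg_cst.
  by apply: cvgB; [exact: cvg_cst|exact: cvg_id].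
have cs : continuous (fun y : R => sin (m * (1 - y))).
  by move=> x; apply: continuous_comp; [exact: clin|exact: continuous_sin].
have cc : continuous (fun y : R => cos (m * (1 - y))).
  by move=> x; apply: continuous_comp; [exact: clin|exact: continuous_cos].
have ce : continuous (fun y : R => expR (m * (1 - y))).
  by move=> x; apply: continuous_comp; [exact: clin|exact: continuous_expR].
have ce' : continuous (fun y : R => expR (- (m * (1 - y)))).
  by move=> x; apply: continuous_comp; [apply: cvgN; exact: clin|exact: continuous_expR].
have csh : continuous (fun y : R => sh (m * (1 - y))).
  move=> x; apply: cvgM; last exact: cvg_cst.
  by apply: cvgB; [exact: ce|exact: ce'].
have cch : continuous (fun y : R => ch (m * (1 - y))).
  move=> x; apply: cvgM; last exact: cvg_cst.
  by apply: cvgD; [exact: ce|exact: ce'].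
rewrite /profile /dprofile /sh /ch; case: b; split; apply: ac_C1.
- move=> x; have := lin x => ?; apply: is_derive_eq; rewrite /GRing.scale/=; ring.
- by move=> x; apply: cvgM; [exact: cvg_cst|exact: cc].
- move=> x; have := lin x => ?; apply: is_derive_eq; rewrite /GRing.scale/=; ring.
- by move=> x; apply: cvgM; [exact: cvg_cst|exact: cs].
- by move=> x; have := lin x => ?; apply: is_derive_eq; rewrite /GRing.scale/=; field.
- by move=> x; apply: cvgM; [exact: cvg_cst|exact: cch].
- by move=> x; have := lin x => ?; apply: is_derive_eq; rewrite /GRing.scale/=; field.
- by move=> x; apply: cvgM; [exact: cvg_cst|exact: csh].
Qed.

Lemma profile1 b : profile b 1 = 0.
Proof. by rewrite /profile /sh subrr mulr0 sin0 oppr0 subrr mul0r if_same. Qed.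

Lemma dprofile1 b : dprofile b 1 = - m.
Proof.
rewrite /dprofile /ch subrr mulr0 cos0 oppr0 expR0.
by rewrite (_ : (1 + 1) / 2 = 1 :> R) ?if_same ?mulr1//; field.
Qed.

(** The vertex conditions at the centre, for amplitudes [a]; the condition at the outer vertices is
    built into the profiles. *)
Definition balanced (a : 'I_n -> C) :=
  (forall i j, a i * (profile (P i) 0)%:C = a j * (profile (P j) 0)%:C) /\
  \sum_j a j * (dprofile (P j) 0)%:C = 0.

Lemma profile_cac j : cac (fun x => (profile (P j) x)%:C) (fun x => (dprofile (P j) x)%:C) /\
  cac (fun x => (dprofile (P j) x)%:C) (fun x => eps j * l * (profile (P j) x)%:C).
Proof.
have [a b] := profile_ac (P j); split; first exact: ac_real_complex.
have := ac_real_complex b; congr cac; apply/funext => x.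
by rewrite epsl -rmorphM.
Qed.

Lemma balanced_solution a : balanced a -> kirchhoff_solution l zero_data
  (fun j x => a j * (profile (P j) x)%:C) (fun j x => a j * (dprofile (P j) x)%:C).
Proof.
move=> [a0 a1]; split => //.
- move=> j; have [b0 b1] := profile_cac j; split; first exact: cacZ.
  by have := cacZ (a j) b1; congr cac; apply/funext => x; ring.
- by move=> j; rewrite profile1 mulr0.
Qed.

Lemma solution_balanced w w1 : kirchhoff_solution l zero_data w w1 ->
  exists2 a, balanced a &
    forall j, {in `[0, 1], forall x, w j x = a j * (profile (P j) x)%:C}.
Proof.
move=> [hw w_1 w_0 wk].
(* Every profile has slope -m at 1, so this amplitude matches the Cauchy data of [w j] there. *)
pose a j := - w1 j 1 / m%:C.
have m0 : m%:C != 0 by rewrite fmorph_eq0 gt_eqF.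
have E j : {in `[0, 1], forall x, w j x = a j * (profile (P j) x)%:C /\
    w1 j x = a j * (dprofile (P j) x)%:C}.
  move=> x x01; have [h0 h1] := hw j; have [b0 b1] := profile_cac j.
  have c0 := cacB h0 (cacZ (a j) b0); have c1 := cacB h1 (cacZ (a j) b1).
  have [|||e0 e1] := ODE2_unique (z := eps j * l) c0 c1 _ _ _ x01.
  - by move=> t _; ring.
  - by rewrite w_1 profile1 mulr0 subrr.
  - by rewrite dprofile1 /a (_ : (- m)%:C = - m%:C) ?rmorphN// mulrN divfK// opprK subrr.
  by split; apply/eqP; rewrite -subr_eq0; apply/eqP.
exists a; last by move=> j x x01; have [] := E j x x01.
split.
  move=> i j; have [<- _] := E i 0 mem0_itv01; have [<- _] := E j 0 mem0_itv01.
  exact: w_0.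
by rewrite -[RHS]wk; apply: eq_bigr => j _; have [_ <-] := E j 0 mem0_itv01.
Qed.

Definition profile_L2 j : L2 R := mkL2 (cac_square_integrable (profile_cac j).1).

Definition edge_family (a : 'I_n -> C) : L2G R n := [ffun j => a j *: profile_L2 j].

Lemma edge_familyE a j : ae_eq mu (@unit_itv R) (fun x => a j * (profile (P j) x)%:C)
  (edge_family a j).
Proof.
rewrite ffunE; apply: ae_eq_sym.
apply: filterS2 (L2_scaleE (a j) (profile_L2 j))
  (mkL2E (cac_square_integrable (profile_cac j).1)).
by move=> x h h' Ix; rewrite h// -h'.
Qed.

Lemma kernel_edge_family (f : L2G R n) : (dom B f /\ Defs.shift B l f = 0) <->
  exists2 a, balanced a & f = edge_family a.
Proof.
rewrite kernel_kirchhoffP; split.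
  move=> [w [w1 [/solution_balanced[a ba wE] wf]]]; exists a => //.
  apply/ffunP => j; apply/L2_eqP.
  apply: filterS2 (wf j) (edge_familyE a j) => x h h' Ix.
  by rewrite -h// -h'// wE//; exact: unit_itv_sub_cc.
move=> [a ba ->]; exists (fun j x => a j * (profile (P j) x)%:C).
exists (fun j x => a j * (dprofile (P j) x)%:C); split; first exact: balanced_solution.
exact: edge_familyE.
Qed.

(** Amplitudes are recovered from the slopes at 1, which are never degenerate, whereas the values at
    0 vanish on trigonometric edges when sin m = 0. *)
Lemma edge_family_inj a a' : edge_family a = edge_family a' -> a =1 a'.
Proof.
move=> aa' j; have [b0 b1] := profile_cac j.
have aj : edge_family a j = edge_family a' j by rewrite aa'.
have ea := edge_familyE a j; rewrite aj in ea.
have e0 : {in `[0, 1], forall x, (a j - a' j) * (profile (P j) x)%:C = 0}.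
  move=> x x01; rewrite mulrBl; apply/eqP; rewrite subr_eq0; apply/eqP.
  exact: (cac_unique (cacZ (a j) b0) (cacZ (a' j) b0) ea (edge_familyE a' j)).
have := cac_derivative_eq0 (cacZ (a j - a' j) b0) (cacZ (a j - a' j) b1) e0 mem1_itv01.
rewrite dprofile1 => /eqP; rewrite mulf_eq0 subr_eq0 => /orP[/eqP//|].
by rewrite fmorph_eq0 oppr_eq0 gt_eqF.
Qed.

Lemma edge_family_sum k (c : 'I_k -> C) (a : 'I_k -> 'I_n -> C) :
  \sum_i c i *: edge_family (a i) = edge_family (fun j => \sum_i c i * a i j).
Proof.
apply/ffunP => j; rewrite sum_ffunE ffunE scaler_suml; apply: eq_bigr => i _.
by rewrite !ffunE scalerA.
Qed.

(** Semisimplicity reduces the root subspace to the kernel, which the balanced amplitudes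
    parametrise faithfully; a multiplicity becomes the dimension of a space of vectors. *)
Lemma multiplicity_edge_family k (e : 'I_k -> 'I_n -> C) : complex.Im l = 0 ->
  (forall i, balanced (e i)) ->
  (forall a, balanced a -> exists c : 'I_k -> C, forall j, a j = \sum_i c i * e i j) ->
  (forall c : 'I_k -> C, (forall j, \sum_i c i * e i j = 0) -> forall i, c i = 0) ->
  has_algebraic_multiplicity B l k.
Proof.
move=> l0 be span free; exists (fun i => edge_family (e i)); split => [c|f].
  apply/root_subspace_real => //; apply/kernel_edge_family.
  exists (fun j => \sum_i c i * e i j); last exact: edge_family_sum.
  split.
    move=> i j; rewrite !mulr_suml; apply: eq_bigr => t _.
    by have [h _] := be t; rewrite -!mulrA (h i j).
  under eq_bigr do rewrite mulr_suml.
  rewrite exchange_big/= big1// => t _.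
  under eq_bigr do rewrite -mulrA.
  by have [_ h] := be t; rewrite -mulr_sumr h mulr0.
move=> /(root_subspace_real _ l0)/kernel_edge_family[a ba ->].
have [c hc] := span a ba; exists c; split.
  by rewrite edge_family_sum; congr edge_family; apply/funext.
move=> c'; rewrite edge_family_sum => /edge_family_inj h.
apply/funext => i; apply/eqP; rewrite -subr_eq0; apply/eqP.
apply: (free (fun i => c i - c' i)) => j.
under eq_bigr do rewrite mulrBl.
by rewrite sumrB -hc -h subrr.
Qed.

Lemma sh_gt0 (x : R) : 0 < x -> 0 < sh x.
Proof. by move=> x0; rewrite divr_gt0// subr_gt0 ltr_expR; lra. Qed.

Lemma profile0_neq0 b : sin m != 0 -> (profile b 0)%:C != 0.
Proof.
move=> s0; rewrite fmorph_eq0 /profile subr0 mulr1; case: b => //.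
by rewrite gt_eqF// sh_gt0.
Qed.

(** [i] enumerates the trigonometric edges. Their profiles vanish at the centre, so the common value
    is 0 and the hyperbolic amplitudes, with sinh m nonzero, vanish. Since cos m is nonzero, what
    remains is the hyperplane of zero sum in dimension k + 1. *)
Lemma multiplicity_sin_eq0 k (i : 'I_k.+1 -> 'I_n) : complex.Im l = 0 ->
  sin m = 0 -> injective i -> (forall j, P j = [exists t, j == i t]) ->
  has_algebraic_multiplicity B l k.
Proof.
move=> l0 sm0 inj PE.
have Pi t : P (i t) by rewrite PE; apply/existsP; exists t.
have cm0 : cos m != 0.
  apply/eqP => cm0; have := cos2Dsin2 m; rewrite cm0 sm0 expr0n addr0 => /esym/eqP.
  by rewrite oner_eq0.
have ii (t t' : 'I_k.+1) : (i t == i t') = (t == t') by rewrite (inj_eq inj).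
have l0i (t : 'I_k) : (i (lift ord0 t) == i ord0) = false.
  by rewrite ii eq_sym; exact/negbTE/neq_lift.
have i0l (t : 'I_k) : (i ord0 == i (lift ord0 t)) = false by rewrite eq_sym l0i.
have ll (t t' : 'I_k) : (i (lift ord0 t) == i (lift ord0 t')) = (t == t').
  by rewrite ii (inj_eq lift_inj).
(* The basis of that hyperplane: differences with the first trigonometric edge. *)
pose e (t : 'I_k) (j : 'I_n) : C := (j == i (lift ord0 t))%:R - (j == i ord0)%:R.
have eP t j : ~~ P j -> e t j = 0.
  move=> Pj; have ne t' : (j == i t') = false.
    by apply: contraNF Pj => /eqP->.
  by rewrite /e !ne subrr.
have pick (F : 'I_n -> C) t : \sum_j (j == i t)%:R * F j = F (i t).
  by rewrite (bigD1 (i t))//= eqxx mul1r big1 ?addr0// => j /negPf->; rewrite mul0r.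
apply: (multiplicity_edge_family (e := e)) => //.
- move=> t.
  have z j : e t j * (profile (P j) 0)%:C = 0.
    have [Pj|/(eP t)->] := boolP (P j); last by rewrite mul0r.
    by rewrite /profile subr0 mulr1 sm0 mulr0.
  split=> [j j'|]; first by rewrite !z.
  under eq_bigr do rewrite mulrBl.
  by rewrite sumrB !pick !Pi subrr.
- move=> a [ba bs].
  have aP j : ~~ P j -> a j = 0.
    move=> Pj; have := ba j (i ord0); rewrite Pi (negPf Pj) /profile subr0 mulr1 sm0 mulr0.
    by move=> /eqP; rewrite mulf_eq0 fmorph_eq0 (gt_eqF (sh_gt0 m_gt0)) orbF => /eqP.
  have a_img (F : 'I_n -> C) : (forall j, ~~ P j -> F j = 0) -> \sum_j F j = \sum_t F (i t).
    move=> FP; transitivity (\sum_j \sum_t (j == i t)%:R * F j).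
      apply: eq_bigr => j _; have [|/FP->] := boolP (P j); last first.
        by rewrite big1// => t _; rewrite mulr0.
      rewrite PE => /existsP[t0 /eqP->]; rewrite (bigD1 t0)//= eqxx mul1r big1 ?addr0//.
      by move=> t tt0; rewrite ii eq_sym (negPf tt0) mul0r.
    by rewrite exchange_big/=; apply: eq_bigr => t _; rewrite pick.
  have s0 : \sum_t a (i t) = 0.
    have := bs; rewrite a_img => [|j Pj]; last by rewrite aP ?mul0r.
    under eq_bigr do rewrite Pi.
    rewrite -mulr_suml => /eqP; rewrite mulf_eq0 => /orP[/eqP//|].
    by rewrite fmorph_eq0 /dprofile subr0 mulr1 mulf_eq0 oppr_eq0 (gt_eqF m_gt0) (negPf cm0).
  exists (fun t => a (i (lift ord0 t))) => j.
  have [|Pj] := boolP (P j); last first.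
    by rewrite aP// big1// => t _; rewrite eP// mulr0.
  rewrite PE => /existsP[t /eqP->]; rewrite /e.
  case: (unliftP ord0 t) => [t' ->|->].
    rewrite (bigD1 t')//= eqxx (l0i t') subr0 mulr1 big1 ?addr0// => t1 tt1.
    by rewrite (ll t') eq_sym (negPf tt1) subrr mulr0.
  under eq_bigr do rewrite i0l eqxx sub0r mulrN1.
  by rewrite sumrN; apply/eqP; rewrite -addr_eq0; move: s0; rewrite big_ord_recl => ->.
- move=> c h t; have := h (i (lift ord0 t)); rewrite (bigD1 t)//= {1}/e.
  rewrite eqxx l0i subr0 mulr1 big1 ?addr0// => t1 tt1.
  by rewrite /e (ll t) l0i eq_sym (negPf tt1) subrr mulr0.
Qed.

(** A sum of logarithmic derivatives at the centre: the total slope there when the common central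
    value is normalised to 1. *)
Lemma sum_dprofile_profile : \sum_j (dprofile (P j) 0)%:C / (profile (P j) 0)%:C =
  (- m * (#|P|%:R * cot m + #|predC P|%:R * coth m))%:C.
Proof.
pose F b : R := dprofile b 0 / profile b 0.
rewrite (eq_bigr (fun j => (F (P j))%:C)) => [|j _]; last by rewrite -fmorph_div.
rewrite -raddf_sum (bigID P)/= (eq_bigr (fun=> F true)) => [|j ->//].
rewrite [X in _ + X](eq_bigr (fun=> F false)) => [|j /negPf->//].
rewrite !sumr_const -(mulr_natl (F true)) -(mulr_natl (F false)); congr (_%:C).
rewrite /F /dprofile /profile !subr0 !mulr1 /cot /coth /ch /sh mulrDr.
congr (_ + _); first by ring.
have h : expR m - expR (- m) != 0.
  by rewrite gt_eqF// subr_gt0 ltr_expR; have := m_gt0; lra.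
by field; rewrite h.
Qed.

(** No profile vanishes at the centre, so the central value determines all amplitudes, and the
    Kirchhoff condition multiplies it by -m D. The multiplicity is thus a truth value read as 0 or
    1. *)
Lemma multiplicity_sin_neq0 : complex.Im l = 0 -> (0 < n)%N -> sin m != 0 ->
  has_algebraic_multiplicity B l
    (#|P|%:R * cot m + #|predC P|%:R * coth m == 0).
Proof.
move=> l0 n0 sm0; have pn0 b := profile0_neq0 b sm0.
pose j0 := Ordinal n0; set D := _ + _.
have sE := sum_dprofile_profile; rewrite -/D in sE.
have bal a : balanced a ->
    (forall j, a j = (a j0 * (profile (P j0) 0)%:C) / (profile (P j) 0)%:C) /\
    (a j0 * (profile (P j0) 0)%:C) * (- m * D)%:C = 0.
  move=> [ba bs]; have E j : a j = (a j0 * (profile (P j0) 0)%:C) / (profile (P j) 0)%:C.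
    by rewrite -(ba j) mulfK.
  split=> //; rewrite -sE mulr_sumr -[RHS]bs; apply: eq_bigr => j _.
  by rewrite [in RHS]E; ring.
case: (eqVneq D 0) => D0.
  apply: (multiplicity_edge_family (e := fun (_ : 'I_1) j => (profile (P j) 0)%:C^-1)) => //.
  - move=> _; split=> [i j|]; first by rewrite !mulVf.
    by under eq_bigr do rewrite mulrC; rewrite sE D0 mulr0.
  - move=> a /bal[E _]; exists (fun=> a j0 * (profile (P j0) 0)%:C) => j.
    by rewrite big_ord1 -E.
  - move=> c h i; have /eqP := h j0; rewrite big_ord1 mulf_eq0 invr_eq0 (negPf (pn0 _)) orbF.
    by rewrite (ord1 i) => /eqP.
apply: (multiplicity_edge_family (e := fun (_ : 'I_0) _ => 0)) => //.
- by case.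
- have mD : (- m * D)%:C != 0 by rewrite fmorph_eq0 mulf_neq0// oppr_eq0 gt_eqF.
  move=> a /bal[E /eqP]; rewrite mulf_eq0 (negPf mD) orbF => /eqP z.
  by exists (fun=> 0) => j; rewrite E z mul0r big_ord0.
- by move=> c h [].
Qed.

End Real_eigenvalues.

(** * Multiplicity decides between resolvent set and point spectrum *)

Section Spectral_dichotomy.
Variable R : realType.
Local Notation C := R[i].
Local Notation mu := (@lebesgue_measure R).
Variables np nm : nat.
Local Notation n := (np + nm)%N.
Local Notation B := (indefinite_kirchhoff R np nm).
Local Notation norm := (@L2G_norm R np nm).
Local Notation zero_data := (fun (_ : 'I_n) (_ : R) => 0 : C).
Implicit Types (l : C).

Lemma point_spectrum_spectrum l : point_spectrum B l -> spectrum norm B l.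
Proof.
move=> [f [df f0 fl]] [ex _]; have [h [_ hu]] := ex 0.
have [d0 s0] := kernel0 np nm l.
have e0 : h = 0 := hu 0 (conj d0 s0).
have sf : Defs.shift B l f = 0 by rewrite /Defs.shift fl subrr.
have ef : h = f := hu f (conj df sf).
by move/eqP: f0; apply; rewrite -ef e0.
Qed.

(** An empty basis leaves a trivial kernel, and injectivity already gives an everywhere defined
    bounded inverse; no continuous or residual spectrum can arise. *)
Lemma multiplicity0_resolvent l : (0 < n)%N -> complex.Im l = 0 ->
  has_algebraic_multiplicity B l 0 -> resolvent_set norm B l.
Proof.
move=> n0 l0 [e [_ he]]; apply: resolvent_of_injective => // w w1 sol j x x01.
have a i : cac (w i) (w1 i) by have [h _ _ _] := sol; have [] := h i.
pose f : L2G R n := [ffun i => mkL2 (cac_square_integrable (a i))].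
have wf i : ae_eq mu (@unit_itv R) (w i) (f i).
  by rewrite ffunE; apply: ae_eq_sym; exact: mkL2E.
have /he[c [fE _]] : root_subspace B l f.
  by apply/root_subspace_real => //; apply/kernel_kirchhoffP; exists w, w1.
have f0 : f = 0 by rewrite fE big_ord0.
apply: (cac_unique (a j) (cac_cst 0) (wf j)) => //.
by rewrite f0 ffunE; apply: ae_eq_sym; exact: L2_zeroE.
Qed.

Lemma multiplicityS_point_spectrum l k : complex.Im l = 0 ->
  has_algebraic_multiplicity B l k.+1 -> point_spectrum B l.
Proof.
move=> l0 [e [he hu]].
pose d (i : 'I_k.+1) : C := (i == ord0)%:R.
have dE : \sum_i d i *: e i = e ord0.
  rewrite (bigD1 ord0)//= /d eqxx scale1r big1 ?addr0// => i /negPf->.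
  by rewrite scale0r.
have e0 : root_subspace B l (e ord0) by rewrite -dE; exact: he.
exists (e ord0); have [de se] := (root_subspace_real _ l0).1 e0; split => //.
  (* Were the first basis vector 0, both [d] and 0 would be its coordinates. *)
  apply/eqP => ez; have [c [_ cu]] := hu _ e0.
  have c1 : c = d by apply: cu; rewrite dE.
  have c2 : c = fun=> 0.
    by apply: cu; rewrite ez big1// => i _; rewrite scale0r.
  have := congr1 (fun h => h ord0) (etrans (esym c1) c2).
  by rewrite /d eqxx => /eqP; rewrite oner_eq0.
by apply/eqP; rewrite -subr_eq0; apply/eqP.
Qed.

Lemma multiplicity_spectrum l k : (0 < n)%N -> complex.Im l = 0 ->
  has_algebraic_multiplicity B l k ->
  (spectrum norm B l <-> (0 < k)%N) /\ (point_spectrum B l <-> (0 < k)%N).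
Proof.
move=> n0 l0; case: k => [|k] h.
  have r := multiplicity0_resolvent n0 l0 h.
  have ns : ~ spectrum norm B l by move=> s; apply: s.
  by split; split => // s; exfalso; apply: ns => //; exact: point_spectrum_spectrum.
have p := multiplicityS_point_spectrum l0 h.
by split; split => // _; exact: point_spectrum_spectrum.
Qed.

Lemma multiplicity_pos_sin_eq0 (m : R) : (0 < np)%N -> 0 < m -> sin m = 0 ->
  has_algebraic_multiplicity B (m ^+ 2)%:C (np - 1).
Proof.
move=> np0 m0 sm; have [k E] : exists k, np = k.+1 by exists np.-1; rewrite prednK.
have -> : (np - 1 = k)%N by rewrite E subn1.
have kn (t : 'I_k.+1) : (t < n)%N by rewrite (leq_trans (ltn_ord t))// -E leq_addr.
apply: (@multiplicity_sin_eq0 _ _ _ (fun j : 'I_n => (j < np)%N) m _ _ _ k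
  (fun t => Ordinal (kn t))) => //.
- move=> j; rewrite /edge_sign; case: ifP => _; last by rewrite mul1r.
  by rewrite mulN1r rmorphN.
- by move=> t t' [] /val_inj.
move=> j; apply/idP/existsP => [jp|[t /eqP->]]; last by rewrite /= E.
have jk : (j < k.+1)%N by apply: leq_trans jp _; rewrite E.
by exists (Ordinal jk); apply/eqP/val_inj.
Qed.

Lemma multiplicity_neg_sin_eq0 (m : R) : (0 < nm)%N -> 0 < m -> sin m = 0 ->
  has_algebraic_multiplicity B (- m ^+ 2)%:C (nm - 1).
Proof.
move=> nm0 m0 sm; have [k E] : exists k, nm = k.+1 by exists nm.-1; rewrite prednK.
have -> : (nm - 1 = k)%N by rewrite E subn1.
have kn (t : 'I_k.+1) : (np + t < n)%N by rewrite ltn_add2l (leq_trans (ltn_ord t))// -E.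
apply: (@multiplicity_sin_eq0 _ _ _ (fun j : 'I_n => ~~ (j < np)%N) m _ _ _ k
  (fun t => Ordinal (kn t))) => //=.
- move=> j; rewrite /edge_sign; case: ifP => _ /=; last by rewrite mul1r.
  by rewrite mulN1r rmorphN opprK.
- by move=> t t' [] /addnI /val_inj.
move=> j; apply/idP/existsP => [jp|[t /eqP->]]; last by rewrite /= -leqNgt leq_addr.
rewrite -leqNgt in jp.
have jk : (j - np < k.+1)%N by rewrite ltn_subLR// (leq_trans (ltn_ord j))// E.
by exists (Ordinal jk); apply/eqP/val_inj; rewrite /= subnKC.
Qed.

Lemma card_pos_edges : #|(fun j : 'I_n => (j < np)%N)| = np /\
  #|predC (fun j : 'I_n => (j < np)%N)| = nm.
Proof.
have E : #|(fun j : 'I_n => (j < np)%N)| = np.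
  rewrite -[RHS]card_ord -(fintype.card_image (@lshift_inj np nm)); apply: eq_card => j.
  apply/idP/fintype.imageP => [jp|[i _ ->]]; last exact: (ltn_ord i).
  by exists (Ordinal jp) => //; exact: val_inj.
split => //; have := cardC (fun j : 'I_n => (j < np)%N).
by rewrite card_ord E => /addnI.
Qed.

Lemma multiplicity_pos_sin_neq0 (m : R) : (0 < n)%N -> 0 < m -> sin m != 0 ->
  has_algebraic_multiplicity B (m ^+ 2)%:C (np%:R * cot m + nm%:R * coth m == 0).
Proof.
move=> n0 m0 sm; have [E1 E2] := card_pos_edges.
have := @multiplicity_sin_neq0 _ np nm (fun j : 'I_n => (j < np)%N) m (m ^+ 2)%:C m0.
rewrite E1 E2; apply => // j; rewrite /edge_sign; case: ifP => _; last by rewrite mul1r.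
by rewrite mulN1r rmorphN.
Qed.

Lemma multiplicity_neg_sin_neq0 (m : R) : (0 < n)%N -> 0 < m -> sin m != 0 ->
  has_algebraic_multiplicity B (- m ^+ 2)%:C (nm%:R * cot m + np%:R * coth m == 0).
Proof.
move=> n0 m0 sm; have [E1 E2] := card_pos_edges.
have := @multiplicity_sin_neq0 _ np nm (predC (fun j : 'I_n => (j < np)%N)) m (- m ^+ 2)%:C m0.
have -> : #|predC (predC (fun j : 'I_n => (j < np)%N))| = np.
  by rewrite -[RHS]E1; apply: eq_card => j; rewrite !inE negbK.
rewrite E2; apply => //=.
move=> j; rewrite /edge_sign; case: ifP => _ /=; last by rewrite mul1r.
by rewrite mulN1r rmorphN opprK.
Qed.

End Spectral_dichotomy.

(** * The equation coth m = -r cot m *)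

Section Transcendental_equation.
Variable R : realType.
Implicit Types (x y r m : R) (k : nat).

Definition th x : R := sh x / ch x.

Lemma ch_gt0 x : 0 < ch x.
Proof. by rewrite divr_gt0// addr_gt0// expR_gt0. Qed.

Lemma th_gt0 x : 0 < x -> 0 < th x.
Proof. by move=> x0; rewrite divr_gt0 ?sh_gt0 ?ch_gt0. Qed.

Lemma coth_ch_sh x : coth x = ch x / sh x.
Proof. by rewrite /coth /ch /sh invfM invrK mulrACA mulVf ?mulr1// pnatr_eq0. Qed.

Lemma th_lt x y : x < y -> th x < th y.
Proof.
move=> xy; rewrite /th ltr_pdivrMr ?ch_gt0// mulrAC ltr_pdivlMr ?ch_gt0//.
rewrite /sh /ch.
have e1 : expR x < expR y by rewrite ltr_expR.
have e2 : expR (- y) < expR (- x) by rewrite ltr_expR ltrN2.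
have := expR_gt0 x; have := expR_gt0 (- y).
by move: (expR x) (expR y) (expR (- x)) (expR (- y)) e1 e2 => a b c d *; nra.
Qed.

Lemma sin_kpi k : sin (k%:R * pi) = 0 :> R.
Proof. by rewrite mulr_natl -[_ *+ k]add0r (alternatingn (@sinDpi R)) sin0 mulr0. Qed.

Lemma sin_between_neq0 k m : k%:R * pi < m < k.+1%:R * pi -> sin m != 0.
Proof.
move=> /andP[h1 h2]; have -> : m = (m - pi *+ k) + pi *+ k by rewrite subrK.
rewrite (alternatingn (@sinDpi R)) mulf_neq0 ?signr_eq0//.
rewrite gt_eqF// sin_gt0_pi// -[pi *+ k]mulr_natl.
by move: h2; rewrite -natr1 mulrDl mul1r => h2; apply/andP; split; lra.
Qed.

Lemma pi_multiple_or_between m : 0 < m -> exists k,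
  ((1 <= k)%N /\ m = k%:R * pi) \/ k%:R * pi < m < k.+1%:R * pi.
Proof.
move=> m0; have p0 := pi_gt0 R.
have /truncn_itv : 0 <= m / pi by rewrite divr_ge0// ltW.
set k := Num.truncn _; rewrite ler_pdivlMr// ltr_pdivrMr// => /andP[h1 h2]; exists k.
move: h1; rewrite le_eqVlt => /predU1P[h|->]; [left|by right; rewrite h2].
split => //; move: m0; rewrite -h; case: (k) => //; by rewrite mul0r ltxx.
Qed.

(** The distance d from m to the right end of its interval lies in ]0, pi[ and satisfies cot m =
    -cot d; the equation becomes tan d = r tanh m. *)
Lemma transcendental_equivalence r m k : 0 < r -> 0 < m ->
  k%:R * pi < m < k.+1%:R * pi ->
  coth m = - r * cot m <-> m + atan (r * th m) = k.+1%:R * pi.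
Proof.
move=> r0 m0 /andP[h1 h2]; set d := k.+1%:R * pi - m.
have d0 : 0 < d by rewrite subr_gt0.
have dpi : d < pi.
  by rewrite /d -natr1 mulrDl mul1r ltrBlDr addrC ltrD2l.
have mE : m = - d + pi *+ k.+1 by rewrite /d -mulr_natl; ring.
have sd : 0 < sin d by rewrite sin_gt0_pi// d0.
have shm := sh_gt0 m0; have chm := ch_gt0 m.
have cotE : cot m = - (cos d / sin d).
  rewrite /cot mE (alternatingn (@sinDpi R)) (alternatingn (@cosDpi R)) sinN cosN.
  by rewrite invfM mulrACA divff ?signr_eq0// mul1r invrN mulrN.
have -> : (m + atan (r * th m) = k.+1%:R * pi) <-> (d = atan (r * th m)).
  by rewrite /d; split => h; lra.
rewrite cotE mulrNN coth_ch_sh; split => h.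
  have e : ch m * sin d = r * cos d * sh m.
    have := congr1 (fun z => z * sh m * sin d) h.
    rewrite divfK ?gt_eqF// => ->.
    by field; rewrite gt_eqF.
  (* The left-hand side of [e] is positive and the right-hand side has the sign of cos d. Hence d <
     pi/2, where [atan] inverts [tan]. *)
  have cd : 0 < cos d.
    have : 0 < r * cos d * sh m by rewrite -e mulr_gt0.
    by rewrite pmulr_lgt0// pmulr_rgt0.
  have td : tan d = r * th m.
    rewrite /tan /th; apply: (mulIf (lt0r_neq0 chm)); apply: (mulIf (lt0r_neq0 cd)).
    rewrite mulrAC divfK ?gt_eqF// mulrC e.
    by field; rewrite gt_eqF.
  rewrite -td tanK// in_itv/=; apply/andP; split.
    by rewrite (lt_trans _ d0)// oppr_lt0 divr_gt0 ?pi_gt0.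
  rewrite ltNge; apply/negP => hd.
  suff : cos d <= 0 by rewrite leNgt cd.
  have := @cos_ge0_pihalf R (pi - d); rewrite (_ : cos (pi - d) = - cos d).
    by rewrite oppr_ge0; apply; apply/andP; split; lra.
  by rewrite cosB cospi sinpi mul0r addr0 mulN1r.
have td : tan d = r * th m by rewrite h atanK.
have cd : 0 < cos d by rewrite h; apply: cos_gt0_pihalf; rewrite atan_gtNpi2 atan_ltpi2.
have e : ch m * sin d = r * cos d * sh m.
  have -> : sin d = tan d * cos d by rewrite /tan divfK// gt_eqF.
  by rewrite td /th; field; rewrite gt_eqF.
apply: (mulIf (lt0r_neq0 shm)); apply: (mulIf (lt0r_neq0 sd)).
rewrite divfK ?gt_eqF// e.
by field; rewrite gt_eqF.
Qed.

Lemma continuous_th : continuous th.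
Proof.
have cN : continuous (fun y : R => expR (- y)).
  by move=> y; apply: continuous_comp; [exact: opp_continuous|exact: continuous_expR].
move=> x; apply: cvgM.
  apply: cvgM; last exact: cvg_cst.
  by apply: cvgB; [exact: continuous_expR|exact: cN].
apply: cvgV; first by rewrite gt_eqF// ch_gt0.
apply: cvgM; last exact: cvg_cst.
by apply: cvgD; [exact: continuous_expR|exact: cN].
Qed.

Lemma transcendental_root r k : 0 < r -> exists m : R,
  [/\ k%:R * pi < m < k.+1%:R * pi, coth m = - r * cot m &
   forall m', k%:R * pi < m' < k.+1%:R * pi -> coth m' = - r * cot m' -> m' = m].
Proof.
move=> r0; pose F m : R := m + atan (r * th m).
have cF : continuous F.
  move=> x; apply: cvgD; first exact: cvg_id.
  apply: (@continuous_comp _ _ _ (fun y => r * th y) (@atan R)).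
    by apply: cvgM; [exact: cvg_cst|exact: continuous_th].
  exact: continuous_atan.
have incF x y : x < y -> F x < F y.
  by move=> xy; rewrite ltrD// lt_atan// ltr_pM2l// th_lt.
have p0 := pi_gt0 R.
have k0 : 0 <= k%:R * pi :> R by rewrite mulr_ge0// ltW.
have kk : k.+1%:R * pi = k%:R * pi + pi :> R by rewrite -natr1 mulrDl mul1r.
(* The target (k+1) pi lies strictly between the end values because [atan] stays below pi at the
   left end and is positive at the right one. Strictness later keeps the root in the open
   interval. *)
have Fl : F (k%:R * pi) < k.+1%:R * pi.
  rewrite /F kk ltrD2l (lt_trans (atan_ltpi2 _))//; lra.
have Fu : k.+1%:R * pi < F (k.+1%:R * pi).
  rewrite /F ltrDl -(@atan0 R) lt_atan// mulr_gt0// th_gt0//; lra.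
have [|||m m01 Fm] := @IVT R F (k%:R * pi) (k.+1%:R * pi) (k.+1%:R * pi).
- by rewrite kk; lra.
- exact: continuous_subspaceT.
- by rewrite ge_min le_max (ltW Fl) (ltW Fu) orbT.
have mk : k%:R * pi < m < k.+1%:R * pi.
  move: m01; rewrite in_itv/= !le_eqVlt => /andP[/predU1P[h|->]].
    by move: Fl; rewrite h Fm ltxx.
  by case/predU1P => [h|//]; move: Fu; rewrite -h Fm h ltxx.
have m0 : 0 < m by case/andP: mk => h _; exact: le_lt_trans h.
exists m; split => //; first exact/(transcendental_equivalence r0 m0 mk).
move=> m' mk' /(transcendental_equivalence r0 _ mk').
have m0' : 0 < m' by case/andP: mk' => h _; exact: le_lt_trans h.
move=> /(_ m0') Fm'.
by case: (ltgtP m' m) => // /incF; rewrite /F in Fm *; rewrite Fm Fm' ltxx.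
Qed.

Lemma th_cvg (u : nat -> R) : (forall k, k%:R <= u k) -> th (u k) @[k --> \oo] --> (1 : R).
Proof.
move=> uk; have e0 : expR (- k%:R) @[k --> \oo] --> (0 : R) by exact: cvgn_expR.
have bnd x : 0 <= x -> 1 - 2 * expR (- x) <= th x <= 1.
  move=> x0; rewrite /th ler_pdivrMr ?ch_gt0// ler_pdivlMr ?ch_gt0// /sh /ch.
  have a1 : 1 <= expR x by rewrite -expR0 ler_expR.
  have ab : expR x * expR (- x) = 1 by rewrite -expRD subrr expR0.
  have := expR_gt0 (- x); move: (expR x) (expR (- x)) a1 ab => a b a1 ab b0.
  by apply/andP; split; nra.
apply: (@squeeze_cvgr _ _ _ _ (fun k => 1 - 2 * expR (- k%:R)) (fun=> 1)).
- apply: nearW => k; have u0 : 0 <= u k by exact: le_trans (uk k).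
  have /andP[h1 ->] := bnd _ u0; rewrite andbT (le_trans _ h1)//.
  by rewrite lerB// ler_wpM2l// ler_expR lerN2.
- rewrite -[X in _ --> X]subr0 -[X in _ - X](mulr0 2).
  by apply: cvgB; [exact: cvg_cst|apply: cvgM; [exact: cvg_cst|exact: e0]].
exact: cvg_cst.
Qed.

(** The deviation from (k+1) pi is exactly -atan (r tanh u_k), and tanh u_k tends to 1. *)
Lemma transcendental_root_cvg r (u : nat -> R) : 0 < r ->
  (forall k, k%:R * pi < u k < k.+1%:R * pi) ->
  (forall k, coth (u k) = - r * cot (u k)) ->
  u k - k.+1%:R * pi @[k --> \oo] --> - atan r.
Proof.
move=> r0 uk uE; have p0 := pi_gt0 R; have p2 := pi_ge2 R.
have kp k : k%:R <= k%:R * pi :> R by rewrite ler_peMr//; lra.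
have u0 k : 0 < u k.
  by have /andP[h _] := uk k; rewrite (le_lt_trans _ h)// (le_trans _ (kp k)).
have E k : u k - k.+1%:R * pi = - atan (r * th (u k)).
  by have /(transcendental_equivalence r0 (u0 k) (uk k)) := uE k; lra.
under eq_fun do rewrite E.
apply: cvgN; rewrite -[X in atan X](mulr1 r).
apply: (@continuous_cvg _ _ _ _ _ (fun k => r * th (u k)) (@atan R)).
  exact: continuous_atan.
apply: cvgM; first exact: cvg_cst.
apply: th_cvg => k; have /andP[h _] := uk k.
exact: le_trans (kp k) (ltW h).
Qed.

End Transcendental_equation.

(** * The list of spectral points, and their discreteness *)

Section Spectrum.
Variable R : realType.
Local Notation C := R[i].
Variables np nm : nat.
Hypotheses (hp : (0 < np)%N) (hm : (0 < nm)%N).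
Local Notation n := (np + nm)%N.
Local Notation B := (indefinite_kirchhoff R np nm).
Local Notation norm := (@L2G_norm R np nm).

Definition transcendental_roots (r : R) (u : nat -> R) := forall k,
  [/\ k%:R * pi < u k < k.+1%:R * pi, coth (u k) = - r * cot (u k) &
   forall m, k%:R * pi < m < k.+1%:R * pi -> coth m = - r * cot m -> m = u k].

Variables u v : nat -> R.
Hypothesis uP : transcendental_roots (np%:R / nm%:R) u.
Hypothesis vP : transcendental_roots (nm%:R / np%:R) v.

(* [u k] lies in (k pi, (k+1) pi), so it is the square root of eta_(k+1);
   similarly [Negz k] is -(k+1). *)
Definition eta_of (u v : nat -> R) (k : int) : R :=
  match k with
  | Posz 0 => 0 | Posz k'.+1 => u k' ^+ 2 | Negz k' => - v k' ^+ 2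
  end.
Local Notation eta := (eta_of u v).

Let n0 : (0 < n)%N. Proof. by rewrite addn_gt0 hp. Qed.

Lemma transcendental_root_gt0 r w k : transcendental_roots r w -> 0 < w k.
Proof.
move=> /(_ k)[/andP[h _] _ _]; apply: le_lt_trans h.
by rewrite mulr_ge0// pi_ge0.
Qed.

Lemma transcendental_cond (p q : nat) (m : R) : (0 < q)%N ->
  (p%:R * cot m + q%:R * coth m == 0) = (coth m == - (p%:R / q%:R) * cot m).
Proof.
move=> q0; have q0' : (q%:R : R) != 0 by rewrite pnatr_eq0 -lt0n.
apply/eqP/eqP => [h|->]; last by field.
apply: (mulfI q0').
have -> : q%:R * (- (p%:R / q%:R) * cot m) = - (p%:R * cot m) by field.
by lra.
Qed.

Lemma multiplicity_kpi_pos k : (1 <= k)%N ->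
  has_algebraic_multiplicity B ((k%:R * pi) ^+ 2)%:C (np - 1).
Proof.
move=> k1; apply: multiplicity_pos_sin_eq0 => //; last exact: sin_kpi.
by rewrite mulr_gt0 ?pi_gt0 ?ltr0n.
Qed.

Lemma multiplicity_kpi_neg k : (1 <= k)%N ->
  has_algebraic_multiplicity B (- (k%:R * pi) ^+ 2)%:C (nm - 1).
Proof.
move=> k1; apply: multiplicity_neg_sin_eq0 => //; last exact: sin_kpi.
by rewrite mulr_gt0 ?pi_gt0 ?ltr0n.
Qed.

Lemma multiplicity_eta (k : int) : k != 0 ->
  has_algebraic_multiplicity B (eta k)%:C 1.
Proof.
case: k => [[//|k]|k] _ /=.
  have [h1 h2 _] := uP k; have m0 := transcendental_root_gt0 k uP.
  have := @multiplicity_pos_sin_neq0 R np nm (u k) n0 m0 (sin_between_neq0 h1).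
  by rewrite transcendental_cond// h2 eqxx.
have [h1 h2 _] := vP k; have m0 := transcendental_root_gt0 k vP.
have := @multiplicity_neg_sin_neq0 R np nm (v k) n0 m0 (sin_between_neq0 h1).
by rewrite transcendental_cond// h2 eqxx.
Qed.

Lemma spectrum_real (l : C) : spectrum norm B l ->
  exists x : R, [/\ x != 0, l = x%:C & exists k, has_algebraic_multiplicity B l k.+1].
Proof.
move=> sl; have [l0|l0] := eqVneq (complex.Im l) 0; last first.
  by exfalso; apply: sl; apply: nonreal_resolvent => //; right.
have lE : l = (complex.Re l)%:C by case: l l0 {sl} => a b /= ->.
have x0 : complex.Re l != 0.
  apply/eqP => x0; apply: sl; apply: nonreal_resolvent => //; left.
  by rewrite lE x0.
exists (complex.Re l); split => //.
have [k hk] : exists k, has_algebraic_multiplicity B l k.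
  rewrite lE; have [xl|xg] := ltP (complex.Re l) 0.
    set m := Num.sqrt (- complex.Re l).
    have m0 : 0 < m by rewrite sqrtr_gt0 oppr_gt0.
    have -> : complex.Re l = - m ^+ 2 by rewrite sqr_sqrtr ?opprK// oppr_ge0 ltW.
    have [sm|sm] := eqVneq (sin m) 0; eexists.
      exact: multiplicity_neg_sin_eq0.
    exact: multiplicity_neg_sin_neq0.
  have {xg} xg : 0 < complex.Re l by rewrite lt_neqAle eq_sym x0.
  set m := Num.sqrt (complex.Re l).
  have m0 : 0 < m by rewrite sqrtr_gt0.
  have -> : complex.Re l = m ^+ 2 by rewrite sqr_sqrtr// ltW.
  have [sm|sm] := eqVneq (sin m) 0; eexists.
    exact: multiplicity_pos_sin_eq0.
  exact: multiplicity_pos_sin_neq0.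
have [[/(_ sl) k0 _] _] := multiplicity_spectrum n0 l0 hk.
by exists k.-1; rewrite prednK.
Qed.

Lemma multiplicity_in_spectrum (x : R) k :
  has_algebraic_multiplicity B x%:C k -> (0 < k)%N -> spectrum norm B x%:C.
Proof.
move=> h k0.
by have [] := multiplicity_spectrum n0 (erefl : complex.Im x%:C = 0) h; case=> _ /(_ k0).
Qed.

Lemma multiplicity_gt0 (x : R) k :
  has_algebraic_multiplicity B x%:C k -> spectrum norm B x%:C -> (0 < k)%N.
Proof.
move=> h s.
by have [] := multiplicity_spectrum n0 (erefl : complex.Im x%:C = 0) h; case=> /(_ s).
Qed.

(** Let m be the square root of |l|. If m is a multiple of pi, the multiplicity np - 1 or nm - 1
    must be positive. Otherwise sin m is nonzero, a positive multiplicity means that the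
    transcendental equation holds, and uniqueness of its root on the interval identifies m. *)
Lemma spectrumP (l : C) : spectrum norm B l <->
  [\/ exists k, [/\ (1 <= k)%N, (2 <= np)%N & l = ((k%:R * pi) ^+ 2)%:C],
      exists k, [/\ (1 <= k)%N, (2 <= nm)%N & l = (- (k%:R * pi) ^+ 2)%:C] |
      exists k : int, k != 0 /\ l = (eta k)%:C].
Proof.
split; last first.
  case=> [[k [k1 p2 ->]]|[k [k1 p2 ->]]|[k [k0 ->]]].
  - by apply: multiplicity_in_spectrum (multiplicity_kpi_pos k1) _; rewrite subn_gt0.
  - by apply: multiplicity_in_spectrum (multiplicity_kpi_neg k1) _; rewrite subn_gt0.
  - exact: multiplicity_in_spectrum (multiplicity_eta k0) _.
move=> sl; have [x [x0 lE _]] := spectrum_real sl; rewrite lE in sl *.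
have [xl|xg] := ltP x 0.
  set m := Num.sqrt (- x).
  have m0 : 0 < m by rewrite sqrtr_gt0 oppr_gt0.
  have xE : x = - m ^+ 2 by rewrite sqr_sqrtr ?opprK// oppr_ge0 ltW.
  rewrite xE in sl *; have [k [[k1 mk]|mk]] := pi_multiple_or_between m0.
    constructor 2; exists k; split => //; last by rewrite mk.
    rewrite mk in sl; have := multiplicity_gt0 (multiplicity_kpi_neg k1) sl.
    by rewrite subn_gt0.
  constructor 3; exists (Negz k); split => //=.
  have := multiplicity_gt0 (multiplicity_neg_sin_neq0 n0 m0 (sin_between_neq0 mk)) sl.
  rewrite transcendental_cond// lt0b => /eqP h.
  by have [_ _ /(_ m mk h) ->] := vP k.
have {xg} xg : 0 < x by rewrite lt_neqAle eq_sym x0.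
set m := Num.sqrt x.
have m0 : 0 < m by rewrite sqrtr_gt0.
have xE : x = m ^+ 2 by rewrite sqr_sqrtr// ltW.
rewrite xE in sl *; have [k [[k1 mk]|mk]] := pi_multiple_or_between m0.
  constructor 1; exists k; split => //; last by rewrite mk.
  rewrite mk in sl; have := multiplicity_gt0 (multiplicity_kpi_pos k1) sl.
  by rewrite subn_gt0.
constructor 3; exists (Posz k.+1); split => //=.
have := multiplicity_gt0 (multiplicity_pos_sin_neq0 n0 m0 (sin_between_neq0 mk)) sl.
rewrite transcendental_cond// lt0b => /eqP h.
by have [_ _ /(_ m mk h) ->] := uP k.
Qed.

(** Each of the four sequences dominates (k pi)^2 in absolute value, so only finitely many indices
    reach a given ball. *)
Lemma spectrum_finite_ball (l : C) :
  finite_set (spectrum norm B `&` [set z : C | (`|l - z| < 1)%R]).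
Proof.
(* The chain k <= (k pi)^2 <= |x| < 1 + |l| < N bounds the index. *)
pose N := (Num.truncn (complex.Re `|l|%R) + 3)%N.
pose F := ([set ((k%:R * pi) ^+ 2)%:C | k in `I_N] `|`
  [set (- (k%:R * pi) ^+ 2 : R)%:C | k in `I_N]) `|`
  ([set ((u k) ^+ 2)%:C | k in `I_N] `|` [set (- (v k) ^+ 2 : R)%:C | k in `I_N]).
apply: (@sub_finite_set _ _ F); last first.
  by rewrite !finite_setU; split; split; apply: finite_image; exact: finite_II.
have bnd (x : R) k : `|l - x%:C| < 1 -> (k%:R * pi) ^+ 2 <= `|x| -> (k < N)%N.
  move=> lx kx.
  have lE : `|l| = (complex.Re `|l|%R)%:C by rewrite normc_def.
  have xE : `|x%:C| = `|x|%:C by rewrite normc_def/= expr0n addr0 sqrtr_sqr.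
  have : `|x|%:C < (1 + complex.Re `|l|%R)%:C.
    rewrite -xE rmorphD/= -lE; apply: le_lt_trans (_ : `|l - x%:C| + `|l| < _).
      by have := ler_normB l (l - x%:C); rewrite opprB addrCA subrr addr0 addrC.
    by rewrite ltrD2r.
  rewrite ltcR => xl.
  have l0 : 0 <= complex.Re `|l|%R by rewrite normc_def/= sqrtr_ge0.
  have /andP[_ ht] := truncn_itv l0.
  have kk : (k%:R : R) <= (k%:R * pi) ^+ 2.
    rewrite exprMn -natrX -[leLHS]mulr1; apply: ler_pM => //.
      by rewrite ler_nat; case: (k) => // i; rewrite leq_pmulr.
    by rewrite expr_ge1// ?pi_ge0//; have := pi_ge2 R; lra.
  have : (k%:R : R) < N%:R.
    apply: (le_lt_trans kk); apply: (le_lt_trans kx); apply: (lt_trans xl).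
    by rewrite /N natrD; move: ht; rewrite -natr1; lra.
  by rewrite ltr_nat.
have p0 := pi_gt0 R.
have sq_lt (r : R) w k : transcendental_roots r w -> (k%:R * pi) ^+ 2 <= `|w k ^+ 2|.
  move=> wP; have [/andP[h _] _ _] := wP k; have w0 := transcendental_root_gt0 k wP.
  rewrite ger0_norm ?sqr_ge0// lerXn2r ?nnegrE ?(ltW w0) ?(ltW h)//.
  by rewrite mulr_ge0// ltW.
move=> z [/spectrumP[[k [k1 _ ->]]|[k [k1 _ ->]]|[[[|k]|k] [// _ ->]]] /= hz].
- by left; left; exists k => //; apply: bnd hz _; rewrite ger0_norm// sqr_ge0.
- by left; right; exists k => //; apply: bnd hz _; rewrite normrN ger0_norm// sqr_ge0.
- by right; left; exists k => //; apply: bnd hz _; exact: sq_lt uP.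
- by right; right; exists k => //; apply: bnd hz _; rewrite normrN; exact: sq_lt vP.
Qed.

(** The other spectral points of the unit ball form a finite, hence closed, set; its complement is a
    neighbourhood of l. *)
Lemma spectrum_isolated (l : C) : spectrum norm B l ->
  isolated (spectrum norm B : set C^o) l.
Proof.
move=> sl; split; first by rewrite inE.
pose F : set C^o := (spectrum norm B `&` [set z : C | (`|l - z| < 1)%R]) `\ l.
have fF : finite_set F by apply: finite_setD; exact: spectrum_finite_ball.
have cF : closed F.
  apply: ((@accessible_finite_set_closed C^o).1 _ F fF).
  by apply: hausdorff_accessible; exact: norm_hausdorff.
exists (ball (l : C^o) 1 `&` ~` F).
  apply: filterI; first exact: nbhsx_ballx.
  by apply: open_nbhs_nbhs; split; [exact: closed_openC|case=> _; apply].
apply/seteqP; split => z /=.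
  move=> [[bz Fz] sz]; apply: contrapT => zl; apply: Fz; split => //; split => //.
move=> ->; split => //; split; first exact: ballxx.
by case=> _; apply.
Qed.

Lemma kirchhoff_purely_discrete : purely_discrete_spectrum norm B.
Proof.
move=> l sl; split; first exact: spectrum_isolated.
  have [x [x0 lE [k hk]]] := spectrum_real sl; rewrite lE in hk *.
  exact: multiplicityS_point_spectrum hk.
by have [x [x0 lE [k hk]]] := spectrum_real sl; exists k.+1.
Qed.

Lemma spectrum_point_spectrum : spectrum norm B = point_spectrum B.
Proof.
apply/seteqP; split => l; last exact: point_spectrum_spectrum.
move=> sl; have [x [x0 lE [k hk]]] := spectrum_real sl; rewrite lE in hk *.
exact: multiplicityS_point_spectrum hk.
Qed.

End Spectrum.

(** * The sequence of the eta_k and its asymptotics *)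

Section Eta_sequences.
Variable R : realType.
Implicit Types (u v : nat -> R) (r : R).

Lemma transcendental_roots_exist r : 0 < r -> exists u, transcendental_roots r u.
Proof.
move=> r0; have /choice[u h] := fun k => @transcendental_root R r k r0.
by exists u.
Qed.

Lemma transcendental_roots_unique r u v : transcendental_roots r u ->
  transcendental_roots r v -> u =1 v.
Proof.
by move=> uP vP k; have [h1 h2 _] := uP k; have [_ _ /(_ _ h1 h2)] := vP k.
Qed.

Lemma between_sqr (k : nat) (x : R) : (k%:R * pi) ^+ 2 < x < (k.+1%:R * pi) ^+ 2 ->
  0 < x /\ k%:R * pi < Num.sqrt x < k.+1%:R * pi.
Proof.
move=> /andP[h1 h2]; have x0 : 0 < x by apply: le_lt_trans h1; exact: sqr_ge0.
split => //; have kp (j : nat) : 0 <= j%:R * pi :> R by rewrite mulr_ge0// pi_ge0.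
by rewrite -(ltr_pXn2r (n := 2)) ?nnegrE ?sqrtr_ge0// -[X in _ && X](ltr_pXn2r (n := 2))
  ?nnegrE ?sqrtr_ge0// sqr_sqrtr ?h1// ltW.
Qed.

Lemma sqr_between (k : nat) (x : R) : k%:R * pi < x < k.+1%:R * pi ->
  (k%:R * pi) ^+ 2 < x ^+ 2 < (k.+1%:R * pi) ^+ 2.
Proof.
move=> /andP[h1 h2]; have kp (j : nat) : 0 <= j%:R * pi :> R by rewrite mulr_ge0// pi_ge0.
have x0 : 0 <= x by apply: le_trans (kp k) (ltW h1).
by rewrite !ltr_pXn2r ?nnegrE// h1.
Qed.

(** Both squared quantities are k pi up to a bounded error, so the squares differ by O(k) while they
    grow like k^2. Asymptotic equivalence therefore holds for every bounded phase c. The index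
    [k.-1] aligns [w] with the numbering of the eta_k. *)
Lemma sqr_equiv (w : nat -> R) (c e : R) : `|c| <= 2 -> 0 < e ->
  (forall k, k%:R * pi < w k < k.+1%:R * pi) ->
  \forall k \near \oo, `|w k.-1 ^+ 2 - (k%:R * pi - c) ^+ 2| <= e * `|(k%:R * pi - c) ^+ 2|.
Proof.
move=> c2 e0 wP; near=> k.
have k0 : (0 < k)%N by near: k; exact: nbhs_infty_gt.
(* With pi < 4 and |c| <= 2 the factors of the difference of squares are at most 6 and 2 s + 6. The
   product is at most 72 s once s >= 1, and 72 <= e s; the 3 absorbs c and this lower bound on s. *)
have kb : 3 + (72 / e) <= k%:R :> R by near: k; exact: nbhs_infty_ger.
have p2 := pi_ge2 R; have p4 : pi < 4 :> R by have := @pihalf_lt2 R; lra.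
have /andP[h1 h2] := wP k.-1; rewrite prednK// in h2.
have h1' : k%:R * pi - pi < w k.-1.
  apply: le_lt_trans h1; rewrite -[X in X%:R * pi - pi](prednK k0) -natr1; lra.
have kp : k%:R <= k%:R * pi :> R by rewrite ler_peMr//; lra.
move: h1' h2 kp; set t := k%:R * pi; set w' := w _ => h1' h2 kp.
have e72 : 0 < 72 / e by rewrite divr_gt0.
have [c2l c2r] : - 2 <= c /\ c <= 2 by split; move: c2; rewrite ler_norml => /andP[].
set s := t - c.
have sb : 1 + 72 / e <= s by rewrite /s; lra.
have s0 : 0 < s by lra.
have d6 : `|w' - s| <= 6 by rewrite ler_norml /s; apply/andP; split; lra.
have a6 : `|w' + s| <= 2 * s + 6.
  by rewrite ler_norml /s; apply/andP; split; lra.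
rewrite subr_sqr normrM [leRHS]mulrC (ger0_norm (sqr_ge0 s)).
have es : 72 <= e * s.
  rewrite -ler_pdivrMl// mulrC; lra.
apply: (@le_trans _ _ (6 * (2 * s + 6))); first exact: ler_pM.
by rewrite expr2 -mulrA [s * e]mulrC; nra.
Unshelve. all: by end_near. Qed.

Lemma atan_norm_le2 (x : R) : `|atan x| <= 2.
Proof.
have := @pihalf_lt2 R; have := atan_gtNpi2 x; have := atan_ltpi2 x => *.
by rewrite ler_norml; apply/andP; split; lra.
Qed.

Lemma unique_sqr_root r u k : transcendental_roots r u ->
  unique (fun x : R => (k%:R * pi) ^+ 2 < x < (k.+1%:R * pi) ^+ 2 /\
    coth (Num.sqrt x) = - r * cot (Num.sqrt x)) (u k ^+ 2).
Proof.
move=> uP; have u0 := transcendental_root_gt0 k uP; have [h1 h2 h3] := uP k.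
split; first by rewrite sqrtr_sqr gtr0_norm//; split => //; exact: sqr_between.
move=> x [/between_sqr[x0 hx] hc].
by rewrite -(h3 _ hx hc) sqr_sqrtr// ltW.
Qed.

Lemma unique_opp_sqr_root r u k : transcendental_roots r u ->
  unique (fun x : R => - (k.+1%:R * pi) ^+ 2 < x < - (k%:R * pi) ^+ 2 /\
    coth (Num.sqrt (- x)) = - r * cot (Num.sqrt (- x))) (- u k ^+ 2).
Proof.
move=> /(unique_sqr_root k)[[/andP[h1 h2] h3] h4]; split.
  by rewrite opprK; split => //; rewrite !ltrN2 h1 h2.
move=> x [/andP[x1 x2] xc]; rewrite (h4 (- x)) ?opprK//; split => //.
by rewrite ltrNr x2 ltrNl x1.
Qed.

(** Reflection exchanges the two kinds of edges, so statements for negative indices follow from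
    those for positive ones. *)
Lemma eta_of_opp u v (k : int) : eta_of u v (- k) = - eta_of v u k.
Proof. by case: k => [[|k]|k] /=; rewrite ?oppr0 ?opprK. Qed.

Lemma eta_of_asymptotic r u v (c : R) : transcendental_roots r u -> `|c| <= 2 ->
  (fun k : nat => eta_of u v k%:Z) ~_\oo (fun k : nat => (k%:R * pi - c) ^+ 2).
Proof.
move=> uP c2; apply/eqaddoP => e e0.
have := sqr_equiv c2 e0 (fun k => let: And3 h _ _ := uP k in h).
apply: filterS2 (nbhs_infty_gt 0) => k k0; rewrite !fctE.
by case: k k0.
Qed.

(** Unlike the equivalence of squares, this limit determines the phase: it is the arctangent of the
    ratio in the equation itself. *)
Lemma sqrt_eta_of_cvg r u v : 0 < r -> transcendental_roots r u ->
  Num.sqrt (eta_of u v k%:Z) - (k%:R * pi - atan r) @[k --> \oo] --> (0 : R).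
Proof.
move=> r0 uP; rewrite -cvg_shiftS /=.
have -> : (fun k => Num.sqrt (u k ^+ 2) - (k.+1%:R * pi - atan r)) =
    (fun k => (u k - k.+1%:R * pi) + atan r).
  apply/funext => k; rewrite sqrtr_sqr gtr0_norm; last exact: transcendental_root_gt0 uP.
  by rewrite opprD opprK addrA.
have h : u k - k.+1%:R * pi @[k --> \oo] --> - atan r.
  by apply: transcendental_root_cvg => // k; have [] := uP k.
by have := cvgD h (cvg_cst (atan r)); rewrite addNr; exact.
Qed.

End Eta_sequences.

(** * Collecting the spectral data, and the symmetry criterion *)

Theorem theorem4p1 (R : realType) (np nm : nat) (hp : (1 <= np)%N)
    (hm : (1 <= nm)%N) :
  let B := indefinite_kirchhoff R np nm in
  let sigma := spectrum (@L2G_norm R np nm) B in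
  let rp : R := np%:R / nm%:R in
  let rm : R := nm%:R / np%:R in
  [/\ krein_positive B,
      resolvent_set (@L2G_norm R np nm) B 0,
      purely_discrete_spectrum (@L2G_norm R np nm) B,
      (forall l : R[i], sigma l -> l \is Num.real) &
      exists eta : int -> R,
      let etas : set R[i] := [set (eta k)%:C | k in [set k : int | k != 0]] in
      [/\ (forall k : int, 1 <= k ->
             unique (fun x : R =>
               ((k - 1)%:~R * pi) ^+ 2 < x < (k%:~R * pi) ^+ 2 /\
               coth (Num.sqrt x) = - rp * cot (Num.sqrt x)) (eta k)) /\
          (forall k : int, k <= -1 ->
             unique (fun x : R =>
               - (k%:~R * pi) ^+ 2 < x < - ((k + 1)%:~R * pi) ^+ 2 /\
               coth (Num.sqrt (- x)) = - rm * cot (Num.sqrt (- x))) (eta k)),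
          sigma = point_spectrum B /\
          [/\ np = 1%N -> (2 <= nm)%N ->
                sigma =
                [set (- (k%:R * pi) ^+ 2)%:C | k in [set k : nat | (1 <= k)%N]]
                `|` etas,
              nm = 1%N -> (2 <= np)%N ->
                sigma =
                [set ((k%:R * pi) ^+ 2)%:C | k in [set k : nat | (1 <= k)%N]]
                `|` etas,
              (2 <= np)%N -> (2 <= nm)%N ->
                sigma =
                [set (Num.sg k%:~R * (k%:~R * pi) ^+ 2)%:C
                  | k in [set k : int | k != 0]] `|` etas &
              np = 1%N -> nm = 1%N -> sigma = etas],
          [/\ - pi ^+ 2 < eta (- 1) < 0,
              0 < eta 1 < pi ^+ 2,
              forall k : int, k <= - 2 ->
                - (k%:~R * pi) ^+ 2 < eta k < - ((k + 1)%:~R * pi) ^+ 2 &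
              forall k : int, 2 <= k ->
                ((k - 1)%:~R * pi) ^+ 2 < eta k < (k%:~R * pi) ^+ 2],
          [/\ forall k : nat, (1 <= k)%N ->
                has_algebraic_multiplicity B ((k%:R * pi) ^+ 2)%:C (np - 1),
              forall k : nat, (1 <= k)%N ->
                has_algebraic_multiplicity B (- (k%:R * pi) ^+ 2)%:C (nm - 1) &
              forall k : int, k != 0 ->
                has_algebraic_multiplicity B (eta k)%:C 1] &
          [/\ (fun k : nat => eta k%:Z) ~_\oo
                (fun k : nat => (k%:R * pi - atan rm) ^+ 2),
              (fun k : nat => eta (- k%:Z)) ~_\oo
                (fun k : nat => - (- k%:R * pi - atan rp) ^+ 2),
              Num.sqrt (eta k%:Z) - (k%:R * pi - atan rp) @[k --> \oo] --> 0 &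
              Num.sqrt (- eta (- k%:Z)) - (k%:R * pi - atan rm)
                @[k --> \oo] --> 0]] /\
      ((forall l : R[i], sigma l <-> sigma (- l)) <-> np = nm)].
Proof.
have np0 : (0 < np)%N by [].
have nm0 : (0 < nm)%N by [].
have npR : 0 < np%:R :> R by rewrite ltr0n.
have nmR : 0 < nm%:R :> R by rewrite ltr0n.
move=> B sigma rp rm.
have rp0 : 0 < rp by rewrite divr_gt0.
have rm0 : 0 < rm by rewrite divr_gt0.
have [u uP] := transcendental_roots_exist rp0.
have [v vP] := transcendental_roots_exist rm0.
have specP := spectrumP np0 nm0 uP vP.
have p0 := pi_gt0 R.
have vgt k : 0 < v k := transcendental_root_gt0 k vP.
split.
- exact: kirchhoff_krein_positive.
- by apply: nonreal_resolvent; [rewrite addn_gt0 np0|left].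
- exact (kirchhoff_purely_discrete np0 nm0 uP vP).
- move=> l /(spectrum_real np0 nm0)[x [_ -> _]].
  by rewrite complex_real.
pose eta := eta_of u v; exists eta => etas.
have etasP l : etas l <-> exists k : int, k != 0 /\ l = (eta k)%:C.
  by split=> [[k k0 <-]|[k [k0 ->]]]; exists k.
split; first split.
- split.
    case=> [[|k]|k]// _; have := unique_sqr_root k uP; rewrite -/rp.
    have -> : (k.+1%:Z - 1)%:~R = k%:R :> R.
      by rewrite rmorphB/= rmorph1 -[_.+1%:~R]/(_.+1%:R) -natr1 addrK.
    exact.
  case=> [[|k]|k]// _; have := unique_opp_sqr_root k vP; rewrite -/rm.
  have -> : (Negz k + 1)%:~R = - k%:R :> R.
    by rewrite NegzE rmorphD/= rmorph1 rmorphN/= -[_.+1%:~R]/(_.+1%:R) -natr1 opprD addrNK.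
  have -> : (Negz k)%:~R = - k.+1%:R :> R by [].
  by rewrite !mulNr !sqrrN.
- split; first exact: spectrum_point_spectrum.
  split.
  + move=> np1 nm2; apply/seteqP; split=> l.
      move=> /specP[[k [_]]|[k [k1 _ ->]]|/etasP]; first by rewrite np1.
        by left; exists k.
      by right.
    move=> [[k k1 <-]|/etasP h]; apply/specP; last by constructor 3.
    by constructor 2; exists k.
  + move=> nm1 np2; apply/seteqP; split=> l.
      move=> /specP[[k [k1 _ ->]]|[k [_]]|/etasP]; last by right.
        by left; exists k.
      by rewrite nm1.
    move=> [[k k1 <-]|/etasP h]; apply/specP; last by constructor 3.
    by constructor 1; exists k.
  + move=> np2 nm2; apply/seteqP; split=> l.
      move=> /specP[[k [k1 _ ->]]|[k [k1 _ ->]]|/etasP]; last by right.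
        left; exists k%:Z; first by rewrite /= eqz_nat -lt0n.
        by rewrite gtr0_sg ?mul1r// ltr0n.
      left; exists (- k%:Z); first by rewrite /= oppr_eq0 eqz_nat -lt0n.
      by rewrite rmorphN/= sgrN gtr0_sg ?ltr0n// [- _ * pi]mulNr sqrrN mulN1r.
    move=> [[[[|k]|k] // _ <-]|/etasP h]; apply/specP; last by constructor 3.
      constructor 1; exists k.+1; split => //.
      by rewrite gtr0_sg ?mul1r// ltr0n.
    constructor 2; exists k.+1; split => //.
    have -> : (Negz k)%:~R = - k.+1%:R :> R by [].
    by rewrite sgrN gtr0_sg ?ltr0n// [- _ * pi]mulNr sqrrN mulN1r.
  (* Here np - 1 and nm - 1 are both 0, so neither family of squared multiples of pi is in the
     spectrum. *)
  + move=> np1 nm1; apply/seteqP; split=> l.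
      move=> /specP[[k [_]]|[k [_]]|/etasP//]; by rewrite ?np1 ?nm1.
    by move=> /etasP h; apply/specP; constructor 3.
- have bu k := sqr_between (let: And3 h _ _ := uP k in h).
  have bv k := sqr_between (let: And3 h _ _ := vP k in h).
  split.
  + have /andP[h1 h2] := bv 0%N; rewrite mul1r mul0r expr0n/= in h1 h2.
    by rewrite (_ : eta (-1) = - v 0%N ^+ 2)// ltrN2 h2 oppr_lt0 h1.
  + have := bu 0%N; by rewrite mul1r mul0r expr0n/=.
  + case=> [[|k]|[|k]]// _.
    have := bv k.+1.
    have -> : (Negz k.+1 + 1)%:~R = - k.+1%:R :> R.
      by rewrite NegzE rmorphD/= rmorph1 rmorphN/= -[_.+2%:~R]/(_.+2%:R) -natr1 opprD addrNK.
    have -> : (Negz k.+1)%:~R = - k.+2%:R :> R by [].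
    by rewrite !mulNr !sqrrN /= !ltrN2 andbC.
  + case=> [[|[|k]]|k]// _.
    have := bu k.+1.
    have -> : (k.+2%:Z - 1)%:~R = k.+1%:R :> R.
      by rewrite rmorphB/= rmorph1 -[_.+2%:~R]/(_.+2%:R) -natr1 addrK.
    exact.
- split.
  + by move=> k k1; exact: multiplicity_kpi_pos.
  + by move=> k k1; exact: multiplicity_kpi_neg.
  + by move=> k k1; exact (multiplicity_eta np0 nm0 uP vP k1).
- have evE : (fun k : nat => eta (- k%:Z)) = (fun k : nat => - eta_of v u k%:Z).
    by apply/funext => k; exact: eta_of_opp.
  split.
  (* Any phase bounded by 2 would do, in particular the arctangent of either ratio. *)
  + exact: eta_of_asymptotic uP (atan_norm_le2 _).
  + rewrite evE; apply/eqaddoP => e e0.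
    (* The square of -k pi - a is that of k pi - (-a), so the phase is used with the opposite
       sign. *)
    have c2 : `|- atan rp| <= 2 by rewrite normrN atan_norm_le2.
    have /eqaddoP/(_ e e0) := eta_of_asymptotic u vP c2.
    apply: filterS => k; rewrite !fctE normrN opprK.
    have -> : - k%:R * pi - atan rp = - (k%:R * pi - - atan rp) by ring.
    by rewrite sqrrN !opprK -[`|- _ + _|]normrN opprD opprK.
  + exact: sqrt_eta_of_cvg rp0 uP.
  + rewrite (_ : (fun k : nat => _) =
      (fun k : nat => Num.sqrt (eta_of v u k%:Z) - (k%:R * pi - atan rm))).
      exact: sqrt_eta_of_cvg rm0 vP.
    by apply/funext => k; rewrite /eta eta_of_opp opprK.
split=> [sym|npnm].
  (* By symmetry -eta_1 is in the spectrum. It lies in ]-pi^2, 0[, which excludes all multiples of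
     pi, so [u 0] equals some [v k]. The two transcendental equations at this point give rp cot = rm
     cot, and cot is nonzero because coth is; hence rp = rm. *)
  have h1 : sigma (- (u 0%N ^+ 2))%:C.
    rewrite rmorphN; apply/sym; rewrite opprK; apply/specP; constructor 3.
    by exists 1.
  have [/andP[u1 u2] uE _] := uP 0%N; rewrite mul0r mul1r in u1 u2.
  have u20 : 0 < u 0%N ^+ 2 by rewrite exprn_gt0.
  have cinj (a b : R) : a%:C = b%:C -> a = b by move=> [].
  move: h1 => /specP[[k [_ _ /cinj e]]|[k [k1 _ /cinj /oppr_inj e]]|].
  - by have := sqr_ge0 (k%:R * pi : R); rewrite -e oppr_ge0 leNgt u20.
  - have : u 0%N ^+ 2 < (k%:R * pi) ^+ 2.
      rewrite ltr_pXn2r ?nnegrE ?(ltW u1) ?mulr_ge0// ?(ltW p0)//.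
      by apply: (lt_le_trans u2); rewrite ler_peMl// ?(ltW p0)// ler1n.
    by rewrite e ltxx.
  case=> [[[|k]|k] [// _ /cinj e]].
    by have := sqr_ge0 (u k); rewrite /= in e; rewrite -e oppr_ge0 leNgt u20.
  move: e => /= /oppr_inj /eqP; rewrite eqrXn2 ?ltW// => /eqP uv.
  have [_ vE _] := vP k; rewrite -uv uE in vE.
  have sn0 : sin (u 0%N) != 0 by apply: (sin_between_neq0 (k := 0)); rewrite mul0r mul1r u1.
  have ct : coth (u 0%N) != 0.
    by rewrite coth_ch_sh mulf_neq0 ?invr_eq0 ?gt_eqF ?ch_gt0 ?sh_gt0.
  have cc : cot (u 0%N) != 0 by move: ct; rewrite uE mulf_eq0 negb_or => /andP[].
  have /oppr_inj : - rp = - rm by apply: (mulIf cc).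
  rewrite /rp /rm => /eqP; rewrite eqr_div ?lt0r_neq0// -!expr2 eqrXn2 ?ler0n//.
  by rewrite eqr_nat => /eqP.
have rr : rp = rm by rewrite /rp /rm npnm.
(* Equal ratios give the same equation on both half-lines, hence the same roots. *)
have uv : u =1 v by apply: (transcendental_roots_unique uP); rewrite rr.
have ev k : eta (- k) = - eta k.
  by rewrite /eta eta_of_opp; case: k => [[|k]|k] //=; rewrite uv.
have half l : sigma l -> sigma (- l).
  move=> /specP[[k [k1 p2 ->]]|[k [k1 p2 ->]]|[k [k0 ->]]]; apply/specP.
  - by constructor 2; exists k; rewrite -npnm -rmorphN.
  - by constructor 1; exists k; rewrite npnm -rmorphN opprK.
  - by constructor 3; exists (- k); rewrite oppr_eq0 -/eta ev rmorphN.
by move=> l; split=> [|/half]; [exact: half|rewrite opprK].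
Qed.
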